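(* Let $(S,\sigma)$ be a real primary Kodaira surface. Then the real part $S(\mathbb{R})=\mathrm{Fix}(\sigma)$ is either the empty set, or a disjoint union of $t$ tori, where $1\le t\le 4$.
   Context: A primary Kodaira surface is a compact complex surface $S$ of the form $\mathbb{C}^2/G$, where $G\cong\pi_1(S)$ is a properly discontinuous group of affine transformations of $\mathbb{C}^2$ acting without fixed points, leaving the 2-form $dz_1\wedge dz_2$ invariant, and such that $H_1(S,\mathbb{Z})\cong \mathbb{Z}\oplus\mathbb{Z}\oplus\mathbb{Z}\oplus\mathbb{Z}/m$ for some integer $m\ge 1$. A real primary Kodaira surface is a pair $(S,\sigma)$ where $S$ is a primary Kodaira surface and $\sigma:S\to S$ is an antiholomorphic involution ($\sigma^2=\mathrm{id}$). Its real part is the fixed point set $S(\mathbb{R}):=\mathrm{Fix}(\sigma)$. A torus here is a real 2-dimensional torus $S^1\times S^1$. *)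

(* Defs.v *)
From HB Require Import structures.
From mathcomp Require Import all_boot all_order all_algebra.
From mathcomp Require Import generic_quotient ring_quotient.
From mathcomp Require Import all_classical all_reals all_analysis.
From mathcomp Require Import complex.
From mathcomp.multinomials Require Import freeg.

Set Implicit Arguments.
Unset Strict Implicit.
Unset Printing Implicit Defensive.

Import Order.TTheory GRing.Theory Num.Theory.
Import numFieldNormedType.Exports.

Local Open Scope classical_set_scope.
Local Open Scope ring_scope.
Local Open Scope quotient_scope.

Definition homeomorphic (X Y : topologicalType) : Prop :=
  exists (f : X -> Y) (g : Y -> X),
    [/\ continuous f, continuous g, cancel f g & cancel g f].

Section Singular.
Variable R : realType.

Definition simplex n : set 'rV[R]_n.+1 :=
  [set t | (forall i, 0 <= t 0 i) /\ \sum_i t 0 i = 1].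
Arguments simplex n : clear implicits.

Definition face_row n (i : 'I_n.+2) (t : 'rV[R]_n.+1) : 'rV[R]_n.+2 :=
  \row_j (if unlift i j is Some k then t 0 k else 0).

Fact face_subproof n i (t : simplex n) :
  face_row i (set_val t) \in simplex n.+1.
Proof.
have /set_mem[t0 t1] := valP t; apply/mem_set; split=> [j|].
  by rewrite mxE; case: unliftP.
rewrite (bigD1_ord i) //= mxE unlift_none add0r -[RHS]t1.
by apply: eq_bigr => k _; rewrite mxE liftK.
Qed.

Definition face n (i : 'I_n.+2) (t : simplex n) : simplex n.+1 :=
  Sub (face_row i (set_val t)) (face_subproof i t).

Fact face_continuous n (i : 'I_n.+2) : continuous (@face n i).
Proof.
apply: continuous_comp_initial => t A [P Pnear sPA].
have near_j j : \forall s \near t, P 0 j (face_row i (set_val s) 0 j).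
  have := Pnear 0 j; rewrite /= !mxE.
  case E: (unlift i j) => [k|] Pj; last first.
    by near=> s; rewrite mxE E; exact: nbhs_singleton Pj.
  have ck : {for t, continuous (fun s : simplex n => set_val s 0 k)}.
    apply: (@continuous_comp _ _ _ (set_val : simplex n -> _) (fun u => u 0 k)).
      exact: initial_continuous.
    exact: coord_continuous.
  by near=> s; rewrite mxE E; near: s; exact: (ck _ Pj).
have : \forall s \near t, forall j, P 0 j (face_row i (set_val s) 0 j).
  exact: (@filter_forall _ _ (fun j s => P 0 j (face_row i (set_val s) 0 j)) _ _ near_j).
by apply: filterS => s Ps; apply: sPA => r j; rewrite ord1; exact: Ps.
Unshelve. all: by end_near.
Qed.

Variable X : topologicalType.

Definition singular n : set (simplex n -> X) := [set s | continuous s].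
Arguments singular n : clear implicits.

Fact comp_face_subproof n (i : 'I_n.+2) (s : singular n.+1) :
  set_val s \o face i \in singular n.
Proof.
have /set_mem s_cont := valP s; apply/mem_set => t.
by apply: continuous_comp; [exact: face_continuous | exact: s_cont].
Qed.

Definition comp_face n (i : 'I_n.+2) (s : singular n.+1) : singular n :=
  Sub (set_val s \o face i) (comp_face_subproof i s).

Definition chain n : zmodType := {freeg (singular n)}.

Definition chain_boundary n (c : chain n.+1) : chain n :=
  fglift (fun s => \sum_(i < n.+2) (-1) ^+ i *: << comp_face i s >>) c.

Fact chain_boundary_is_additive n : zmod_morphism (@chain_boundary n).
Proof. exact: lift_is_additive. Qed.

HB.instance Definition _ n :=
  GRing.isZmodMorphism.Build (chain n.+1) (chain n) (@chain_boundary n)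
    (@chain_boundary_is_additive n).

Definition cycle1 : {pred chain 1} := fun c => chain_boundary c == 0.

Fact cycle1_zmod_closed : zmod_closed cycle1.
Proof.
split=> [|c d]; rewrite !unfold_in ?raddf0 // => /eqP c0 /eqP d0.
by rewrite raddfB /= c0 d0 subrr.
Qed.

HB.instance Definition _ := GRing.isZmodClosed.Build _ cycle1 cycle1_zmod_closed.

Definition Z1 : Type := {c : chain 1 | c \in cycle1}.

HB.instance Definition _ := SubChoice.on Z1.
HB.instance Definition _ := [SubChoice_isSubZmodule of Z1 by <:].

Definition B1 : {pred Z1} :=
  fun z => `[< exists b : chain 2, chain_boundary b = val z >].

Fact B1_zmod_closed : zmod_closed B1.
Proof.
split=> [|y z]; rewrite !unfold_in.
  by apply/asboolP; exists 0; rewrite !raddf0.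
move=> /asboolP[b by_] /asboolP[c cz]; apply/asboolP; exists (b - c).
by rewrite !raddfB /= by_ cz.
Qed.

HB.instance Definition _ := GRing.isZmodClosed.Build _ B1 B1_zmod_closed.

Definition H1 : zmodType := Quotient.quot B1.
End Singular.

Definition zmod_isomorphic (A B : zmodType) : Prop :=
  exists f : {additive A -> B}, bijective f.

Section Surface.
Variable R : realType.

(* Packaging R[i] as a numClosedFieldType makes its norm topology and complex
   normed-module structure available, so that differentiable over cplx is
   complex differentiability. *)
Definition cplx : numClosedFieldType := R[i].

Notation C2 := 'rV[cplx]_2.

Definition affine (g : C2 -> C2) : Prop :=
  exists (A : 'M[cplx]_2) (b : C2), A \in unitmx /\ forall z, g z = z *m A + b.

Record affine_group := AffineGroup {
  elements :> (C2 -> C2) -> Prop;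
  elements_affine : forall g, elements g -> affine g;
  elements_id : elements id;
  elements_comp : forall g h, elements g -> elements h -> elements (g \o h);
  elements_inv : forall g, elements g ->
    exists h, [/\ elements h, cancel g h & cancel h g] }.

Definition properly_discontinuous (G : affine_group) : Prop :=
  forall K : set C2, compact K ->
    finite_set [set g | G g /\ (g @` K `&` K !=set0)].

Definition acts_freely (G : affine_group) : Prop :=
  forall g z, G g -> g z = z -> g = id.

(* The constant 2-form dz_1 /\ dz_2 evaluated on tangent vectors. *)
Definition dz1dz2 (u v : C2) : cplx := u 0 0 * v 0 1 - u 0 1 * v 0 0.

Definition preserves_dz1dz2 (G : affine_group) : Prop :=
  forall g, G g -> forall z u v : C2,
    dz1dz2 ('d g z u) ('d g z v) = dz1dz2 u v.

Section Quotient.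
Variable G : affine_group.

Definition same_orbit (x y : C2) : bool := `[< exists2 g, G g & g x = y >].

Fact same_orbit_equiv : equiv_class_of same_orbit.
Proof.
split=> [x|x y|y x z].
- by apply/asboolP; exists id; first exact: elements_id.
- apply/asboolP/asboolP => -[g Gg <-]; have [h [Gh gK _]] := elements_inv Gg;
    by exists h.
- move=> /asboolP[g Gg <-] /asboolP[h Gh <-]; apply/asboolP.
  by exists (h \o g); first exact: elements_comp.
Qed.

Canonical same_orbit_equivRel := EquivRelPack same_orbit_equiv.

Definition surface : Type := quotient_topology {eq_quot same_orbit}.
HB.instance Definition _ := Topological.on surface.
HB.instance Definition _ := Quotient.on surface.

Definition surface_pi : C2 -> surface := \pi_surface.

End Quotient.

(* C^2/G is compact, G acts freely and properly discontinuously, preserves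
   dz_1 /\ dz_2, and H_1 = Z^3 + Z/m.  The group Z/m is 'I_m.-1.+1 rather than
   'Z_m because 'Z_1 is Z/2. *)
Definition primary_kodaira (G : affine_group) : Prop :=
  [/\ properly_discontinuous G, acts_freely G, preserves_dz1dz2 G,
      compact [set: surface G] &
      exists2 m : nat, (1 <= m)%N &
        zmod_isomorphic (H1 R (surface G)) (int * int * int * 'I_m.-1.+1)%type].

Definition conj2 (z : C2) : C2 := map_mx Num.conj z.

Definition antiholomorphic_on (U : set C2) (f : C2 -> C2) : Prop :=
  forall z, U z -> differentiable (conj2 \o f) z.

(* The charts of surface G are the local inverses of the projection, so s is
   antiholomorphic iff it is locally covered by antiholomorphic maps of C^2. *)
Definition antiholomorphic (G : affine_group) (s : surface G -> surface G) :
    Prop :=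
  forall z : C2, exists (U : set C2) (f : C2 -> C2),
    [/\ open U, U z, antiholomorphic_on U f &
       forall u, U u -> s (surface_pi G u) = surface_pi G (f u)].

Definition real_part (G : affine_group) (s : surface G -> surface G) :
    set (surface G) :=
  [set x | s x = x].

Definition circle : set (R * R) := [set p | p.1 ^+ 2 + p.2 ^+ 2 = 1].
Definition torus : topologicalType := (circle * circle)%type.
End Surface.

(* Main.v *)
(* Since G is free and volume preserving, its linear parts are unipotent, so in a
   suitable frame G acts by (x, y) |-> (x + a, y + c x + b).  Discreteness and
   cocompactness force c = k a + l conj(a), and the shear (x, y) |-> (x, (y - k x^2/2)/l)
   turns G into a lattice L of left translations of C^2 with the group law
   u * z = (u1 + z1, u2 + z2 + e conj(u1) z1), where e = 0 or e = 1.

   Taking a fixed point of sigma as origin, sigma lifts to an antiholomorphic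
   involution F of C^2 with F(u * z) = F(u) * F(z) for u in L.  Hence conj(F) is entire
   of linear growth along complex lines, and by Liouville's theorem F is conj-linear
   if e = 0 and of the form F(z) = (a conj(z1), |a|^2 conj(z2) + d conj(z1)) if e = 1;
   in both cases F is an automorphism whose fixed group V is isomorphic to R^2.

   A point z lies over a fixed point of sigma iff z * F(z)^-1 is in L.  The set of these
   points is a union of cosets x * V, each of which maps onto a torus, the quotient of
   R^2 by a lattice; the tori correspond to classes of cocycles u in L, u * F(u) = 1,
   modulo u ~ h * u * F(h)^-1.  These are detected by two parities, so that there are at
   most four of them. *)
Require Import Defs.
From HB Require Import structures.
From mathcomp Require Import all_boot all_order all_algebra.
From mathcomp Require Import all_classical all_reals all_analysis.
From mathcomp Require Import complex ring lra.

Set Implicit Arguments.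
Unset Strict Implicit.
Unset Printing Implicit Defensive.

Import Order.TTheory GRing.Theory Num.Theory.
Import numFieldNormedType.Exports.

Local Open Scope classical_set_scope.
Local Open Scope ring_scope.

(** * Goursat's theorem on rectangles *)

Section Goursat.
Variable R : realType.
Implicit Types (f g : R -> R) (u v : R -> R -> R) (a b c x y : R).

(** Liouville's theorem needs bounds on the increments of F. For [e = 0] left translations are
    isometries, and continuity on one compact box bounds the increments everywhere. For [e = 1] the
    term conj(u1) z1 distorts distances without bound. F is then studied on slices, along the fibres
    {x} x C and along the base, where lattice elements act by translation and change a component of
    F by a constant. This requires the base projection of L to be discrete, which follows because
    commutators are central elements of L controlled by base coordinates, and the fibre part of L to
    be cocompact, which follows from that discreteness.

    Of F only antiholomorphy along complex lines is retained, so the analysis is in one variable and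
    uses first derivatives alone. Cauchy's estimate is Goursat's theorem in a logarithmic
    coordinate, where circles become vertical segments.

    In the normal form, c is a real-linear function of a because commutators are translations by a
    discrete set; k and l are its linear and antilinear parts.

    The tori are counted once for both group laws, from a parametrisation of V by R^2 and a
    labelling of cocycle classes by a finite type. *)

Definition segint a b f := \int[@lebesgue_measure R]_(x in `[a, b]) f x.

Lemma continuous_segment_integrable a b f : continuous f ->
  (@lebesgue_measure R).-integrable `[a, b] (EFin \o f).
Proof.
move=> cf; apply: continuous_compact_integrable; first exact: segment_compact.
exact: continuous_subspaceT.
Qed.

Lemma segint_cat a b c f : continuous f -> a <= b -> b <= c ->
  segint a c f = segint a b f + segint b c f.
Proof.
move=> cf ab bc; rewrite /segint -(Rintegral_itv_obnd_cbnd (r := b)); last first.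
  apply: integrableS (continuous_segment_integrable b c cf) => //.
  by move=> x /=; rewrite !in_itv /= => /andP[/ltW -> ->].
rewrite -(@Rintegral_itvB R f (BLeft a) (BRight c) b) ?bnd_simp //.
  by rewrite addrC subrK.
exact: continuous_segment_integrable.
Qed.

Lemma segintB a b f g : continuous f -> continuous g ->
  segint a b (fun x => f x - g x) = segint a b f - segint a b g.
Proof.
by move=> cf cg; rewrite /segint RintegralB //; exact: continuous_segment_integrable.
Qed.

Lemma segint_cst a b c : a <= b -> segint a b (fun=> c) = c * (b - a).
Proof.
move=> ab; rewrite /segint Rintegral_cst //; have := lebesgue_measure_itv `[a, b].
rewrite /= lte_fin => ->; by case: ltgtP ab => //= -> _; rewrite subrr.
Qed.

Lemma segint_bound a b f M : a <= b -> continuous f ->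
  (forall x, a <= x <= b -> `|f x| <= M) -> `|segint a b f| <= M * (b - a).
Proof.
move=> ab cf fM; apply: le_trans (le_normr_Rintegral _ _) _ => //.
  exact: continuous_segment_integrable.
rewrite -segint_cst //; apply: le_Rintegral => //.
- apply: continuous_segment_integrable => x.
  by apply: continuous_comp; [exact: cf|exact: norm_continuous].
- by apply: continuous_segment_integrable => x; exact: cst_continuous.
Qed.

(* Goursat's bisection: a rectangle violating [P] contains a nested sequence of
   violating quarters, shrinking to a point that contradicts the local hypothesis. *)
Lemma quartering_principle (P : R -> R -> R -> R -> Prop) a b c d :
    a <= b -> c <= d ->
    (forall a b c d, a <= b -> c <= d -> let m := (a + b) / 2 in let n := (c + d) / 2 in
       P a m c n -> P a m n d -> P m b c n -> P m b n d -> P a b c d) ->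
    (forall x y, exists2 e, 0 < e & forall a b c d, a <= x <= b -> c <= y <= d ->
       b - a < e -> d - c < e -> P a b c d) ->
  P a b c d.
Proof.
move=> ab cd Pglue Ploc; apply: contrapT => nP.
pose T := {s : (R * R) * (R * R) | [/\ s.1.1 <= s.1.2, s.2.1 <= s.2.2 &
   ~ P s.1.1 s.1.2 s.2.1 s.2.2]}.
pose half (p q : R * R) := p.1 <= q.1 /\ q.2 <= p.2 /\ q.2 - q.1 = (p.2 - p.1) / 2.
have step (s : T) : exists t : T, half (sval s).1 (sval t).1 /\ half (sval s).2 (sval t).2.
  case: s => -[[a1 b1] [c1 d1]] [/= ab1 cd1 nP1].
  apply: contrapT => nt; have sub a' b' c' d' : half (a1, b1) (a', b') ->
      half (c1, d1) (c', d') -> a' <= b' -> c' <= d' -> P a' b' c' d'.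
    move=> hab hcd ab' cd'; apply: contrapT => nP'; apply: nt.
    by exists (exist _ ((a', b'), (c', d')) (And3 ab' cd' nP')).
  by apply: nP1; apply: Pglue => //; apply: sub; rewrite /half /=; lra.
have [nxt nxtP] := choice step.
have s0P : [/\ a <= b, c <= d & ~ P a b c d] by [].
pose s n := iter n nxt (exist _ ((a, b), (c, d)) s0P : T).
pose lo (k : bool) n := (if k then (sval (s n)).1 else (sval (s n)).2).1.
pose hi (k : bool) n := (if k then (sval (s n)).1 else (sval (s n)).2).2.
have lohi k n : lo k n <= hi k n.
  by rewrite /lo /hi; case: (s n) => -[[? ?] [? ?]] [/= ? ? _]; case: k.
have hS k n : half (lo k n, hi k n) (lo k n.+1, hi k n.+1).
  have [] := nxtP (s n); rewrite /lo /hi /=.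
  by move: (sval (s n)) (sval (nxt (s n))) => [[? ?] [? ?]] [[? ?] [? ?]]; case: k.
have lo_mono k : {homo lo k : m n / (m <= n)%N >-> m <= n}.
  by apply: homo_leq => // [x y z|n]; [exact: le_trans | have [] := hS k n].
have hi_mono k : {homo hi k : m n / (m <= n)%N >-> n <= m}.
  apply: (@homo_leq _ _ (fun p q => q <= p)) => // [x y z h1 h2|n]; first exact: le_trans h1.
  by have [_ []] := hS k n.
have lohi2 k m n : lo k m <= hi k n.
  apply: (le_trans (lo_mono k _ _ (leq_maxl m n))).
  by apply: (le_trans (lohi k _)); exact: hi_mono (leq_maxr m n).
pose L k := sup (range (lo k)).
have LP k n : lo k n <= L k <= hi k n.
  apply/andP; split.
    apply: ub_le_sup; last by exists n.
    by exists (hi k 0%N) => _ [m _ <-].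
  apply: ge_sup; first by exists (lo k 0%N), 0%N.
  by move=> _ [m _ <-].
have dist k n : hi k n - lo k n = (hi k 0%N - lo k 0%N) / 2 ^+ n.
  elim: n => [|n IH]; first by rewrite expr0 divr1.
  have [_ [_ /= ->]] := hS k n; rewrite IH exprS invfM; lra.
have [e e0 Pe] := Ploc (L true) (L false).
have small k : \forall n \near \oo, hi k n - lo k n < e.
  pose D := hi k 0%N - lo k 0%N; have D0 : 0 <= D by rewrite subr_ge0.
  have g0 : geometric D 2^-1 @ \oo --> (0 : R).
    by apply: cvg_geometric; rewrite ger0_norm; lra.
  move/cvgrPdist_lt : g0 => /(_ _ e0) g0; near=> n; rewrite dist -exprVn.
  have : `|0 - geometric D 2^-1 n| < e by near: n; exact: g0.
  by rewrite sub0r normrN /= ger0_norm // mulr_ge0 // exprn_ge0 // invr_ge0.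
have [N _ smallN] : \forall n \near \oo, hi true n - lo true n < e /\ hi false n - lo false n < e.
  by near=> n; split; near: n; exact: small.
have [small1 small2] := smallN N (leqnn N).
have [] := svalP (s N); move: (Pe _ _ _ _ (LP true N) (LP false N) small1 small2).
by rewrite /lo /hi.
Unshelve. all: by end_near.
Qed.

(** Frechet differentiability of [u + i v] with complex derivative [p + i q]. Nothing is said about
    continuity of the derivative, hence Goursat's argument rather than Green's formula. *)
Definition cauchy_riemann u v := forall x0 y0, exists p q, forall e, 0 < e ->
  exists2 d, 0 < d & forall x y, `|x - x0| < d -> `|y - y0| < d ->
    `|u x y - (u x0 y0 + p * (x - x0) - q * (y - y0))| <= e * (`|x - x0| + `|y - y0|) /\
    `|v x y - (v x0 y0 + q * (x - x0) + p * (y - y0))| <= e * (`|x - x0| + `|y - y0|).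

(** The real part of the counterclockwise contour integral of [u + i v] around the rectangle. *)
Definition rectint u v a b c d :=
  segint a b (fun x => u x c - u x d) - segint c d (fun y => v b y - v a y).

(** The bound [e] times the squared half-perimeter passes from the quarters to the whole, since four
    quarters have half the perimeter each. On small rectangles it is the first-order error, as the
    linear part integrates to 0. *)
Lemma goursat u v a b c d : a <= b -> c <= d -> cauchy_riemann u v ->
  (forall y, continuous (u^~ y)) -> (forall x, continuous (v x)) ->
  rectint u v a b c d = 0.
Proof.
move=> ab cd CR cu cv.
have cuB y1 y2 : continuous (fun x => u x y1 - u x y2).
  by move=> x; apply: cvgB; exact: cu.
have cvB y1 y2 : continuous (fun x => v y1 x - v y2 x).
  by move=> x; apply: cvgB; exact: cv.
suff le_e e : 0 < e -> `|rectint u v a b c d| <= e * (b - a + (d - c)) ^+ 2.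
  apply/eqP; rewrite -normr_le0; apply/ler_addgt0Pl => e e0; rewrite addr0.
  set K := (b - a + (d - c)) ^+ 2 in le_e.
  have K0 : 0 <= K by exact: sqr_ge0.
  have K1 : 0 < K + 1 by rewrite ltr_wpDl.
  apply: (le_trans (le_e (e / (K + 1)) _)); first exact: divr_gt0.
  rewrite mulrAC ler_pdivrMr //; apply: ler_wpM2l; first exact: ltW.
  lra.
move=> e0; apply: (@quartering_principle (fun a b c d =>
  `|rectint u v a b c d| <= e * (b - a + (d - c)) ^+ 2)) => // {ab cd a b c d}.
- move=> a b c d ab cd m n; set Q1 := rectint _ _ _ _ _ _ => H1.
  set Q2 := rectint _ _ _ _ _ _ => H2; set Q3 := rectint _ _ _ _ _ _ => H3.
  set Q4 := rectint _ _ _ _ _ _ => H4.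
  have am : a <= m by rewrite /m; lra. have mb : m <= b by rewrite /m; lra.
  have cn : c <= n by rewrite /n; lra. have nd : n <= d by rewrite /n; lra.
  have -> : rectint u v a b c d = Q1 + Q2 + Q3 + Q4.
    rewrite /Q1 /Q2 /Q3 /Q4 /rectint !segintB //.
    rewrite (segint_cat (cu c) am mb) (segint_cat (cu d) am mb).
    by rewrite (segint_cat (cv a) cn nd) (segint_cat (cv b) cn nd); ring.
  have : `|Q1 + Q2 + Q3 + Q4| <= `|Q1| + `|Q2| + `|Q3| + `|Q4|.
    by do 3! (apply: (le_trans (ler_normD _ _)); rewrite lerD2r).
  move=> /le_trans; apply.
  apply: le_trans (lerD (lerD (lerD H1 H2) H3) H4) _.
  by rewrite /m /n le_eqVlt; apply/orP; left; apply/eqP; field.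
- move=> x0 y0; have [p [q pq]] := CR x0 y0.
  (* Each side integral below involves two values of the same function, each with error at most
     [e / 2 * s]. *)
  have [|del del0 apx] := pq (e / 2); first by rewrite divr_gt0.
  exists del => // a b c d /andP[ax xb] /andP[cy yd] bae dce.
  have ab : a <= b by lra. have cd : c <= d by lra.
  pose s := b - a + (d - c).
  have s0 : 0 <= s by rewrite /s; lra.
  pose lu x y := u x0 y0 + p * (x - x0) - q * (y - y0).
  pose lv x y := v x0 y0 + q * (x - x0) + p * (y - y0).
  have bnd x y : a <= x <= b -> c <= y <= d ->
      `|u x y - lu x y| <= e / 2 * s /\ `|v x y - lv x y| <= e / 2 * s.
    move=> /andP[ax' xb'] /andP[cy' yd'].
    have xx0 : `|x - x0| <= b - a by rewrite ler_norml; lra.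
    have yy0 : `|y - y0| <= d - c by rewrite ler_norml; lra.
    have [||H1 H2] := apx x y; [exact: le_lt_trans bae|exact: le_lt_trans dce|].
    by split; apply: (le_trans H1) || apply: (le_trans H2);
      rewrite ler_pM2l ?divr_gt0 // lerD.
  (* Subtracting the linear part changes nothing: both constants integrate to
     [q * (b - a) * (d - c)], and they cancel. *)
  have -> : rectint u v a b c d =
     segint a b (fun x => u x c - u x d - q * (d - c)) -
     segint c d (fun y => v b y - v a y - q * (b - a)).
    rewrite /rectint (segintB _ _ (cuB c d) (@cst_continuous _ _ _)).
    rewrite (segintB _ _ (cvB b a) (@cst_continuous _ _ _)) !segint_cst //; ring.
  have B1 : `|segint a b (fun x => u x c - u x d - q * (d - c))| <= e * s * (b - a).
    apply: segint_bound => // [x|x xab].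
      by apply: cvgB; [exact: cuB|exact: cvg_cst].
    have [|H1 _] := bnd x c xab; first lra.
    have [|H2 _] := bnd x d xab; first lra.
    have -> : u x c - u x d - q * (d - c) = (u x c - lu x c) - (u x d - lu x d).
      by rewrite /lu; ring.
    apply: (le_trans (ler_normB _ _)); apply: (le_trans (lerD H1 H2)); lra.
  have B2 : `|segint c d (fun y => v b y - v a y - q * (b - a))| <= e * s * (d - c).
    apply: segint_bound => // [y|y ycd].
      by apply: cvgB; [exact: cvB|exact: cvg_cst].
    have [||_ H1] := bnd b y; [lra|by []|].
    have [||_ H2] := bnd a y; [lra|by []|].
    have -> : v b y - v a y - q * (b - a) = (v b y - lv b y) - (v a y - lv a y).
      by rewrite /lv; ring.
    apply: (le_trans (ler_normB _ _)); apply: (le_trans (lerD H1 H2)); lra.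
  apply: (le_trans (ler_normB _ _)); apply: (le_trans (lerD B1 B2)).
  by rewrite le_eqVlt; apply/orP; left; apply/eqP; rewrite /s; ring.
Qed.

End Goursat.

(** * Real coordinates and the exponential on the complex field *)

Section ComplexNorm.
Variable R : realType.
Notation C := (cplx R).
Implicit Types (z w : C) (x y : R).

(* The norm of [cplx R] takes its values in [cplx R] itself; [nrm] is the real modulus. *)
Definition nrm (z : C) : R := Normc.normc (z : R[i]).
Definition rc (x : R) : C := real_complex R x.
Definition mkc x y : C := Complex x y.
Definition re (z : C) : R := complex.Re z.
Definition im (z : C) : R := complex.Im z.

Lemma normE z : `|z| = rc (nrm z). Proof. by []. Qed.
Lemma nrm_ge0 z : 0 <= nrm z.
Proof. by case: z => a b; exact: sqrtr_ge0. Qed.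
Lemma nrm0 : nrm 0 = 0. Proof. exact: Normc.normc0. Qed.
Lemma nrm_eq0 z : nrm z = 0 -> z = 0. Proof. exact: Normc.eq0_normc. Qed.
Lemma nrmM z w : nrm (z * w) = nrm z * nrm w. Proof. exact: Normc.normcM. Qed.
Lemma nrmV z : nrm z^-1 = (nrm z)^-1. Proof. exact: Normc.normcV. Qed.
Lemma nrmD z w : nrm (z + w) <= nrm z + nrm w. Proof. exact: le_normcD. Qed.
Lemma nrmN z : nrm (- z) = nrm z. Proof. exact: normcN. Qed.
Lemma nrmB z w : nrm (z - w) <= nrm z + nrm w.
Proof. by rewrite -(nrmN w); exact: nrmD. Qed.
Lemma nrm_distC z w : nrm (z - w) = nrm (w - z).
Proof. by rewrite -nrmN opprB. Qed.
Lemma nrmJ z : nrm z^* = nrm z.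
Proof. by case: z => a b; rewrite /nrm /= sqrrN. Qed.
Lemma nrm_rc x : nrm (rc x) = `|x|.
Proof. by rewrite /nrm /= expr0n addr0 sqrtr_sqr. Qed.
Lemma nrm_gt0 z : z != 0 -> 0 < nrm z.
Proof.
by move=> z0; rewrite lt_neqAle nrm_ge0 andbT eq_sym; apply: contra z0 => /eqP/nrm_eq0 ->.
Qed.
Lemma re_le z : `|re z| <= nrm z.
Proof.
by case: z => a b; rewrite /nrm /= -sqrtr_sqr ler_wsqrtr // lerDl sqr_ge0.
Qed.
Lemma im_le z : `|im z| <= nrm z.
Proof.
by case: z => a b; rewrite /nrm /= -sqrtr_sqr ler_wsqrtr // lerDr sqr_ge0.
Qed.
Lemma nrm_le z : nrm z <= `|re z| + `|im z|.
Proof.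
case: z => a b; rewrite /nrm /= -[leRHS]ger0_norm ?addr_ge0 // -sqrtr_sqr.
rewrite ler_wsqrtr // sqrrD !real_normK ?num_real // -addrA lerD2l lerDr.
by rewrite mulrn_wge0 // mulr_ge0.
Qed.

Lemma reE z : rc (re z) = (z + z^*) / 2. Proof. exact: ReJ_add. Qed.
Lemma reD z w : re (z + w) = re z + re w. Proof. by case: z w => ? ? []. Qed.
Lemma imD z w : im (z + w) = im z + im w. Proof. by case: z w => ? ? []. Qed.
Lemma reN z : re (- z) = - re z. Proof. by case: z. Qed.
Lemma imN z : im (- z) = - im z. Proof. by case: z. Qed.
Lemma reB z w : re (z - w) = re z - re w. Proof. by rewrite reD reN. Qed.
Lemma imB z w : im (z - w) = im z - im w. Proof. by rewrite imD imN. Qed.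
Lemma reM z w : re (z * w) = re z * re w - im z * im w.
Proof. by case: z w => ? ? []. Qed.
Lemma imM z w : im (z * w) = re z * im w + im z * re w.
Proof. by case: z w => ? ? [? ?]; rewrite /im /re /= addrC. Qed.
Lemma ceq z w : re z = re w -> im z = im w -> z = w.
Proof. by case: z w => ? ? [? ?]; rewrite /re /im /= => -> ->. Qed.
Lemma rcD x y : rc (x + y) = rc x + rc y. Proof. exact: rmorphD. Qed.
Lemma rcB x y : rc (x - y) = rc x - rc y. Proof. exact: rmorphB. Qed.
Lemma rcM x y : rc (x * y) = rc x * rc y. Proof. exact: rmorphM. Qed.
Lemma rcV x : rc x^-1 = (rc x)^-1. Proof. exact: fmorphV. Qed.
Lemma rc0 : rc 0 = 0. Proof. by []. Qed.
Lemma rc1 : rc 1 = 1. Proof. by []. Qed.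
Lemma rcJ x : (rc x)^* = rc x. Proof. exact: conjc_real. Qed.
Lemma rc_nat n : rc n%:R = n%:R. Proof. exact: rmorph_nat. Qed.
Lemma rc_int (n : int) : rc n%:~R = n%:~R. Proof. exact: rmorph_int. Qed.
Lemma rc_lt x y : (rc x < rc y) = (x < y). Proof. exact: ltcR. Qed.
Lemma re_rc x : re (rc x) = x. Proof. by []. Qed.
Lemma im_rc x : im (rc x) = 0. Proof. by []. Qed.
Lemma reJ z : re z^* = re z. Proof. by case: z. Qed.
Lemma imJ z : im z^* = - im z. Proof. by case: z. Qed.
Lemma gt0_rc z : 0 < z -> z = rc (re z) /\ 0 < re z.
Proof.
by case: z => a b; rewrite ltcE /= => /andP[/eqP -> a0]; split.
Qed.

Lemma nbhs_nrm z (P : set C) :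
  nbhs z P <-> exists2 e : R, 0 < e & forall w, nrm (w - z) < e -> P w.
Proof.
split=> [/nbhs_normP[e /= /gt0_rc[-> e0] eP]|[e e0 eP]].
  by exists (re e) => // w we; apply: eP; rewrite /ball_ /= normE rc_lt nrm_distC.
apply/nbhs_normP; exists (rc e) => /=; first by rewrite rc_lt.
by move=> w; rewrite /ball_ /= normE rc_lt nrm_distC; exact: eP.
Qed.

Lemma cvg_nrm (T : Type) (F : set_system T) (FF : Filter F) (f : T -> C) z :
  f @ F --> z <-> forall e : R, 0 < e -> \forall t \near F, nrm (f t - z) < e.
Proof.
split=> [fz e e0|fz].
  by apply: (fz [set w | nrm (w - z) < e]); apply/nbhs_nrm; exists e.
move=> P /nbhs_nrm[e e0 eP]; by apply: filterS (fz e e0) => t; exact: eP.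
Qed.

Lemma re_continuous : continuous re.
Proof.
move=> z; apply/(@cvgrPdist_lt _ _ _ (nbhs z)) => e e0; apply/nbhs_nrm; exists e => // w we.
by rewrite distrC -reB (le_lt_trans (re_le _)).
Qed.
Lemma im_continuous : continuous im.
Proof.
move=> z; apply/(@cvgrPdist_lt _ _ _ (nbhs z)) => e e0; apply/nbhs_nrm; exists e => // w we.
by rewrite distrC -imB (le_lt_trans (im_le _)).
Qed.
Lemma nrm_continuous : continuous nrm.
Proof.
move=> z; apply/(@cvgrPdist_lt _ _ _ (nbhs z)) => e e0; apply/nbhs_nrm; exists e => // w we.
apply: le_lt_trans we; rewrite ler_norml; have := nrmB (w - z) w; have := nrmD (w - z) z.
by rewrite subrK addrAC subrr sub0r nrmN; lra.
Qed.

Lemma cvg_mkc (T : Type) (F : set_system T) (FF : Filter F) (f g : T -> R) x y :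
  f @ F --> x -> g @ F --> y -> (fun t => mkc (f t) (g t)) @ F --> mkc x y.
Proof.
move=> /cvgrPdist_lt fx /cvgrPdist_lt gy; apply/cvg_nrm => e e0.
have e20 : 0 < e / 2 by rewrite divr_gt0.
near=> t; apply: (le_lt_trans (nrm_le _)); rewrite reB imB /re /im /=.
have H1 : `|x - f t| < e / 2 by near: t; exact: fx.
have H2 : `|y - g t| < e / 2 by near: t; exact: gy.
by rewrite distrC (distrC (g t)); lra.
Unshelve. all: by end_near.
Qed.

Lemma rc_continuous : continuous rc.
Proof. by move=> x; apply: cvg_mkc; [exact: cvg_id | exact: cvg_cst]. Qed.

(** Replaces the difference quotient by an error bound between real numbers that is also valid at
    [h = 0]; most of the derivative estimates on C use this form. *)
Lemma is_derive_nrm (f : C -> C) z d : is_derive z 1 f d <->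
  forall e, 0 < e -> exists2 r, 0 < r & forall h, nrm h < r ->
    nrm (f (z + h) - f z - d * h) <= e * nrm h.
Proof.
split=> [fd e e0|fd].
  have : derivable f z 1 by exact: ex_derive.
  rewrite /derivable => /cvg_ex[l fl].
  have ld : l = d by rewrite -[RHS](@derive_val _ _ _ _ _ _ _ fd); symmetry; exact: cvg_lim.
  rewrite {}ld {l} in fl.
  move/cvg_nrm: fl => /(_ e e0); rewrite /= /dnbhs near_withinE => /nbhs_nrm[r r0 re_].
  exists r => // h hr; have [->|h0] := eqVneq h 0.
    by rewrite mulr0 addr0 !subrr nrm0 mulr0.
  have := re_ h; rewrite subr0 => /(_ hr h0) /ltW.
  rewrite -(ler_pM2r (nrm_gt0 h0)) -nrmM; congr (nrm _ <= _).
  by rewrite /GRing.scale /= [h * 1]mulr1 [h + z]addrC; field.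
have dl : (fun h => h^-1 *: ((f \o shift z) (h *: (1 : C)) - f z)) @ (0 : C)^' --> d.
  apply/cvg_nrm => e e0; have [|r r0 re_] := fd (e / 2); first by rewrite divr_gt0.
  rewrite /= /dnbhs near_withinE; apply/nbhs_nrm; exists r => // h; rewrite subr0 => hr h0.
  rewrite -(ltr_pM2r (nrm_gt0 h0)) -nrmM.
  have := re_ h hr; have := nrm_gt0 h0; set n := nrm h => n0 H.
  apply: (@le_lt_trans _ _ (e / 2 * n)); last by rewrite ltr_pM2r // ltr_pdivrMr // ltr_pMr // ltr1n.
  apply: le_trans H; rewrite le_eqVlt; apply/orP; left; apply/eqP; congr nrm.
  by rewrite /GRing.scale /= [h * 1]mulr1 [h + z]addrC; field.
by split; [apply/cvg_ex; exists d | exact: cvg_lim].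
Qed.

Lemma is_derive_expansion (f : R -> R) x d : is_derive x 1 f d ->
  forall e, 0 < e -> exists2 r, 0 < r & forall h, `|h| < r ->
    `|f (x + h) - f x - d * h| <= e * `|h|.
Proof.
move=> fd e e0; have : derivable f x 1 by exact: ex_derive.
rewrite /derivable => /cvg_ex[l fl].
have ld : l = d by rewrite -[RHS](@derive_val _ _ _ _ _ _ _ fd); symmetry; exact: cvg_lim.
rewrite {}ld {l} in fl.
move/cvgrPdist_lt: fl => /(_ e e0); rewrite /= /dnbhs near_withinE => /nbhs_ballP[r /= r0 re_].
exists r => // h hr; have [->|h0] := eqVneq h 0.
  by rewrite mulr0 addr0 !subrr normr0 mulr0.
have := re_ h; rewrite /ball /= sub0r normrN => /(_ hr h0) /ltW; rewrite distrC.
have hp : 0 < `|h| by rewrite normr_gt0.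
rewrite -(ler_pM2r hp) -normrM; congr (`| _ | <= _).
by rewrite /GRing.scale /= [h * 1]mulr1 [h + x]addrC; field.
Qed.

Definition cexp z : C := mkc (expR (re z) * cos (im z)) (expR (re z) * sin (im z)).

Lemma cexpD z w : cexp (z + w) = cexp z * cexp w.
Proof.
apply: ceq; rewrite ?reM ?imM /cexp /re /im /= -/(re _) -/(im _) reD imD expRD ?cosD ?sinD; ring.
Qed.
Lemma cexp0 : cexp 0 = 1.
Proof. by apply: ceq; rewrite /cexp /re /im /= expR0 ?cos0 ?sin0 ?mulr1 ?mulr0. Qed.
Lemma cexpVM z : cexp z * cexp (- z) = 1.
Proof. by rewrite -cexpD subrr cexp0. Qed.
Lemma cexpN z : cexp (- z) = (cexp z)^-1.
Proof.
have H := cexpVM z; have z0 : cexp z != 0.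
  by apply/eqP => z0; move: H; rewrite z0 mul0r => /esym/eqP; rewrite oner_eq0.
by apply: (mulfI z0); rewrite H mulfV.
Qed.
Lemma nrm_cexp z : nrm (cexp z) = expR (re z).
Proof.
by rewrite /nrm /= !exprMn -mulrDr cos2Dsin2 mulr1 sqrtr_sqr ger0_norm // expR_ge0.
Qed.

(** Differentiability at 0 is enough: the addition formula carries it to every point. *)
Lemma is_derive_cexp0 : is_derive (0 : C) 1 cexp 1.
Proof.
apply/is_derive_nrm => e e0.
(* The two coordinates will contribute [3 * e1 * n] and [5 * e1 * n], together below [e * n]; the
   cap 1 lets products of small terms be bounded linearly. *)
pose e1 := Num.min (e / 10) 1.
have e10 : 0 < e1 by rewrite lt_min ltr01 divr_gt0.
have e1e : e1 <= e / 10 by rewrite ge_min lexx.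
have e11 : e1 <= 1 by rewrite ge_min lexx orbT. clearbody e1.
have [r1 r10 H1] := is_derive_expansion (is_derive_expR 0) e10.
have [r2 r20 H2] := is_derive_expansion (is_derive_cos (0 : R)) e10.
have [r3 r30 H3] := is_derive_expansion (is_derive_sin (0 : R)) e10.
pose r := Num.min (Num.min r1 r2) (Num.min r3 e1).
exists r; first by rewrite !lt_min r10 r20 r30 e10.
move=> h; rewrite !lt_min => /andP[/andP[h1 h2] /andP[h3 he]].
rewrite add0r cexp0 mul1r; apply: (le_trans (nrm_le _)).
rewrite reB imB /cexp reB imB /re /im /= -/(re _) -/(im _) subr0.
set x := re h; set y := im h.
have xh : `|x| <= nrm h := re_le h; have yh : `|y| <= nrm h := im_le h.
have := H1 x (le_lt_trans xh h1); rewrite add0r expR0 mul1r => A1.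
have := H2 y (le_lt_trans yh h2); rewrite add0r cos0 sin0 oppr0 mul0r subr0 => A2.
have := H3 y (le_lt_trans yh h3); rewrite add0r cos0 sin0 mul1r subr0 => A3.
set n := nrm h in xh yh h1 h2 h3 he *.
have n0 : 0 <= n := nrm_ge0 h.
have C1 : `|cos y| <= 1 by rewrite ler_norml cos_geN1 cos_le1.
have B1 : `|expR x * cos y - 1 - x| <= 3 * e1 * n.
  have -> : expR x * cos y - 1 - x = (expR x - 1 - x) * cos y + (1 + x) * (cos y - 1) by ring.
  apply: (le_trans (ler_normD _ _)); rewrite !normrM.
  have T1 : `|expR x - 1 - x| * `|cos y| <= e1 * n.
    rewrite -[leRHS]mulr1; apply: ler_pM => //; apply: (le_trans A1).
    by rewrite ler_pM2l.
  have T2 : `|1 + x| * `|cos y - 1| <= 2 * (e1 * n).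
    apply: ler_pM => //; last by apply: (le_trans A2); rewrite ler_pM2l.
    by apply: (le_trans (ler_normD _ _)); rewrite normr1; lra.
  lra.
have B2 : `|expR x * sin y - y| <= 5 * e1 * n.
  have -> : expR x * sin y - y = (expR x - 1) * sin y + (sin y - y) by ring.
  apply: (le_trans (ler_normD _ _)); rewrite normrM.
  have T1 : `|expR x - 1| <= 2 * e1.
    have -> : expR x - 1 = (expR x - 1 - x) + x by ring.
    apply: (le_trans (ler_normD _ _)).
    have : e1 * `|x| <= e1 * 1 by rewrite ler_pM2l //; lra.
    lra.
  have T2 : `|sin y| <= 2 * n.
    have -> : sin y = (sin y - y) + y by ring.
    apply: (le_trans (ler_normD _ _)).
    have : e1 * `|y| <= 1 * n by apply: ler_pM => //; exact: ltW.
    lra.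
  have T3 : `|expR x - 1| * `|sin y| <= 2 * e1 * (2 * n) by apply: ler_pM.
  have T4 : e1 * `|y| <= e1 * n by rewrite ler_pM2l.
  lra.
have E1 : e1 * n <= e / 10 * n by apply: ler_wpM2r.
have E2 : 0 <= e * n by rewrite mulr_ge0 // ltW.
apply: (le_trans (lerD B1 B2)); lra.
Qed.

Lemma is_derive_cexp z : is_derive z 1 cexp (cexp z).
Proof.
apply/is_derive_nrm => e e0; have := is_derive_cexp0 => /is_derive_nrm.
have n0 : 0 < nrm (cexp z) by rewrite nrm_cexp expR_gt0.
move=> /(_ (e / nrm (cexp z))) [|r r0 H]; first by rewrite divr_gt0.
exists r => // h /H; rewrite add0r cexp0 mul1r => {}H.
have -> : cexp (z + h) - cexp z - cexp z * h = cexp z * (cexp h - 1 - h).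
  by rewrite cexpD; ring.
by rewrite nrmM mulrC -ler_pdivlMr // mulrAC.
Qed.

End ComplexNorm.

(** * Entire functions of linear growth *)

Section Liouville.
Variable R : realType.
Notation C := (cplx R).
Implicit Types (z w : C) (x y : R) (f g df : C -> C).

Lemma is_derive_of_expansion (f : R -> R) x d :
  (forall e, 0 < e -> exists2 r, 0 < r & forall h, `|h| < r ->
    `|f (x + h) - f x - d * h| <= e * `|h|) -> is_derive x 1 f d.
Proof.
move=> fd.
have dl : (fun h => h^-1 *: ((f \o shift x) (h *: (1 : R)) - f x)) @ (0 : R)^' --> d.
  apply/cvgrPdist_lt => e e0; have [|r r0 re_] := fd (e / 2); first by rewrite divr_gt0.
  rewrite /= /dnbhs near_withinE; apply/nbhs_ballP; exists r => // h.
  rewrite /ball /= sub0r normrN => hr h0.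
  have hp : 0 < `|h| by rewrite normr_gt0.
  rewrite distrC -(ltr_pM2r hp) -normrM.
  apply: (@le_lt_trans _ _ (e / 2 * `|h|)); last by rewrite ltr_pM2r // ltr_pdivrMr // ltr_pMr // ltr1n.
  apply: le_trans (re_ h hr); rewrite le_eqVlt; apply/orP; left; apply/eqP; congr (`| _ |).
  by rewrite /GRing.scale /= [h * 1]mulr1 [h + x]addrC; field.
by split; [apply/cvg_ex; exists d | exact: cvg_lim].
Qed.

Lemma is_derive_ccomp f g z (a b : C) :
  is_derive (g z) 1 f a -> is_derive z 1 g b -> is_derive z 1 (f \o g) (a * b).
Proof.
move=> /is_derive_nrm fa /is_derive_nrm gb; apply/is_derive_nrm => e e0.
have na := nrm_ge0 a; have nb := nrm_ge0 b.
have a1 : 0 < nrm a + 1 by rewrite ltr_wpDl.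
have b1 : 0 < nrm b + 1 by rewrite ltr_wpDl.
(* The constants make each of the two error terms, one from [f] and one from [g] multiplied by [a],
   at most [e / 2 * nrm h]. *)
pose e1 := Num.min 1 (e / (2 * (nrm a + 1))).
have e10 : 0 < e1 by rewrite lt_min ltr01 divr_gt0 // mulr_gt0.
have e11 : e1 <= 1 by rewrite ge_min lexx.
have e1a : nrm a * e1 <= e / 2.
  have : e1 <= e / (2 * (nrm a + 1)) by rewrite ge_min lexx orbT.
  rewrite ler_pdivlMr ?mulr_gt0 // => H.
  have : 0 <= e1 by exact: ltW.
  lra.
clearbody e1.
have [|r2 r20 H2] := fa (e / (2 * (nrm b + 1))); first by rewrite divr_gt0 // mulr_gt0.
have [r1 r10 H1] := gb e1 e10.
exists (Num.min r1 (r2 / (nrm b + 1))); first by rewrite lt_min r10 divr_gt0.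
move=> h; rewrite lt_min => /andP[hr1]; rewrite ltr_pdivlMr // => hr2.
have nh := nrm_ge0 h.
set k := g (z + h) - g z.
have K1 : nrm (k - b * h) <= e1 * nrm h := H1 h hr1.
have K2 : nrm k <= (nrm b + 1) * nrm h.
  have -> : k = (k - b * h) + b * h by ring.
  apply: (le_trans (nrmD _ _)); rewrite nrmM.
  have : e1 * nrm h <= 1 * nrm h by apply: ler_wpM2r.
  lra.
have K3 : nrm (f (g z + k) - f (g z) - a * k) <= e / (2 * (nrm b + 1)) * nrm k.
  by apply: H2; apply: (le_lt_trans K2); rewrite mulrC.
have -> : (f \o g) (z + h) - (f \o g) z - a * b * h =
    (f (g z + k) - f (g z) - a * k) + a * (k - b * h).
  have -> : g z + k = g (z + h) by rewrite /k addrC subrK.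
  by rewrite /= /k; ring.
apply: (le_trans (nrmD _ _)); rewrite nrmM.
have T1 : e / (2 * (nrm b + 1)) * nrm k <= e / 2 * nrm h.
  rewrite invfM mulrA -[leLHS]mulrA; apply: ler_wpM2l; first by rewrite divr_ge0 // ltW.
  by rewrite mulrC ler_pdivrMr // mulrC.
have T2 : nrm a * nrm (k - b * h) <= nrm a * (e1 * nrm h) by apply: ler_wpM2l.
have T3 : nrm a * e1 * nrm h <= e / 2 * nrm h by apply: ler_wpM2r.
lra.
Qed.

Lemma is_derive_continuous f df : (forall z, is_derive z 1 f (df z)) -> continuous f.
Proof.
move=> fd z; apply: differentiable_continuous; apply/derivable1_diffP.
exact: (@ex_derive _ _ _ _ _ _ _ (fd z)).
Qed.

Lemma is_derive_cst_mul f z (a d : C) : is_derive z 1 f d -> is_derive z 1 (fun w => a * f w) (a * d).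
Proof. by move=> fd; apply: is_deriveZ. Qed.

Lemma is_derive_copp z : is_derive z 1 (fun w : C => - w) (-1 : C).
Proof.
apply/is_derive_nrm => e e0; exists 1 => // h _.
have -> : - (z + h) - - z - -1 * h = 0 by ring.
by rewrite nrm0 mulr_ge0 ?nrm_ge0 // ltW.
Qed.

Lemma is_derive_shift f (z a d : C) :
  is_derive (a + z) 1 f d -> is_derive z 1 (fun w => f (a + w)) d.
Proof.
move=> /is_derive_nrm fd; apply/is_derive_nrm => e e0.
by have [r r0 H] := fd e e0; exists r => // h /H; rewrite addrA.
Qed.

Lemma is_derive_cauchy_riemann f df : (forall z, is_derive z 1 f (df z)) ->
  cauchy_riemann (fun x y => re (f (mkc x y))) (fun x y => im (f (mkc x y))).
Proof.
move=> fd x0 y0; exists (re (df (mkc x0 y0))), (im (df (mkc x0 y0))) => e e0.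
have := fd (mkc x0 y0) => /is_derive_nrm /(_ e e0)[r r0 H].
exists (r / 2) => [|x y xr yr]; first by rewrite divr_gt0.
have E : mkc x y = mkc x0 y0 + mkc (x - x0) (y - y0).
  by apply: ceq; rewrite ?reD ?imD /re /im /=; ring.
have nh : nrm (mkc (x - x0) (y - y0)) <= `|x - x0| + `|y - y0| by exact: nrm_le.
have /H : nrm (mkc (x - x0) (y - y0)) < r by lra.
rewrite -E => {}H.
set D := df _ in H *; set Z := f (mkc x y) in H *; set Z0 := f _ in H *.
have {}H : nrm (Z - Z0 - D * mkc (x - x0) (y - y0)) <= e * (`|x - x0| + `|y - y0|).
  by apply: (le_trans H); rewrite ler_pM2l.
split.
- have -> : re Z - (re Z0 + re D * (x - x0) - im D * (y - y0)) =
     re (Z - Z0 - D * mkc (x - x0) (y - y0)) by rewrite !reB reM /=; ring.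
  exact: le_trans (re_le _) H.
- have -> : im Z - (im Z0 + im D * (x - x0) + re D * (y - y0)) =
     im (Z - Z0 - D * mkc (x - x0) (y - y0)) by rewrite !imB imM /=; ring.
  exact: le_trans (im_le _) H.
Qed.

Lemma cexp_period x : cexp (mkc x (pi *+ 2)) = cexp (mkc x 0) :> C.
Proof. by rewrite /cexp /re /im /= cos2pi sin2pi cos0 sin0. Qed.

Lemma mkc_continuous1 y : continuous (fun x : R => mkc x y).
Proof. by move=> x; apply: cvg_mkc; [exact: cvg_id | exact: cvg_cst]. Qed.
Lemma mkc_continuous2 x : continuous (fun y : R => mkc x y).
Proof. by move=> y; apply: cvg_mkc; [exact: cvg_cst | exact: cvg_id]. Qed.

(* [u] and [v] below are the real and imaginary parts of
   (f (a + e^w) - f (a - e^w)) e^-w, a function of w with period 2 pi i; by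
   Goursat its mean over a vertical period does not depend on re w, and it
   tends to 2 f'(a) when re w tends to -oo. *)
Lemma cauchy_estimate_im f df (a : C) (r M : R) :
  (forall z, is_derive z 1 f (df z)) -> 0 < r ->
  (forall z, nrm z = r -> nrm (f (a + z) - f (a - z)) <= M) ->
  `|im (df a)| <= M / (2 * r).
Proof.
move=> fd r0 fM.
pose g z := f (a + z) - f (a - z).
pose dg z := df (a + z) + df (a - z).
have gd z : is_derive z 1 g (dg z).
  have d1 : is_derive z 1 (fun w => f (a + w)) (df (a + z)) by apply: is_derive_shift.
  have d2 : is_derive z 1 (fun w => f (a - w)) (df (a - z) * -1).
    exact: (is_derive_ccomp (f := fun w => f (a + w)) (is_derive_shift (fd _)) (is_derive_copp z)).
  rewrite /dg -[df (a - z)]opprK -[- df (a - z)]mulrN1.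
  exact: (@is_deriveB _ _ _ (fun w => f (a + w)) (fun w => f (a - w))).
pose G z := g (cexp z) * cexp (- z).
have /choice[dG Gd] : forall z, exists d, is_derive z 1 G d.
  move=> z; eexists.
  exact: (is_deriveM (is_derive_ccomp (gd _) (is_derive_cexp z))
    (is_derive_ccomp (is_derive_cexp (- z)) (is_derive_copp z))).
pose u x y := re (G (mkc x y)); pose v x y := im (G (mkc x y)).
have cG : continuous G := is_derive_continuous Gd.
have cu y : continuous (u^~ y).
  move=> x; apply: (@continuous_comp _ _ _ (fun x => G (mkc x y)) (@re R)); last exact: re_continuous.
  by apply: (@continuous_comp _ _ _ (fun x => mkc x y) G); [exact: mkc_continuous1 | exact: cG].
have cv x : continuous (v x).
  move=> y; apply: (@continuous_comp _ _ _ (fun y => G (mkc x y)) (@im R)); last exact: im_continuous.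
  by apply: (@continuous_comp _ _ _ (fun y => mkc x y) G); [exact: mkc_continuous2 | exact: cG].
have p0 : 0 < (pi : R) *+ 2 by rewrite mulrn_wgt0 // pi_gt0.
(* By periodicity the two horizontal sides cancel, so Goursat's theorem compares the two vertical
   ones. *)
have mean x1 x2 : x1 <= x2 -> segint 0 (pi *+ 2) (v x1) = segint 0 (pi *+ 2) (v x2).
  move=> x12; have := goursat x12 (ltW p0) (is_derive_cauchy_riemann Gd) cu cv.
  rewrite /rectint; have -> : (fun x => u x 0 - u x (pi *+ 2)) = (fun=> 0).
    apply/funext => x; rewrite /u /G cexp_period !cexpN cexp_period; exact: subrr.
  rewrite (segint_cst 0 x12) (segintB 0 (pi *+ 2) (cv x2) (cv x1)).
  by move: (segint _ _ (v x1)) (segint _ _ (v x2)) => s1 s2; lra.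
have Gnrm x y : nrm (G (mkc x y)) = nrm (g (cexp (mkc x y))) / expR x.
  by rewrite /G nrmM cexpN nrmV nrm_cexp.
suff H e : 0 < e -> `|2 * im (df a)| <= M / r + e.
  have : `|2 * im (df a)| <= M / r by apply/ler_addgt0Pl => e /H; rewrite addrC.
  by rewrite normrM (ger0_norm (ler0n _ 2)) -ler_pdivlMl // invfM; lra.
move=> e0.
have dg0 : dg 0 = 2 * df a by rewrite /dg addr0 subr0; ring.
have g0 : g 0 = 0 by rewrite /g addr0 subr0 subrr.
have /is_derive_nrm /(_ e e0)[d d0 Hd] := gd 0.
(* Over the line re w = [x2] the point e^w runs on the circle of radius [r]; over re w = [x1] it is
   within [d] of 0, where the expansion of [g] at 0 applies. *)
pose x2 := ln r; pose x1 := Num.min x2 (ln (d / 2)).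
have d20 : 0 < d / 2 by rewrite divr_gt0.
have ex1 : expR x1 < d.
  apply: (@le_lt_trans _ _ (d / 2)); last by lra.
  have -> : d / 2 = expR (ln (d / 2)) by rewrite lnK.
  by rewrite ler_expR ge_min lexx orbT.
have B2 : `|segint 0 (pi *+ 2) (v x2)| <= M / r * (pi *+ 2 - 0).
  apply: segint_bound => [||y _]; [exact: ltW|exact: cv|].
  apply: (le_trans (im_le _)); rewrite Gnrm /x2 lnK //.
  by rewrite ler_pM2r ?invr_gt0 //; apply: fM; rewrite nrm_cexp /re /= lnK.
have B1 : `|segint 0 (pi *+ 2) (fun y => v x1 y - im (2 * df a))| <= e * (pi *+ 2 - 0).
  apply: segint_bound => [||y _]; first exact: ltW.
    by move=> y; apply: cvgB; [exact: cv|exact: cvg_cst].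
  rewrite -imB; apply: (le_trans (im_le _)).
  set c := cexp (mkc x1 y); have nc : nrm c = expR x1 by rewrite nrm_cexp.
  have nc0 : 0 < nrm c by rewrite nc expR_gt0.
  have c0 : c != 0 by apply/eqP => c0; move: nc0; rewrite c0 nrm0 ltxx.
  have -> : G (mkc x1 y) - 2 * df a = (g (0 + c) - g 0 - dg 0 * c) / c.
    by rewrite /G cexpN -/c add0r g0 dg0; field.
  by rewrite nrmM nrmV ler_pdivrMr //; apply: Hd; rewrite nc.
rewrite segintB in B1; [|exact: cv|by move=> y; exact: cvg_cst].
rewrite (segint_cst _ (ltW p0)) !subr0 in B1; rewrite !subr0 in B2.
rewrite (mean x1 x2) ?ge_min ?lexx // in B1.
have -> : 2 * im (df a) = im (2 * df a).
  by rewrite -(rc_nat R 2) imM re_rc im_rc mul0r addr0.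
rewrite -(ler_pM2r p0) -[X in _ * X]ger0_norm ?(ltW p0) // -normrM.
set S := segint _ _ _ in B1 B2; set P := im _ * _ in B1 *.
have -> : P = S - (S - P) by ring.
by apply: (le_trans (ler_normB _ _)); rewrite mulrDl; exact: lerD.
Qed.

(** The real part of the derivative is the imaginary part for i f, so the bound [M / (2 * r)] is
    used twice. *)
Lemma cauchy_estimate f df (a : C) (r M : R) :
  (forall z, is_derive z 1 f (df z)) -> 0 < r ->
  (forall z, nrm z = r -> nrm (f (a + z) - f (a - z)) <= M) ->
  nrm (df a) <= M / r.
Proof.
move=> fd r0 fM.
have H1 := cauchy_estimate_im fd r0 fM.
have H2 : `|re (df a)| <= M / (2 * r).
  have -> : re (df a) = im ((mkc 0 1) * df a) by rewrite imM /re /im /= mul0r mul1r add0r.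
  apply: (@cauchy_estimate_im (fun z => mkc 0 1 * f z) (fun z => mkc 0 1 * df z)) => //.
  move=> z zr; rewrite -mulrBr nrmM.
  have -> : nrm (mkc 0 1 : C) = 1 by rewrite /nrm /= expr0n expr1n add0r sqrtr1.
  by rewrite mul1r; exact: fM.
apply: (le_trans (nrm_le _)); apply: (le_trans (lerD H2 H1)).
by rewrite invfM; lra.
Qed.

(** The real mean value theorem along the segment from [w] to [z]; it yields equality only for a
    real-valued function, hence the real part. *)
Lemma mean_value_re f df (K : R) z w : (forall z, is_derive z 1 f (df z)) ->
  (forall z, nrm (df z) <= K) -> `|re (f z - f w)| <= K * nrm (z - w).
Proof.
move=> fd dK; pose phi t := re (f (w + rc t * (z - w))).
pose dphi t := re (df (w + rc t * (z - w)) * (z - w)).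
have n0 := nrm_ge0 (z - w).
have phid (t : R) : is_derive t 1 phi (dphi t).
  apply: is_derive_of_expansion => e e0.
  have n1 : 0 < nrm (z - w) + 1 by rewrite ltr_wpDl.
  have /is_derive_nrm /(_ (e / (nrm (z - w) + 1)))[|r r0 H] := fd (w + rc t * (z - w)).
    by rewrite divr_gt0.
  exists (r / (nrm (z - w) + 1)) => [|h hr]; first by rewrite divr_gt0.
  have hn : nrm (rc h * (z - w)) <= `|h| * (nrm (z - w) + 1).
    by rewrite nrmM nrm_rc ler_wpM2l // lerDl.
  have := H (rc h * (z - w)); rewrite ltr_pdivlMr // in hr.
  move=> /(_ (le_lt_trans hn hr)) {}H.
  have -> : phi (t + h) - phi t - dphi t * h =
    re (f (w + rc t * (z - w) + rc h * (z - w)) - f (w + rc t * (z - w))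
       - df (w + rc t * (z - w)) * (rc h * (z - w))).
    rewrite !reB /phi /dphi rcD mulrDl addrA; congr (_ - _ - _).
    by rewrite mulrCA [RHS]reM re_rc im_rc mul0r subr0 mulrC.
  apply: (le_trans (re_le _)); apply: (le_trans H).
  rewrite mulrAC ler_pdivrMr // -mulrA; apply: ler_wpM2l => //; exact: ltW.
have cphi : continuous phi.
  move=> t; apply: differentiable_continuous; apply/derivable1_diffP.
  exact: (@ex_derive _ _ _ _ _ _ _ (phid t)).
have [c _] := MVT_segment ler01 (fun (t : R) _ => phid t) (continuous_subspaceT cphi).
rewrite /phi rc0 rc1 mul0r mul1r addr0 addrC [w + _]addrC subrK addrC subr0 mulr1 -reB => ->.
by apply: (le_trans (re_le _)); rewrite nrmM; apply: ler_wpM2r.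
Qed.

Lemma mean_value_inequality f df (K : R) z w : (forall z, is_derive z 1 f (df z)) ->
  (forall z, nrm (df z) <= K) -> nrm (f z - f w) <= 2 * K * nrm (z - w).
Proof.
move=> fd dK; have H1 := mean_value_re z w fd dK.
have H2 : `|im (f z - f w)| <= K * nrm (z - w).
  have ni : nrm (mkc 0 (-1) : C) = 1 by rewrite /nrm /= expr0n sqrrN expr1n add0r sqrtr1.
  have -> : im (f z - f w) = re (mkc 0 (-1) * f z - mkc 0 (-1) * f w).
    by rewrite -mulrBr reM /re /im /= -/(im _); ring.
  apply: (@mean_value_re (fun z => mkc 0 (-1) * f z) (fun z => mkc 0 (-1) * df z)) => s.
  by rewrite nrmM ni mul1r.
by apply: (le_trans (nrm_le _)); lra.
Qed.

Lemma zero_derivative_cst f : (forall z, is_derive z 1 f (0 : C)) -> forall z w, f z = f w.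
Proof.
move=> fd z w; apply/eqP; rewrite -subr_eq0; apply/eqP/nrm_eq0/eqP.
rewrite eq_le nrm_ge0 andbT.
have := @mean_value_inequality f (fun=> 0) 0 z w fd; rewrite mulr0 mul0r; apply.
by move=> ?; rewrite nrm0.
Qed.

(** Cauchy's estimate on large circles bounds [df], so each difference f(h + w) - f(w) is a bounded
    entire function. A second estimate on arbitrarily large circles makes its derivative vanish, and
    [df] is constant. Working with differences avoids the second derivative. *)
Lemma entire_linear_growth f df (A B : R) : (forall z, is_derive z 1 f (df z)) ->
  (forall z, nrm (f z) <= A + B * nrm z) -> exists d, forall z, f z = f 0 + d * z.
Proof.
move=> fd fAB.
have B0 : 0 <= B.
  rewrite leNgt; apply/negP => B0.
  pose t := (`|A| + 1) / - B.
  have t0 : 0 <= t by rewrite divr_ge0 // ?oppr_ge0 ?addr_ge0 // ltW.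
  have := fAB (rc t); rewrite nrm_rc ger0_norm //.
  have -> : B * t = - (`|A| + 1) by rewrite /t; field; rewrite lt_eqF.
  have := nrm_ge0 (f (rc t)); have := ler_norm A; lra.
have dfK a : nrm (df a) <= 2 * B + 1.
  (* With [2 * (A + B * nrm a) <= r] the estimate [2 * (A + B * (nrm a + r)) / r] is at most
     [2 * B + 1], independently of [a]. *)
  pose r := Num.max 1 (2 * (A + B * nrm a)).
  have r0 : 0 < r by rewrite lt_max ltr01.
  have r1 : 2 * (A + B * nrm a) <= r by rewrite le_max lexx orbT.
  have := @cauchy_estimate f df a r (2 * (A + B * (nrm a + r))) fd r0.
  move=> H; apply: le_trans (H _) _ => [z zr|].
    apply: (le_trans (nrmB _ _)).
    have H1 := fAB (a + z); have H2 := fAB (a - z).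
    have H3 : B * nrm (a + z) <= B * (nrm a + r) by rewrite ler_wpM2l // -zr nrmD.
    have H4 : B * nrm (a - z) <= B * (nrm a + r) by rewrite ler_wpM2l // -zr nrmB.
    lra.
  rewrite ler_pdivrMr //; lra.
have df_cst h z : df (h + z) = df z.
  pose g w := f (h + w) - f w.
  have gd w : is_derive w 1 g (df (h + w) - df w).
    by apply: (@is_deriveB _ _ _ (fun w => f (h + w)) f); exact: is_derive_shift.
  apply/eqP; rewrite -subr_eq0; apply/eqP/nrm_eq0/eqP; rewrite eq_le nrm_ge0 andbT.
  pose K := 2 * (2 * (2 * B + 1) * nrm h).
  have K0 : 0 <= K by rewrite /K !mulr_ge0 // ?nrm_ge0 // addr_ge0 // mulr_ge0.
  apply/ler_addgt0Pl => e e0; rewrite addr0.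
  have r0 : 0 < (K + 1) / e by rewrite divr_gt0 // ltr_wpDl.
  have := @cauchy_estimate g _ z _ K gd r0.
  move=> H; apply: le_trans (H _) _ => [w _|].
    apply: (le_trans (nrmB _ _)).
    have gK s : nrm (g s) <= 2 * (2 * B + 1) * nrm h.
      by have := mean_value_inequality (h + s) s fd dfK; rewrite addrK.
    have := gK (z + w); have := gK (z - w); rewrite /K; lra.
  rewrite invf_div mulrA ler_pdivrMr ?ltr_wpDl //.
  have := ltW e0; move: K0; nra.
exists (df 0) => z.
suff : f z - df 0 * z = f 0 - df 0 * 0 by rewrite mulr0 subr0 => <-; rewrite subrK.
have H2 (w : C) : is_derive w 1 (fun w : C => df 0 * w) (df 0 * 1).
  exact: (is_derive_cst_mul (df 0) (is_derive_id w 1)).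
apply: (@zero_derivative_cst (fun w => f w - df 0 * w)) => w.
have := is_deriveB (fd w) (H2 w).
by rewrite mulr1 -(df_cst w 0) addr0 subrr.
Qed.

End Liouville.

(** * Norm, compact boxes and growth estimates in C and C^2 *)

Section Plane.
Variable R : realType.
Notation C := (cplx R).
Notation N := (C * C)%type.
Implicit Types (z w : N).

Definition nrm2 (z : N) : R := nrm z.1 + nrm z.2.

Lemma nrm2_ge0 z : 0 <= nrm2 z.
Proof. by rewrite addr_ge0 ?nrm_ge0. Qed.
Lemma nrm2_0 : nrm2 0 = 0. Proof. by rewrite /nrm2 !nrm0 addr0. Qed.
Lemma nrm2_eq0 z : nrm2 z = 0 -> z = 0.
Proof.
case: z => a b /eqP; rewrite /nrm2 /= paddr_eq0 ?nrm_ge0 // => /andP[/eqP/nrm_eq0 -> /eqP/nrm_eq0 ->].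
by [].
Qed.
Lemma nrm2D z w : nrm2 (z + w) <= nrm2 z + nrm2 w.
Proof. by have := nrmD z.1 w.1; have := nrmD z.2 w.2; rewrite /nrm2 /=; lra. Qed.
Lemma nrm2N z : nrm2 (- z) = nrm2 z.
Proof. by rewrite /nrm2 /= !nrmN. Qed.
Lemma nrm2_fst z : nrm z.1 <= nrm2 z. Proof. by rewrite lerDl nrm_ge0. Qed.
Lemma nrm2_snd z : nrm z.2 <= nrm2 z. Proof. by rewrite lerDr nrm_ge0. Qed.
Lemma nrm2_tri (u z w : N) : nrm2 (z - w) <= nrm2 (z - u) + nrm2 (u - w).
Proof. by rewrite -(subrKA u); exact: nrm2D. Qed.
Lemma nrm2_scale (c : C) z : nrm2 (c * z.1, c * z.2) = nrm c * nrm2 z.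
Proof. by rewrite /nrm2 /= !nrmM mulrDr. Qed.

Lemma nbhs_nrm2 z (P : set N) :
  nbhs z P <-> exists2 e : R, 0 < e & forall w, nrm2 (w - z) < e -> P w.
Proof.
case: z => z1 z2; split.
  move=> [[A B] [/= /nbhs_nrm[e1 e10 H1] /nbhs_nrm[e2 e20 H2]] ABP].
  exists (Num.min e1 e2); first by rewrite lt_min e10.
  move=> [w1 w2]; rewrite lt_min => /andP[we1 we2]; apply: ABP; split=> /=.
    by apply: H1; exact: le_lt_trans (nrm2_fst ((w1, w2) - (z1, z2))) we1.
  by apply: H2; exact: le_lt_trans (nrm2_snd ((w1, w2) - (z1, z2))) we2.
move=> [e e0 eP].
exists ([set w | nrm (w - z1) < e / 2], [set w | nrm (w - z2) < e / 2]) => /=.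
  by split; apply/nbhs_nrm; exists (e / 2) => //; rewrite divr_gt0.
by move=> [w1 w2] [/= h1 h2]; apply: eP; rewrite /nrm2 /=; lra.
Qed.

Lemma cvg_nrm2 (T : Type) (F : set_system T) (FF : Filter F) (f : T -> N) z :
  f @ F --> z <-> forall e : R, 0 < e -> \forall t \near F, nrm2 (f t - z) < e.
Proof.
split=> [fz e e0|fz].
  by apply: (fz [set w | nrm2 (w - z) < e]); apply/nbhs_nrm2; exists e.
by move=> P /nbhs_nrm2[e e0 eP]; apply: filterS (fz e e0) => t; exact: eP.
Qed.

Lemma cvg_comp1 (T : Type) (F : set_system T) (FF : Filter F) (f : T -> N) z :
  f @ F --> z -> (fun t => (f t).1) @ F --> z.1.
Proof.
move=> /cvg_nrm2 fz; apply/cvg_nrm => e e0; apply: filterS (fz e e0) => t.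
by apply: le_lt_trans; exact: (nrm2_fst (f t - z)).
Qed.
Lemma cvg_comp2 (T : Type) (F : set_system T) (FF : Filter F) (f : T -> N) z :
  f @ F --> z -> (fun t => (f t).2) @ F --> z.2.
Proof.
move=> /cvg_nrm2 fz; apply/cvg_nrm => e e0; apply: filterS (fz e e0) => t.
by apply: le_lt_trans; exact: (nrm2_snd (f t - z)).
Qed.
Lemma cvg_pairN (T : Type) (F : set_system T) (FF : Filter F) (f g : T -> C) (a b : C) :
  f @ F --> a -> g @ F --> b -> (fun t => (f t, g t)) @ F --> (a, b).
Proof.
move=> /cvg_nrm fa /cvg_nrm gb; apply/cvg_nrm2 => e e0.
have e20 : 0 < e / 2 by rewrite divr_gt0.
apply: filterS2 (fa _ e20) (gb _ e20) => t h1 h2.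
by rewrite /nrm2 /=; lra.
Qed.

Lemma cvg_conj (T : Type) (F : set_system T) (FF : Filter F) (f : T -> C) (a : C) :
  f @ F --> a -> (fun t => (f t)^*) @ F --> a^*.
Proof.
move=> /cvg_nrm fa; apply/cvg_nrm => e e0; apply: filterS (fa _ e0) => t.
by rewrite -rmorphB nrmJ.
Qed.

Lemma nrm2_continuous : continuous nrm2.
Proof.
move=> z; apply: cvgD; apply: (@continuous_comp _ _ _ _ (@nrm R)).
- exact: (@cvg_comp1 _ (nbhs z) _ id).
- exact: nrm_continuous.
- exact: (@cvg_comp2 _ (nbhs z) _ id).
- exact: nrm_continuous.
Qed.

Definition cbox (r : R) : set C := [set z | `|re z| <= r /\ `|im z| <= r].

Lemma cbox_compact r : compact (cbox r).
Proof.
have -> : cbox r = (fun p : R * R => mkc p.1 p.2) @` (`[- r, r] `*` `[- r, r]).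
  apply/seteqP; split=> [z [h1 h2]|_ [[x y] [/= h1 h2] <-]].
    by exists (re z, im z); [split; rewrite /= in_itv /= -ler_norml | exact: ceq].
  by rewrite !in_itv /= -!ler_norml in h1 h2.
apply: continuous_compact; last by apply: compact_setX; exact: segment_compact.
apply: continuous_subspaceT => -[x y].
by apply: cvg_mkc; [exact: cvg_fst | exact: cvg_snd].
Qed.

Definition box2 (r : R) : set N := cbox r `*` cbox r.

Lemma box2_compact r : compact (box2 r).
Proof. by apply: compact_setX; exact: cbox_compact. Qed.

Lemma nrm_cbox r (z : C) : nrm z <= r -> cbox r z.
Proof. by move=> zr; split; apply: le_trans zr; [exact: re_le | exact: im_le]. Qed.
Lemma nrm2_box2 r z : nrm2 z <= r -> box2 r z.
Proof.
by move=> zr; split; apply: nrm_cbox; apply: le_trans zr; [exact: nrm2_fst|exact: nrm2_snd].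
Qed.

Lemma compact_bounded_fun (T : topologicalType) (K : set T) (f : T -> R) :
  compact K -> continuous f -> exists M, forall x, K x -> f x <= M.
Proof.
move=> cK cf; have /compact_bounded[M [_ HM]] : compact (f @` K).
  by apply: continuous_compact => //; exact: continuous_subspaceT.
exists (M + 1) => x Kx; apply: (le_trans (ler_norm _)).
by apply: (HM (M + 1)); [rewrite ltrDl | exists x].
Qed.

Lemma continuous_bounded_ball (T : topologicalType) (K : set T) (f : T -> N) :
  compact K -> continuous f -> exists M, forall x, K x -> nrm2 (f x) <= M.
Proof.
move=> cK cf; apply: compact_bounded_fun => // x.
by apply: continuous_comp; [exact: cf | exact: nrm2_continuous].
Qed.

(** Walk from 0 to [z] in equal steps of length at most [d]; the induction goes back from [z] to
    [n / (n + 1)] times [z]. *)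
Lemma linear_growth (f : C -> C) (K d : R) : 0 < d ->
  (forall z w : C, nrm (z - w) <= d -> nrm (f z - f w) <= K) ->
  exists A B, forall z : C, nrm (f z) <= A + B * nrm z.
Proof.
move=> d0 fK.
have K0 : 0 <= K by apply: le_trans (fK 0 0 _); rewrite ?nrm_ge0 // subrr nrm0 ltW.
have step n (z : C) : nrm z <= n%:R * d -> nrm (f z) <= nrm (f 0) + n%:R * K.
  elim: n z => [|n IH] z.
    rewrite !mul0r addr0 => z0; have -> // : z = 0.
    by apply/nrm_eq0/eqP; rewrite eq_le z0 nrm_ge0.
  move=> zn; pose w := rc (n%:R / n.+1%:R) * z.
  have n1 : 0 < n.+1%:R :> R by rewrite ltr0n.
  have nn : 0 <= n%:R / n.+1%:R :> R by rewrite divr_ge0.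
  have wn : nrm w <= n%:R * d.
    rewrite /w nrmM nrm_rc ger0_norm //.
    have : n%:R / n.+1%:R * nrm z <= n%:R / n.+1%:R * (n.+1%:R * d) by rewrite ler_wpM2l.
    by rewrite mulrA divfK // lt0r_neq0.
  have zw : nrm (z - w) <= d.
    have -> : z - w = rc (n.+1%:R^-1) * z.
      have -> : z - w = (1 - rc (n%:R / n.+1%:R)) * z by rewrite /w; ring.
      rewrite -rc1 -rcB; congr (rc _ * _).
      by rewrite -natr1; field; rewrite natr1 lt0r_neq0.
    by rewrite nrmM nrm_rc ger0_norm ?invr_ge0 ?ler0n // mulrC ler_pdivrMr // mulrC.
  have -> : f z = f w + (f z - f w) by rewrite addrC subrK.
  apply: (le_trans (nrmD _ _)); apply: (le_trans (lerD (IH _ wn) (fK _ _ zw))).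
  by rewrite -natr1 mulrDl mul1r addrA.
exists (nrm (f 0) + K), (K / d) => z.
have [n] : exists n : nat, nrm z / d <= n%:R <= nrm z / d + 1.
  have zd : 0 <= nrm z / d by rewrite divr_ge0 ?nrm_ge0 // ltW.
  have /andP[h1 h2] := truncn_itv zd.
  exists (Num.truncn (nrm z / d)).+1; rewrite (ltW h2) /= -natr1; lra.
rewrite ler_pdivrMr // => /andP[/step H n1]; apply: (le_trans H).
have : n%:R * K <= (nrm z / d + 1) * K by rewrite ler_wpM2r.
rewrite [K / d * _]mulrAC -mulrA; lra.
Qed.

Lemma entire_bounded_increments (f df : C -> C) (K d : R) :
  (forall z : C, is_derive z 1 f (df z)) -> 0 < d ->
  (forall z w : C, nrm (z - w) <= d -> nrm (f z - f w) <= K) ->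
  exists c, forall z : C, f z = f 0 + c * z.
Proof.
by move=> fd d0 /(linear_growth d0)[A [B H]]; exact: entire_linear_growth fd H.
Qed.

(** A translation by an element of [P] leaves increments of [f] unchanged, so they can all be
    measured in one compact box. *)
Lemma entire_quasiperiodic (f df : C -> C) (P : set C) (r : R) :
  (forall z : C, is_derive z 1 f (df z)) ->
  (forall z : C, exists2 l, P l & nrm (l + z) <= r) ->
  (forall l, P l -> exists c, forall z : C, f (l + z) = f z + c) ->
  exists c, forall z : C, f z = f 0 + c * z.
Proof.
move=> fd Pr Pf.
have [M HM] : exists M, forall x, cbox (r + 1) x -> nrm (f x) <= M.
  apply: compact_bounded_fun; first exact: cbox_compact.
  move=> z; apply: continuous_comp; last exact: nrm_continuous.
  exact: (is_derive_continuous fd).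
apply: (@entire_bounded_increments f df (M + M) 1 fd ltr01) => z w zw.
have [l Pl lz] := Pr z; have [c fc] := Pf l Pl.
have -> : f z - f w = f (l + z) - f (l + w) by rewrite !fc; ring.
apply: (le_trans (nrmB _ _)); apply: lerD; apply: HM; apply: nrm_cbox.
  by apply: (le_trans lz); rewrite lerDl.
have -> : l + w = (l + z) - (z - w) by ring.
by apply: (le_trans (nrmB _ _)); apply: lerD.
Qed.

Lemma finite_set_bounded (T : eqType) (A : set T) (f : T -> R) : finite_set A ->
  exists M, forall x, A x -> f x <= M.
Proof.
move=> /finite_seqP[s ->]; elim: s => [|x s [M HM]]; first by exists 0.
exists (Num.max (f x) M) => y; rewrite /= inE le_max => /orP[/eqP ->|/HM ->].
  by rewrite lexx.
by rewrite orbT.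
Qed.

Lemma cocompact_neq0 (P : set C) (r : R) : (forall z : C, exists2 l, P l & nrm (l + z) <= r) ->
  exists2 l, P l & l != 0.
Proof.
move=> Pr; have [l Pl] := Pr (rc (`|r| + 1)) => h; exists l => //.
apply/eqP => l0; move: h; rewrite l0 add0r nrm_rc ger0_norm ?addr_ge0 //.
by have := ler_norm r; lra.
Qed.

(** The number im(conj(a1) a) is the real determinant of [a1] and [a]. A target [z] at distance
    [r + 1] from the real line of [a1], in the direction i a1, cannot be brought within [r] of 0 by
    an element of that line. *)
Lemma transverse_element (P : set C) (r : R) (a1 : C) : a1 != 0 ->
  (forall z : C, exists2 a, P a & nrm (a + z) <= r) -> exists2 a, P a & im (a1^* * a) != 0.
Proof.
move=> a10 Pr; have n1 := nrm_gt0 a10.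
have r0 : 0 <= r by have [a _ h] := Pr 0; apply: le_trans h; exact: nrm_ge0.
pose z : C := mkc 0 1 * a1 * rc ((r + 1) / nrm a1).
have [a2 Pa2 h2] := Pr z; exists a2 => //; apply/eqP => h.
have E : im (a1^* * (a2 + z)) = nrm a1 * (r + 1).
  rewrite mulrDr imD h add0r.
  have -> : a1^* * z = mkc 0 1 * (a1^* * a1) * rc ((r + 1) / nrm a1) by rewrite /z; ring.
  have -> : a1^* * a1 = rc (nrm a1 ^+ 2).
    rewrite mulrC; apply: ceq; case: (a1) => x y.
      by rewrite re_rc /nrm /re /= sqr_sqrtr ?addr_ge0 ?sqr_ge0 //; ring.
    by rewrite im_rc /im /=; ring.
  rewrite -mulrA -rcM imM re_rc im_rc /re /im /= mul0r add0r mul1r.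
  by field; exact: lt0r_neq0.
have : `|im (a1^* * (a2 + z))| <= nrm a1 * r.
  by apply: (le_trans (im_le _)); rewrite nrmM nrmJ ler_pM2l.
rewrite E ger0_norm ?mulr_ge0 ?addr_ge0 ?nrm_ge0 //.
by rewrite ler_pM2l //; lra.
Qed.

End Plane.

(** * Lattices, coverings and lifts *)

Section Heisenberg.
Variable R : realType.
Notation C := (cplx R).
Notation N := (C * C)%type.
Variable e : C.
Implicit Types (u v z w : N) (L : set N).

(* For e = 0 this is the addition of C^2, for e = 1 the nilpotent group law whose
   left translations make up the fundamental group of a Kodaira surface. *)
Definition hop (u z : N) : N := (u.1 + z.1, u.2 + z.2 + e * u.1^* * z.1).
Definition hinv (u : N) : N := (- u.1, - u.2 + e * u.1^* * u.1).

Lemma hopA u v w : hop u (hop v w) = hop (hop u v) w.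
Proof. by rewrite /hop /= rmorphD; congr (_, _); ring. Qed.
Lemma hop0z z : hop 0 z = z.
Proof. by case: z => a b; rewrite /hop /= rmorph0; congr (_, _); ring. Qed.
Lemma hopz0 z : hop z 0 = z.
Proof. by case: z => a b; rewrite /hop /=; congr (_, _); ring. Qed.
Lemma hopV z : hop z (hinv z) = 0.
Proof. by rewrite /hop /hinv /=; congr (_, _); ring. Qed.
Lemma hVop z : hop (hinv z) z = 0.
Proof. by rewrite /hop /hinv /= rmorphN; congr (_, _); ring. Qed.
Lemma hopK u : cancel (hop u) (hop (hinv u)).
Proof. by move=> z; rewrite hopA hVop hop0z. Qed.
Lemma hopVK u : cancel (hop (hinv u)) (hop u).
Proof. by move=> z; rewrite hopA hopV hop0z. Qed.
Lemma hop_inj u : injective (hop u). Proof. exact: can_inj (hopK u). Qed.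
Lemma hinvK u : hinv (hinv u) = u.
Proof. by apply: (@hop_inj (hinv u)); rewrite hopV hVop. Qed.
Lemma hinvM u v : hinv (hop u v) = hop (hinv v) (hinv u).
Proof.
by apply: (@hop_inj (hop u v)); rewrite hopV -hopA (hopA v) hopV hop0z hopV.
Qed.
Lemma hinv0 : hinv 0 = 0. Proof. by rewrite -[LHS]hop0z hopV. Qed.
Lemma cvg_hop (T : Type) (F : set_system T) (FF : Filter F) (f g : T -> N) u v :
  f @ F --> u -> g @ F --> v -> (fun t => hop (f t) (g t)) @ F --> hop u v.
Proof.
move=> fu gv; apply: cvg_pairN.
  by apply: cvgD; exact: cvg_comp1.
apply: cvgD; first by apply: cvgD; exact: cvg_comp2.
apply: cvgM; last exact: cvg_comp1.
by apply: cvgM; [exact: cvg_cst | apply: cvg_conj; exact: cvg_comp1].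
Qed.

Lemma cvg_hinv (T : Type) (F : set_system T) (FF : Filter F) (f : T -> N) u :
  f @ F --> u -> (fun t => hinv (f t)) @ F --> hinv u.
Proof.
move=> fu; apply: cvg_pairN; first by apply: cvgN; exact: cvg_comp1.
apply: cvgD; first by apply: cvgN; exact: cvg_comp2.
apply: cvgM; last exact: cvg_comp1.
by apply: cvgM; [exact: cvg_cst | apply: cvg_conj; exact: cvg_comp1].
Qed.

Lemma hop_continuous u : continuous (hop u).
Proof. by move=> z; apply: cvg_hop; [exact: cvg_cst | exact: cvg_id]. Qed.

Definition locally_finite L := forall r : R, finite_set [set u | L u /\ nrm2 u <= r].

Record lattice L : Prop := Lattice {
  lattice0 : L 0;
  latticeM : forall u v, L u -> L v -> L (hop u v);
  latticeV : forall u, L u -> L (hinv u);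
  lattice_fin : locally_finite L;
  lattice_cocompact : exists r : R, forall z, exists2 u, L u & nrm2 (hop u z) <= r }.

(** In place of evenly covered neighbourhoods: an open continuous surjection whose fibres are the
    left orbits of [L]. With [L] locally finite, two lifts of one map differ locally by a constant
    element of [L]; openness is what will make the inverse homeomorphism continuous. *)
Record covering (S : topologicalType) L (p : N -> S) : Prop := Covering {
  covering_continuous : continuous p;
  covering_open : forall U : set N, open U -> open (p @` U);
  covering_surj : forall s, exists z, p z = s;
  covering_fiber : forall z w, p z = p w <-> exists2 u, L u & w = hop u z }.

Lemma finite_isolated (A : set N) z : finite_set A ->
  exists2 d : R, 0 < d & forall a, A a -> nrm2 (a - z) < d -> a = z.
Proof.
move=> /finite_seqP[s ->] {A}; elim: s => [|a s [d d0 IH]].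
  by exists 1.
have [az|az] := pselect (a = z).
  exists d => // b; rewrite /= inE => /orP[/eqP -> //|]; exact: IH.
have da : 0 < nrm2 (a - z).
  rewrite lt_neqAle nrm2_ge0 andbT eq_sym; apply/eqP => /nrm2_eq0/eqP.
  by rewrite subr_eq0 => /eqP.
exists (Num.min d (nrm2 (a - z))); first by rewrite lt_min d0.
move=> b; rewrite /= inE lt_min => /orP[/eqP -> /andP[_]|bs /andP[bd _]].
  by rewrite ltxx.
exact: IH.
Qed.

Lemma discrete_near_cst L (T : Type) (F : set_system T) (FF : Filter F) (h : T -> N) l :
  locally_finite L -> h @ F --> l -> (\forall t \near F, L (h t)) ->
  \forall t \near F, h t = l.
Proof.
move=> Lfin /cvg_nrm2 hl Lh.
have [d d0 Hd] := finite_isolated l (Lfin (nrm2 l + 1)).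
near=> t; apply: Hd; last by near: t; exact: hl.
split; first by near: t.
have : nrm2 (h t - l) < 1 by near: t; exact: hl.
have := nrm2D (h t - l) l; rewrite subrK; lra.
Unshelve. all: by end_near.
Qed.

(** Connectedness of the line enters as vanishing of a derivative: the path is locally constant, so
    every real function of it has derivative 0. *)
Lemma discrete_path_cst L (k : R -> N) : locally_finite L -> continuous k ->
  (forall t, L (k t)) -> forall s t, k s = k t.
Proof.
move=> Lfin ck Lk.
have loc t : \forall s \near t, k s = k t.
  by apply: (@discrete_near_cst L R (nbhs t) _ k (k t) Lfin (ck t)); near=> s; exact: Lk.
have cst (phi : N -> R) s t : phi (k s) = phi (k t).
  apply: (@is_derive_0_is_cst _ (phi \o k)) => x.
  apply: is_derive_of_expansion => d d0.
  have /nbhs_ballP[r /= r0 Hr] := loc x.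
  exists r => // h hr; rewrite /= Hr; last first.
    by rewrite /ball /= opprD addrA subrr sub0r normrN.
  by rewrite mul0r subrr subr0 normr0 mulr_ge0 // ltW.
move=> s t; case E1 : (k s) => [a b]; case E2 : (k t) => [a' b'].
have H1 := cst (fun z => re z.1) s t; have H2 := cst (fun z => im z.1) s t.
have H3 := cst (fun z => re z.2) s t; have H4 := cst (fun z => im z.2) s t.
by rewrite E1 E2 /= in H1 H2 H3 H4; congr (_, _); apply: ceq.
Unshelve. all: by end_near.
Qed.

Definition seg2 (w z : N) (t : R) : N :=
  (w.1 + rc t * (z.1 - w.1), w.2 + rc t * (z.2 - w.2)).
Definition convex2 (D : set N) :=
  forall w z t, D w -> D z -> 0 <= t <= 1 -> D (seg2 w z t).

Lemma seg2_continuous w z : continuous (seg2 w z).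
Proof.
move=> t; apply: cvg_pairN; (apply: cvgD; first exact: cvg_cst);
  by apply: cvgM; [exact: rc_continuous | exact: cvg_cst].
Qed.

Definition ball2 (c : N) (r : R) : set N := [set z | nrm2 (z - c) < r].

Lemma ball2_convex c r : convex2 (ball2 c r).
Proof.
move=> w z t; rewrite /ball2 /= => wc zc /andP[t0 t1].
have -> : seg2 w z t - c = (rc (1 - t) * (w - c).1, rc (1 - t) * (w - c).2)
   + (rc t * (z - c).1, rc t * (z - c).2).
  rewrite /seg2; case: w z c {wc zc} => w1 w2 [z1 z2] [c1 c2].
  by rewrite rcB rc1; congr (_, _) => /=; ring.
apply: (le_lt_trans (nrm2D _ _)); rewrite !nrm2_scale !nrm_rc !ger0_norm ?subr_ge0 //.
have [->|t'] := eqVneq t 0; first by rewrite subr0 mul0r mul1r addr0.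
have H1 : t * nrm2 (z - c) < t * r by rewrite ltr_pM2l // lt_neqAle eq_sym t'.
have H2 : (1 - t) * nrm2 (w - c) <= (1 - t) * r by rewrite ler_wpM2l ?subr_ge0 // ltW.
lra.
Qed.

Lemma convex2I (A B : set N) : convex2 A -> convex2 B -> convex2 (A `&` B).
Proof. by move=> cA cB w z t [Aw Bw] [Az Bz] t01; split; [exact: cA | exact: cB]. Qed.

Lemma convex2T : convex2 setT. Proof. by []. Qed.

Lemma convex_discrete_cst L (D : set N) (h : N -> N) : locally_finite L -> convex2 D ->
  (forall w, D w -> {for w, continuous h}) -> (forall w, D w -> L (h w)) ->
  forall w z, D w -> D z -> h w = h z.
Proof.
move=> Lfin cD ch Lh w z Dw Dz.
(* Clamping the parameter to [0, 1] turns the segment into a path defined and continuous on the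
   whole line that never leaves [D]. *)
pose cl (t : R) := Num.max 0 (Num.min 1 t).
have cl01 t : 0 <= cl t <= 1 by rewrite /cl le_max lexx ge_max ler01 ge_min lexx.
have ccl : continuous cl.
  move=> t; apply: (@continuous_max _ R (fun=> 0) (fun t => Num.min 1 t)).
    exact: cvg_cst.
  by apply: (@continuous_min _ R (fun=> 1) id); [exact: cvg_cst|exact: cvg_id].
have Dcl t : D (seg2 w z (cl t)) by apply: cD.
have := @discrete_path_cst L (fun t => h (seg2 w z (cl t))) Lfin _ (fun t => Lh _ (Dcl t)) 0 1.
have -> : cl 0 = 0 by rewrite /cl min_r ?ler01 // maxxx.
have -> : cl 1 = 1 by rewrite /cl minxx max_r // ler01.
have -> : seg2 w z 0 = w by case: w {Dw Dcl} => ? ?; rewrite /seg2 rc0 !mul0r !addr0.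
have -> : seg2 w z 1 = z.
  by case: z {Dz Dcl} => ? ?; rewrite /seg2 rc1 !mul1r; congr (_, _); rewrite addrC subrK.
apply=> t.
apply: (@continuous_comp _ _ _ (fun t => seg2 w z (cl t)) h); last exact: ch.
by apply: (@continuous_comp _ _ _ cl (seg2 w z)); [exact: ccl | exact: seg2_continuous].
Qed.

Section Lifting.
Variables (S : topologicalType) (L : set N) (p : N -> S).
Hypotheses (latL : lattice L) (covp : covering L p).

Lemma covering_hop u z : L u -> p (hop u z) = p z.
Proof. by move=> Lu; apply/esym/(covering_fiber covp); exists u. Qed.

Lemma covering_quot z w : p z = p w -> L (hop w (hinv z)).
Proof.
by move=> /(covering_fiber covp)[u Lu ->]; rewrite -hopA hopV hopz0.
Qed.

(** The quotient [hop (g t) (hinv (f t))] lies in [L] and converges, hence is eventually equal to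
    its limit. *)
Lemma lift_near_unique (T : Type) (F : set_system T) (FF : Filter F) (f g : T -> N) z w :
  f @ F --> z -> g @ F --> w -> (\forall t \near F, p (f t) = p (g t)) ->
  \forall t \near F, g t = hop (hop w (hinv z)) (f t).
Proof.
move=> fz gw pfg.
have H : \forall t \near F, hop (g t) (hinv (f t)) = hop w (hinv z).
  apply: (@discrete_near_cst L _ F _ (fun t => hop (g t) (hinv (f t))) _ (lattice_fin latL)).
    by apply: cvg_hop; [exact: gw | exact: cvg_hinv].
  by apply: filterS pfg => t; exact: covering_quot.
by apply: filterS H => t <-; rewrite -hopA hVop hopz0.
Qed.

Definition lifts_on (D : set N) (Q : N -> S) (f : N -> N) :=
  forall w, D w -> {for w, continuous f} /\ p (f w) = Q w.

Lemma lift_convex_translate D Q f g a : convex2 D -> lifts_on D Q f -> lifts_on D Q g ->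
  D a -> forall z, D z -> g z = hop (hop (g a) (hinv (f a))) (f z).
Proof.
move=> cD lf lg Da z Dz.
have <- : hop (g z) (hinv (f z)) = hop (g a) (hinv (f a)).
  have ch w : D w -> {for w, continuous (fun z => hop (g z) (hinv (f z)))}.
    move=> Dw; have [cf _] := lf w Dw; have [cg _] := lg w Dw.
    by apply: cvg_hop; [exact: cg | apply: cvg_hinv; exact: cf].
  have Lh w : D w -> L (hop (g w) (hinv (f w))).
    by move=> Dw; apply: covering_quot; rewrite (lf w Dw).2 (lg w Dw).2.
  exact: (convex_discrete_cst (lattice_fin latL) cD ch Lh Dz Da).
by rewrite -hopA hVop hopz0.
Qed.

Lemma lift_convex_unique D Q f g a : convex2 D -> lifts_on D Q f -> lifts_on D Q g ->
  D a -> f a = g a -> forall z, D z -> f z = g z.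
Proof.
move=> cD lf lg Da fg z Dz.
by rewrite (lift_convex_translate cD lf lg Da Dz) fg hopV hop0z.
Qed.

Lemma lifts_on_sub D D' Q f : D' `<=` D -> lifts_on D Q f -> lifts_on D' Q f.
Proof. by move=> DD lf w /DD; exact: lf. Qed.

Lemma lifts_on_hop D Q f u : L u -> lifts_on D Q f -> lifts_on D Q (fun z => hop u (f z)).
Proof.
move=> Lu lf w /lf[cf pf]; split; last by rewrite covering_hop.
by apply: cvg_hop; [exact: cvg_cst | exact: cf].
Qed.

Variable Q : N -> S.
Hypothesis locQ : forall z, exists (U : set N) (f : N -> N), [/\ open U, U z & lifts_on U Q f].

(** A Lebesgue number argument: compactness of the box gives one radius [d] for the balls carrying a
    lift. *)
Lemma uniform_local_lifts r : exists2 d : R, 0 < d & forall z, nrm2 z <= r ->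
  exists f, lifts_on (ball2 z d) Q f.
Proof.
have := @box2_compact R r; rewrite compact_near_coveringP => /(_ R (0 : R)^'+
   (fun d z => exists f, lifts_on (ball2 z d) Q f)) [x _|d /= d0 H].
- have [U [f [oU Ux lf]]] := locQ x.
  have /nbhs_nrm2[c c0 Hc] : nbhs x U by exact: open_nbhs_nbhs.
  have c20 : 0 < c / 2 by rewrite divr_gt0.
  exists ([set z | nrm2 (z - x) < c / 2], [set d | d < c / 2]) => /=.
    split; first by apply/nbhs_nrm2; exists (c / 2).
    exact: nbhs_right_lt.
  move=> [z d] [/= zx dc]; exists f; apply: lifts_on_sub lf => w wz; apply: Hc.
  apply: (le_lt_trans (nrm2_tri z _ _)); move: wz; rewrite /ball2 /=; lra.
- exists (d / 2); first by rewrite divr_gt0.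
  move=> z zr; apply: H (nrm2_box2 zr).
  + by rewrite /= sub0r normrN ger0_norm ?ltr_pdivrMr // ?ltr_pMr ?ltr1n // divr_ge0 // ltW.
  + by rewrite divr_gt0.
Qed.

(** The lift grows radially in shells of thickness [d / 2]. A point [w] of the new ball is
    contracted to [sh w] in the old one, and the local lift around [sh w] continues the value found
    there up to [w]. *)
Lemma lift_on_balls r x0 : p x0 = Q 0 -> exists2 F, F 0 = x0 & lifts_on (ball2 0 r) Q F.
Proof.
move=> px0; have [d d0 Hd] := uniform_local_lifts r.
have /choice[lf lfP] : forall z, exists f, nrm2 z <= r -> lifts_on (ball2 z d) Q f.
  move=> z; have [zr|zr] := pselect (nrm2 z <= r); last by exists id.
  by have [f] := Hd z zr; exists f.
have d20 : 0 < d / 2 by rewrite divr_gt0.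
have key (n : nat) : exists2 F, F 0 = x0 &
   forall s, s <= n%:R * (d / 2) -> s <= r -> lifts_on (ball2 0 s) Q F.
  elim: n => [|n [F F0 IH]].
    exists (fun=> x0) => // s; rewrite mul0r => s0 _ w; rewrite /ball2 /= subr0 => ws.
    by exfalso; have := nrm2_ge0 w; lra.
  pose c : R := n%:R / n.+1%:R.
  have n1 : 0 < n.+1%:R :> R by rewrite ltr0n.
  have c0 : 0 <= c by rewrite /c divr_ge0.
  have c1 : 0 <= 1 - c.
    by rewrite /c subr_ge0 ler_pdivrMr // mul1r ler_nat.
  pose sh (w : N) : N := (rc c * w.1, rc c * w.2).
  pose D := ball2 0 (Num.min r (n%:R * (d / 2))).
  pose D1 := ball2 0 (Num.min r (n.+1%:R * (d / 2))).
  have lF : lifts_on D Q F by apply: IH; rewrite ge_min lexx ?orbT.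
  have shD w : nrm2 (sh w) = c * nrm2 w by rewrite nrm2_scale nrm_rc ger0_norm.
  have D1sh w : D1 w -> nrm2 w < r /\ nrm2 (w - sh w) < d / 2.
    rewrite /D1 /ball2 /= subr0 lt_min => /andP[wr wn]; split => //.
    have -> : w - sh w = (rc (1 - c) * w.1, rc (1 - c) * w.2).
      by case: w {wr wn} => ? ?; rewrite rcB rc1; congr (_, _) => /=; ring.
    rewrite nrm2_scale nrm_rc ger0_norm // -(ltr_pM2l n1) mulrA.
    have -> : n.+1%:R * (1 - c) = 1.
      by rewrite /c mulrBr mulr1 mulrCA divff ?lt0r_neq0 // mulr1 -natr1 addrAC subrr add0r.
    by rewrite mul1r.
  have shr w : nrm2 w < r -> nrm2 (sh w) <= r.
    move=> wr; rewrite shD; apply: le_trans (ltW wr).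
    by rewrite -[leRHS]mul1r ler_wpM2r ?nrm2_ge0 // -subr_ge0.
  have Dsh y : (0 < n)%N -> D1 y -> D (sh y).
    move=> n0; rewrite /D1 /D /ball2 /= !subr0 shD !lt_min => /andP[yr yn].
    apply/andP; split.
      by apply: le_lt_trans yr; rewrite -[leRHS]mul1r ler_wpM2r ?nrm2_ge0 // -subr_ge0.
    by rewrite /c mulrAC ltr_pdivrMr // -mulrA ltr_pM2l ?ltr0n // [_ * n.+1%:R]mulrC.
  (* For n = 0 the set [D] is empty, but then [sh] is constantly 0 and [F 0 = x0] lifts [Q 0]. *)
  have pF w : D1 w -> p (F (sh w)) = Q (sh w).
    move=> D1w; have [n0|n0] := posnP n; last exact: (lF (sh w) (Dsh w n0 D1w)).2.
    by have -> : sh w = 0; rewrite /sh /c ?n0 ?mul0r ?rc0 ?mul0r // F0.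
  (* [tr w] is the local lift around [sh w], translated by an element of [L] so as to agree with [F]
     at [sh w]; the new lift takes the value of [tr w] at its own base point [w]. *)
  pose tr w y := hop (hop (F (sh w)) (hinv (lf (sh w) (sh w)))) (lf (sh w) y).
  pose F' w := tr w w.
  have ball_self z : ball2 z d z by rewrite /ball2 /= subrr nrm2_0.
  have lfw w : D1 w -> lifts_on (ball2 (sh w) d) Q (tr w).
    move=> D1w; have [wr _] := D1sh w D1w; apply: lifts_on_hop; last exact: lfP (shr w wr).
    apply: covering_quot; rewrite pF //.
    exact: (lfP _ (shr w wr) (sh w) (ball_self _)).2.
  have F'0 : F' 0 = x0.
    have sh0 : sh 0 = 0 by rewrite /sh /= mulr0.
    by rewrite /F' /tr sh0 -hopA hVop hopz0.
  exists F'; first exact: F'0.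
  move=> s sn sr.
  apply: (@lifts_on_sub D1).
    by move=> z; rewrite /D1 /ball2 /= lt_min => zs; apply/andP; split; lra.
  move=> w D1w; have [wr ww] := D1sh w D1w.
  have [cw pw] := lfw w D1w w (lt_trans ww (ltac:(lra) : d / 2 < d)).
  split; last exact: pw.
  (* [F'] uses a different local lift at each point, so its continuity requires [tr z] and [tr w] to
     agree at [z]. By uniqueness on convex intersections, [tr w] agrees with [F] from [sh w] to
     [sh z], and from there with [tr z] up to [z]. *)
  suff near_eq : \forall z \near w, tr w z = F' z.
    by apply: cvg_trans cw; apply: near_eq_cvg.
  have D1near : \forall z \near w, D1 z.
    pose g := Num.min r (n.+1%:R * (d / 2)) - nrm2 w.
    apply/nbhs_nrm2; exists g.
      by rewrite subr_gt0; move: D1w; rewrite /D1 /ball2 /= subr0.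
    by move=> z zw; rewrite /D1 /ball2 /= subr0; have := nrm2D (z - w) w; rewrite subrK /g in zw *; lra.
  have closenear : \forall z \near w, nrm2 (z - w) < d / 2 - nrm2 (w - sh w).
    by apply/nbhs_nrm2; exists (d / 2 - nrm2 (w - sh w)); rewrite ?subr_gt0.
  near=> z.
  have D1z : D1 z by near: z.
  have zw : nrm2 (z - w) < d / 2 - nrm2 (w - sh w) by near: z.
  have [zr zz] := D1sh z D1z.
  have shzw : nrm2 (sh z - sh w) < d / 2.
    have -> : sh z - sh w = (rc c * (z - w).1, rc c * (z - w).2).
      by rewrite /sh; case: (z) (w) => ? ? [? ?] /=; congr (_, _) => /=; ring.
    rewrite nrm2_scale nrm_rc ger0_norm //.
    have : c * nrm2 (z - w) <= 1 * nrm2 (z - w) by rewrite ler_wpM2r ?nrm2_ge0 // -subr_ge0.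
    by have := nrm2_ge0 (w - sh w); lra.
  have agree : tr w (sh z) = F (sh z).
    have [n0|n0] := posnP n.
      have E y : sh y = 0 by rewrite /sh /c n0 mul0r rc0 !mul0r.
      by rewrite /tr !E -hopA hVop hopz0.
    apply: (@lift_convex_unique (ball2 (sh w) d `&` D) Q (tr w) F (sh w)).
    - by apply: convex2I; exact: ball2_convex.
    - by apply: lifts_on_sub (lfw w D1w) => ? [].
    - by apply: lifts_on_sub lF => ? [].
    - by split; [exact: ball_self | exact: (Dsh _ n0)].
    - by rewrite /tr -hopA hVop hopz0.
    - by split; [rewrite /ball2 /=; lra | exact: (Dsh _ n0)].
  apply: (@lift_convex_unique (ball2 (sh w) d `&` ball2 (sh z) d) Q (tr w) (tr z) (sh z)).
  - by apply: convex2I; exact: ball2_convex.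
  - by apply: lifts_on_sub (lfw w D1w) => ? [].
  - by apply: lifts_on_sub (lfw z D1z) => ? [].
  - by split; [rewrite /ball2 /=; lra | exact: ball_self].
  - by rewrite agree /tr -hopA hVop hopz0.
  - split; rewrite /ball2 /=; last by lra.
    by apply: (le_lt_trans (nrm2_tri w _ _)); lra.
have rd : 0 <= `|r| / (d / 2) by rewrite divr_ge0 // ltW.
have /andP[_ hn] := truncn_itv rd.
have [F F0 HF] := key (Num.truncn (`|r| / (d / 2))).+1.
exists F => //; apply: HF => //; move: hn; rewrite ltr_pdivrMr // => hn.
by apply: (le_trans (ler_norm r)); exact: ltW.
Unshelve. all: by end_near.
Qed.

Theorem lift_exists x0 : p x0 = Q 0 ->
  exists F : N -> N, [/\ F 0 = x0, continuous F & forall z, p (F z) = Q z].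
Proof.
move=> px0.
have /choice[F FP] : forall r : R, exists F : N -> N, F 0 = x0 /\ lifts_on (ball2 0 r) Q F.
  by move=> r; have [F F0 lF] := lift_on_balls r px0; exists F.
have b0 (r : R) : 0 < r -> ball2 0 r 0 by rewrite /ball2 /= subrr nrm2_0.
have agree (r s : R) z : nrm2 z < r -> r <= s -> F r z = F s z.
  move=> zr rs; have r0 : 0 < r := le_lt_trans (nrm2_ge0 z) zr.
  apply: (@lift_convex_unique (ball2 0 r) Q (F r) (F s) 0).
  - exact: ball2_convex.
  - exact: (FP r).2.
  - apply: lifts_on_sub (FP s).2 => w; rewrite /ball2 /= => h; exact: lt_le_trans rs.
  - exact: b0.
  - by rewrite (FP r).1 (FP s).1.
  - by rewrite /ball2 /= subr0.
have in1 (z : N) : ball2 0 (nrm2 z + 1) z by rewrite /ball2 /= subr0 ltrDl.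
(* The radius exceeds the norm, so [z] is inside its ball; lifts on different balls agree because
   all of them start at [x0]. *)
exists (fun z => F (nrm2 z + 1) z); split.
- exact: (FP _).1.
- move=> z; have [cz _] := (FP (nrm2 z + 2)).2 z (ltac:(by rewrite /ball2 /= subr0 ltrDl)).
  have E : F (nrm2 z + 1) z = F (nrm2 z + 2) z.
    by apply: agree; rewrite ?ltrDl // lerD2l ler1n.
  have {}cz : F (nrm2 z + 2) @ z --> F (nrm2 z + 1) z by rewrite E; exact: cz.
  apply: cvg_trans cz; apply: near_eq_cvg; apply/nbhs_nrm2; exists 1 => // w wz.
  have wz1 : nrm2 w < nrm2 z + 1.
    by have := nrm2D (w - z) z; rewrite subrK; lra.
  by apply/esym/agree; lra.
- by move=> z; exact: ((FP _).2 z (in1 z)).2.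
Qed.

End Lifting.
End Heisenberg.

(** * Lifts of antiholomorphic involutions *)

Section Rigidity.
Variable R : realType.
Notation C := (cplx R).
Notation N := (C * C)%type.
Implicit Types (u v z w : N) (L : set N).

Definition antiholo (f : N -> N) (z : N) : Prop :=
  differentiable (fun w => (f w).1^*) z /\ differentiable (fun w => (f w).2^*) z.

Lemma antiholo_continuous f z : antiholo f z -> {for z, continuous f}.
Proof.
move=> [/differentiable_continuous c1 /differentiable_continuous c2].
suff H : f @ nbhs z --> f z by exact: H.
apply/cvg_nrm2 => x x0; have x20 : 0 < x / 2 by rewrite divr_gt0.
have h1 : \forall w \near z, nrm ((f w).1^* - (f z).1^*) < x / 2 :=
  (@cvg_nrm R N (nbhs z) (nbhs_filter z) (fun w => (f w).1^*) _).1 c1 _ x20.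
have h2 : \forall w \near z, nrm ((f w).2^* - (f z).2^*) < x / 2 :=
  (@cvg_nrm R N (nbhs z) (nbhs_filter z) (fun w => (f w).2^*) _).1 c2 _ x20.
near=> w; rewrite /nrm2 /=.
have A1 : nrm ((f w).1 - (f z).1) < x / 2 by rewrite -nrmJ rmorphB; near: w.
have A2 : nrm ((f w).2 - (f z).2) < x / 2 by rewrite -nrmJ rmorphB; near: w.
lra.
Unshelve. all: by end_near.
Qed.

Definition line (z v : N) (t : C) : N := (z.1 + t * v.1, z.2 + t * v.2).

Lemma line_differentiable z v t : differentiable (line z v) t.
Proof.
apply: differentiable_pair; apply: differentiableD.
- exact: differentiable_cst.
- by apply: differentiableM; [exact: ex_diff | exact: differentiable_cst].
- exact: differentiable_cst.
- by apply: differentiableM; [exact: ex_diff | exact: differentiable_cst].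
Qed.

Lemma line_continuous z v : continuous (line z v).
Proof. by move=> t; apply: differentiable_continuous; exact: line_differentiable. Qed.

Lemma is_derive_line (g : N -> C) z v t : differentiable g (line z v t) ->
  exists d, is_derive t 1 (fun s => g (line z v s)) d.
Proof.
move=> dg; have dl : differentiable (g \o line z v) t.
  by apply: differentiable_comp; [exact: line_differentiable | exact: dg].
by exists ('D_1 (g \o line z v) t); apply: derivableP; apply/derivable1_diffP.
Qed.

Lemma is_derive_near (f g : C -> C) (z d : C) : (\forall w \near z, f w = g w) ->
  is_derive z 1 f d -> is_derive z 1 g d.
Proof.
move=> /nbhs_nrm[r r0 fg] /is_derive_nrm fd; apply/is_derive_nrm => x x0.
have [s s0 H] := fd x x0; exists (Num.min r s); first by rewrite lt_min r0.
move=> h; rewrite lt_min => /andP[hr hs]; rewrite -!fg; first exact: H.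
  by rewrite subrr nrm0.
by rewrite addrAC subrr add0r.
Qed.

Lemma is_derive_caffine (f g : C -> C) (c k z d d' : C) :
  is_derive z 1 f d -> is_derive z 1 g d' ->
  is_derive z 1 (fun t => c + f t + k * g t) (d + k * d').
Proof.
move=> fd gd; have := is_deriveD (is_deriveD (is_derive_cst c z 1) fd) (is_derive_cst_mul k gd).
by rewrite add0r.
Qed.

Variables (e : C) (L : set N) (S : topologicalType) (p : N -> S) (sigma : S -> S).
Hypotheses (latL : lattice e L) (covp : covering e L p) (sigmaK : involutive sigma).
Hypothesis sigma_loc : forall z : N, exists (U : set N) (f : N -> N),
  [/\ open U, U z, forall w, U w -> antiholo f w & forall w, U w -> sigma (p w) = p (f w)].
Hypothesis sigma0 : sigma (p 0) = p 0.

(** All clauses are uniqueness of lifts. Both F o F and the identity lift [p] and agree at 0; z |->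
    F(u z) and F lift the same map, hence differ by the constant F(u); and F is locally a lattice
    translate of the given antiholomorphic map. *)
Lemma lift_involution : exists F : N -> N,
  [/\ F 0 = 0, forall z, p (F z) = sigma (p z), involutive F,
      (forall u z, L u -> L (F u) /\ F (hop e u z) = hop e (F u) (F z)) &
      continuous F /\
      forall z v, exists df1 df2 : C -> C,
        (forall t : C, is_derive t 1 (fun s => (F (line z v s)).1^*) (df1 t)) /\
        (forall t : C, is_derive t 1 (fun s => (F (line z v s)).2^*) (df2 t)) ].
Proof.
have loc z : exists (U : set N) (f : N -> N), [/\ open U, U z & lifts_on p U (sigma \o p) f].
  have [U [f [oU Uz af pf]]] := sigma_loc z; exists U, f; split=> // w Uw; split.
    exact: antiholo_continuous (af w Uw).
  by rewrite /= pf.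
have [F [F0 cF pF]] := lift_exists latL covp loc (esym sigma0).
have lF : lifts_on p setT (sigma \o p) F by move=> w _; split; [exact: cF | exact: pF].
exists F; split; [exact: F0 | exact: pF | | | split; first exact: cF].
- apply/(fun H z => @lift_convex_unique _ e _ _ _ latL covp setT p (F \o F) id 0 (@convex2T _) _ _ I H z I).
  + by move=> w _; split; [apply: continuous_comp; exact: cF | rewrite /= pF /= pF /= sigmaK].
  + by move=> w _; split; [exact: cvg_id | ].
  + by rewrite /= F0.
- move=> u z Lu; split.
    have : p (F u) = p 0.
      by rewrite pF /= -[u](hopz0 e) (covering_hop covp _ Lu).
    move=> /esym/(covering_quot covp); rewrite hinv0 hopz0 //.
  have lFu : lifts_on p setT (sigma \o p) (fun z => F (hop e u z)).
    move=> w _; split; last by rewrite pF /= (covering_hop covp _ Lu).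
    by apply: (@continuous_comp _ _ _ (hop e u) F); [exact: hop_continuous | exact: cF].
  have := lift_convex_translate latL covp (@convex2T _) lF lFu (I : setT 0) (I : setT z).
  by rewrite hopz0 F0 hinv0 hopz0.
- move=> z v.
  suff H (t : C) : exists d1 d2, is_derive t 1 (fun s => (F (line z v s)).1^*) d1 /\
      is_derive t 1 (fun s => (F (line z v s)).2^*) d2.
    by have /choice[df1 /choice[df2 H']] := H; exists df1, df2; split=> t; have [] := H' t.
  have [U [f [oU Uz af pf]]] := sigma_loc (line z v t).
  have [/is_derive_line[d1 D1] /is_derive_line[d2 D2]] := af _ Uz.
  have nU : \forall w \near line z v t, U w by exact: open_nbhs_nbhs.
  have := @lift_near_unique _ e _ _ _ latL covp N (nbhs (line z v t)) _ f F _ _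
    (antiholo_continuous (af _ Uz)) (cF _).
  set g := hop e _ (hinv e _) => /(_ _) Fg.
  have {}Fg : \forall w \near line z v t, F w = hop e g (f w).
    by apply: Fg; near=> w; rewrite pF /= pf //; near: w.
  have {}Fg : \forall s \near t, F (line z v s) = hop e g (f (line z v s)).
    exact: (@line_continuous z v t _ Fg).
  (* Left translation by [g] adds e conj(g1) f1 to the second component; its conjugate is a constant
     times conj(f1), so complex differentiability survives. *)
  clearbody g; exists (d1 + 0 * d1), (d2 + e^* * g.1 * d1); split.
    apply: is_derive_near (is_derive_caffine (g.1^*) 0 D1 D1).
    near=> s; have -> : F (line z v s) = hop e g (f (line z v s)) by near: s.
    by rewrite /hop /= rmorphD; ring.
  apply: is_derive_near (is_derive_caffine (g.2^*) (e^* * g.1) D2 D1).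
  near=> s; have -> : F (line z v s) = hop e g (f (line z v s)) by near: s.
  by rewrite /hop /= !rmorphD !rmorphM /= conjCK.
Unshelve. all: by end_near.
Qed.

End Rigidity.

Section RigidTorus.
Variable R : realType.
Notation C := (cplx R).
Notation N := (C * C)%type.
Variables (L : set N) (F : N -> N).
Hypotheses (latL : lattice 0 L) (F0 : F 0 = 0) (cF : continuous F).
Hypothesis FM : forall u z, L u -> F (hop 0 u z) = hop 0 (F u) (F z).
Hypothesis F_entire : forall z v : N, exists df1 df2 : C -> C,
  (forall t : C, is_derive t 1 (fun s => (F (line z v s)).1^*) (df1 t)) /\
  (forall t : C, is_derive t 1 (fun s => (F (line z v s)).2^*) (df2 t)).

(** For [e = 0] lattice elements preserve both z - w and F z - F w, so the pair can be moved into a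
    fixed box. *)
Lemma torus_increments : exists K, forall z w : N, nrm2 (z - w) <= 1 -> nrm2 (F z - F w) <= K.
Proof.
have [r Hr] := lattice_cocompact latL.
have [M HM] := continuous_bounded_ball (@box2_compact R (r + 1)) cF.
exists (M + M) => z w zw; have [u Lu uz] := Hr z.
have hop0E (a b : N) : hop 0 a b = a + b by rewrite /hop !mul0r addr0.
have -> : F z - F w = F (hop 0 u z) - F (hop 0 u w).
  by rewrite !FM // !hop0E opprD addrACA subrr add0r.
apply: (le_trans (nrm2D _ _)); rewrite nrm2N; apply: lerD; apply: HM; apply: nrm2_box2.
  by apply: (le_trans uz); rewrite lerDl.
have -> : hop 0 u w = hop 0 u z - (z - w) by rewrite !hop0E; ring.
by apply: (le_trans (nrm2D _ _)); rewrite nrm2N; exact: lerD.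
Qed.

Lemma line_diff (z v : N) (t s : C) : line z v t - line z v s = ((t - s) * v.1, (t - s) * v.2) :> N.
Proof. by rewrite /line; congr (_, _) => /=; ring. Qed.

(** Bounded increments make [phi] affine on every complex line. Horizontal and vertical lines leave
    only a possible term in x y, which the diagonal excludes. *)
Lemma additive_on_lines (phi : N -> C) :
  (forall z w : N, nrm (phi z - phi w) <= nrm2 (F z - F w)) ->
  (forall z v : N, exists df : C -> C, forall t : C, is_derive t 1 (fun s => phi (line z v s)) (df t)) ->
  phi 0 = 0 -> exists a b, forall z : N, phi z = a * z.1 + b * z.2.
Proof.
move=> phiF phid phi0; have [K HK] := torus_increments.
have lin (z v : N) : exists c, forall t, phi (line z v t) = phi z + c * t.
  have [df fd] := phid z v.
  have v1 : 0 < nrm2 v + 1 by rewrite ltr_wpDl ?nrm2_ge0.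
  have [||c Hc] := @entire_bounded_increments R _ df K (nrm2 v + 1)^-1 fd.
  - by rewrite invr_gt0.
  - move=> t s ts; apply: (le_trans (phiF _ _)); apply: HK.
    rewrite line_diff nrm2_scale; move: ts; rewrite -[_^-1]mul1r ler_pdivlMr //.
    by apply: le_trans; rewrite ler_wpM2l ?nrm_ge0 // lerDl.
  - exists c => t; rewrite Hc; congr (phi _ + _).
    by case: z {fd Hc} => ? ?; rewrite /line /= !mul0r !addr0.
have [c1 H1] := lin 0 (1, 0); have [c2 H2] := lin 0 (0, 1).
have [c3 H3] := lin 0 (1, 1).
have /choice[d Hd] : forall x, exists d, forall t, phi (x, t) = phi (x, 0) + d * t.
  move=> x; have [d Hd] := lin (x, 0) (0, 1); exists d => t; rewrite -Hd.
  by congr phi; rewrite /line /=; congr (_, _); ring.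
have /choice[g Hg] : forall y, exists d, forall t, phi (t, y) = phi (0, y) + d * t.
  move=> y; have [g Hg] := lin (0, y) (1, 0); exists g => t; rewrite -Hg.
  by congr phi; rewrite /line /=; congr (_, _); ring.
have E1 x : phi (x, 0) = g 0 * x by rewrite Hg phi0 add0r.
have E2 y : phi (0, y) = d 0 * y by rewrite Hd phi0 add0r.
have E3 t : phi (t, t) = c3 * t.
  by have := H3 t; rewrite phi0 add0r => <-; congr phi; rewrite /line /=; congr (_, _); ring.
have dE x : d x = d 0 + (g 1 - g 0) * x.
  have := Hd x 1; rewrite Hg E1 E2 => H.
  by rewrite -[LHS]mulr1 -(addKr (g 0 * x) (d x * 1)) -H; ring.
have phiE x y : phi (x, y) = g 0 * x + d 0 * y + (g 1 - g 0) * x * y.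
  by rewrite Hd E1 dE; ring.
(* On the diagonal the mixed term is quadratic while [phi] is linear; the points t = 1 and t = 2
   already separate the two. *)
have g10 : g 1 - g 0 = 0.
  have A1 := E3 1; have A2 := E3 2; rewrite !phiE in A1 A2.
  have : 2 * (g 1 - g 0) = (c3 * 2) - 2 * (c3 * 1) by rewrite -A1 -A2; ring.
  by rewrite mulr1 mulrC [2 * c3]mulrC subrr => /eqP; rewrite mulf_eq0 pnatr_eq0 orbF => /eqP.
by exists (g 0), (d 0) => -[x y]; rewrite phiE g10 !mul0r addr0.
Qed.

Lemma rigid_torus : exists a b c d : C, forall z : N,
  F z = (a * z.1^* + b * z.2^*, c * z.1^* + d * z.2^*).
Proof.
have [|||a [b H1]] := @additive_on_lines (fun z => (F z).1^*).
- by move=> z w; rewrite -rmorphB nrmJ; exact: (nrm2_fst (F z - F w)).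
- by move=> z v; have [df1 [df2 [D _]]] := F_entire z v; exists df1.
- by rewrite F0 rmorph0.
have [|||c [d H2]] := @additive_on_lines (fun z => (F z).2^*).
- by move=> z w; rewrite -rmorphB nrmJ; exact: (nrm2_snd (F z - F w)).
- by move=> z v; have [df1 [df2 [_ D]]] := F_entire z v; exists df2.
- by rewrite F0 rmorph0.
exists a^*, b^*, c^*, d^* => z.
have E1 : (F z).1 = a^* * z.1^* + b^* * z.2^* by rewrite -[LHS]conjCK H1 rmorphD !rmorphM.
have E2 : (F z).2 = c^* * z.1^* + d^* * z.2^* by rewrite -[LHS]conjCK H2 rmorphD !rmorphM.
by rewrite -E1 -E2; case: (F z).
Qed.

End RigidTorus.

Section KodairaLattice.
Variable R : realType.
Notation C := (cplx R).
Notation N := (C * C)%type.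
Variable L : set N.
Hypothesis latL : lattice 1 L.

Lemma base_cocompact : exists r : R, forall z : C, exists2 a, (exists b, L (a, b)) & nrm (a + z) <= r.
Proof.
have [r Hr] := lattice_cocompact latL; exists r => z.
have [[a b] Lu uz] := Hr (z, 0); exists a; first by exists b.
by apply: le_trans uz; exact: (nrm2_fst (hop 1 (a, b) (z, 0))).
Qed.

Lemma base_independent :
  exists a1 b1 a2 b2, [/\ L (a1, b1), L (a2, b2) & im (a1^* * a2) != 0].
Proof.
have [r Hr] := base_cocompact; have [a1 [b1 L1] a10] := cocompact_neq0 Hr.
by have [a2 [b2 L2] h] := transverse_element a10 Hr; exists a1, b1, a2, b2.
Qed.

Lemma latticeB u v : L u -> L v -> L (hop 1 u (hinv 1 v)).
Proof. by move=> Lu Lv; apply: (latticeM latL) => //; exact: latticeV. Qed.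

Lemma commutator_mem a b a' b' : L (a, b) -> L (a', b') -> L (0, a^* * a' - a'^* * a).
Proof.
move=> Lu Lv.
have := latticeB (latticeM latL Lu Lv) (latticeM latL Lv Lu).
by congr (L _); rewrite /hop /hinv /= !rmorphD /=; congr (_, _); ring.
Qed.

Lemma fiber_diff_mem a b b' : L (a, b) -> L (a, b') -> L (0, b - b').
Proof.
move=> Lu Lv; have := latticeM latL (latticeV latL Lv) Lu.
by congr (L _); rewrite /hop /hinv /= !rmorphN /=; congr (_, _); ring.
Qed.

(** Commutators with two elements of independent base coordinates lie in the fibre of [L] and are
    bounded in terms of the base coordinate [a], so they take finitely many values; together they
    determine [a]. *)
Lemma base_locally_finite (r : R) : finite_set [set a : C | (exists b, L (a, b)) /\ nrm a <= r].
Proof.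
have [a1 [b1 [a2 [b2 [L1 L2 h]]]]] := base_independent.
pose P s := [set u | L u /\ nrm2 u <= s].
pose M := 2 * (nrm a1 + nrm a2) * r.
(* Eliminates conj(a) between the two commutators and solves for [a]. *)
pose g (p : N * N) : C :=
  (p.2.2 * a1 - p.1.2 * a2) / (a1 * a2^* - a1^* * a2).
apply: (@sub_finite_set _ _ (g @` (P M `*` P M))); last first.
  by apply: finite_image; apply: finite_setX; exact: lattice_fin latL M.
move=> a [[b La] ar].
have r0 : 0 <= r := le_trans (nrm_ge0 a) ar.
exists ((0, a1^* * a - a^* * a1), (0, a2^* * a - a^* * a2)).
  have bnd c : nrm (c^* * a - a^* * c) <= 2 * nrm c * r.
    apply: (le_trans (nrmB _ _)); rewrite !nrmM !nrmJ.
    have : nrm c * nrm a <= nrm c * r by rewrite ler_wpM2l ?nrm_ge0.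
    lra.
  have H1 := bnd a1; have H2 := bnd a2.
  have N1 : 0 <= nrm a1 * r by rewrite mulr_ge0 ?nrm_ge0.
  have N2 : 0 <= nrm a2 * r by rewrite mulr_ge0 ?nrm_ge0.
  split; split => /=.
  - exact: commutator_mem L1 La.
  - rewrite /nrm2 nrm0 add0r /M /=; lra.
  - exact: commutator_mem L2 La.
  - rewrite /nrm2 nrm0 add0r /M /=; lra.
rewrite /g /=.
have d0 : a1 * a2^* - a1^* * a2 != 0.
  apply/eqP => /(congr1 (@im R)); rewrite imB.
  have -> : im (a1 * a2^*) = - im (a1^* * a2) by rewrite -imJ rmorphM /= conjCK.
  by move=> /eqP; rewrite -opprD oppr_eq0 -mulr2n mulrn_eq0 /= (negbTE h).
by field.
Qed.

(** An element moving (0, z) into a ball has bounded base coordinate, hence one of finitely many.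
    Dividing by an element chosen once over that coordinate gives a fibre element at bounded
    cost. *)
Lemma fiber_cocompact : exists r : R, forall z : C, exists2 l, L (0, l) & nrm (l + z) <= r.
Proof.
have [r Hr] := lattice_cocompact latL.
have /choice[bb Hbb] : forall a : C, exists b, (exists b', L (a, b')) -> L (a, b).
  move=> a; have [[b Lb]|h] := pselect (exists b', L (a, b')); last by exists 0.
  by exists b.
have [M HM] := finite_set_bounded (fun a => nrm (bb a)) (base_locally_finite r).
exists (r + M) => z; have [[a b] Lu uz] := Hr (0, z).
have ar : nrm a <= r.
  by apply: le_trans uz; apply: le_trans (nrm2_fst _); rewrite /= addr0.
have bz : nrm (b + z) <= r.
  by apply: le_trans uz; apply: le_trans (nrm2_snd _); rewrite /= mulr0 addr0.
exists (b - bb a).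
  exact: fiber_diff_mem Lu (Hbb a (ex_intro _ b Lu)).
have -> : b - bb a + z = (b + z) - bb a by ring.
apply: (le_trans (nrmB _ _)); apply: lerD => //.
by apply: HM; split=> //; exists b.
Qed.

Variable F : N -> N.
Hypotheses (F0 : F 0 = 0) (FK : involutive F) (FL : forall u, L u -> L (F u)).
Hypothesis FM : forall u z, L u -> F (hop 1 u z) = hop 1 (F u) (F z).
Hypothesis F_entire : forall z v : N, exists df1 df2 : C -> C,
  (forall t : C, is_derive t 1 (fun s => (F (line z v s)).1^*) (df1 t)) /\
  (forall t : C, is_derive t 1 (fun s => (F (line z v s)).2^*) (df2 t)).

(** Fibre elements are central, and F maps [L] onto itself, so F(0, l) commutes with all of [L]. A
    nonzero first coordinate would make all base coordinates real multiples of one another. *)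
Lemma fiber_preserved l : L (0, l) -> (F (0, l)).1 = 0.
Proof.
move=> Ll; set w := F (0, l).
have comm v : L v -> w.1^* * v.1 = v.1^* * w.1.
  move=> Lv; have LFv := FL Lv.
  have : hop 1 (0, l) (F v) = hop 1 (F v) (0, l).
    by rewrite /hop /= rmorph0; congr (_, _); ring.
  move=> /(congr1 F); rewrite !FM // FK -/w => /(congr1 snd) /=; rewrite !mul1r.
  by move=> /eqP; rewrite [v.2 + w.2]addrC (inj_eq (addrI _)) => /eqP.
have [a1 [b1 [a2 [b2 [L1 L2 h]]]]] := base_independent.
have := comm _ L1; have := comm _ L2 => /= c2 c1.
apply/eqP; rewrite -[_ == _]negbK; apply/negP => w0.
move/eqP: h; apply.
have E : a1^* * a2 = a2^* * a1.
  apply: (mulfI w0); rewrite mulrA [w.1 * _]mulrC -c1 mulrA [w.1 * _]mulrC -c2; ring.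
have : im (a1^* * a2) = - im (a1^* * a2) by rewrite -imJ rmorphM /= conjCK E mulrC.
lra.
Qed.

Lemma slice_affine (phi : C -> C) (df : C -> C) (P : set C) (r : R) :
  (forall t : C, is_derive t 1 (fun s => (phi s)^*) (df t)) ->
  (forall z : C, exists2 l, P l & nrm (l + z) <= r) ->
  (forall l, P l -> exists c, forall z : C, phi (l + z) = phi z + c) ->
  exists c, forall z : C, phi z = phi 0 + c * z^*.
Proof.
move=> phid Pr Pphi.
have [l /Pphi[c Hc]|c Hc] := entire_quasiperiodic phid Pr.
  by exists c^* => z; rewrite Hc rmorphD.
by exists c^* => z; rewrite -[LHS]conjCK Hc rmorphD rmorphM /= conjCK.
Qed.

(** Only fibre slices and the slice y = 0 are used, for there lattice elements act by genuine
    translations. The slices are then tied together by the homomorphism property, which also forces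
    the factor |a|^2 on the fibre. *)
Lemma rigid_kodaira : exists a d : C, forall z,
  F z = (a * z.1^*, a * a^* * z.2^* + d * z.1^*).
Proof.
have [r1 Hr1] := base_cocompact; have [r2 Hr2] := fiber_cocompact.
have [l0 Ll0 l0n] := cocompact_neq0 Hr2.
have F001 : (F (0, 0)).1 = 0 by exact: (congr1 fst F0).
have F002 : (F (0, 0)).2 = 0 by exact: (congr1 snd F0).
have entire1 x : exists df : C -> C, forall t : C, is_derive t 1 (fun s => (F (x, s)).1^*) (df t).
  have [df1 [_ [D _]]] := F_entire (x, 0) (0, 1); exists df1 => t.
  have -> // : (fun s : C => (F (x, s)).1^*) = (fun s => (F (line (x, 0) (0, 1) s)).1^*).
  by apply/funext => s; rewrite /line /= mulr0 addr0 mulr1 add0r.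
have entire2 x : exists df : C -> C, forall t : C, is_derive t 1 (fun s => (F (x, s)).2^*) (df t).
  have [_ [df2 [_ D]]] := F_entire (x, 0) (0, 1); exists df2 => t.
  have -> // : (fun s : C => (F (x, s)).2^*) = (fun s => (F (line (x, 0) (0, 1) s)).2^*).
  by apply/funext => s; rewrite /line /= mulr0 addr0 mulr1 add0r.
have [df1 [df2 [D1 D2]]] := F_entire 0 (1, 0).
have lineE : line 0 (1, 0) = (fun s : C => (s, 0)).
  by apply/funext => s; rewrite /line /= mulr0 addr0 mulr1 add0r.
rewrite lineE in D1 D2.
have hop0 l x y : hop 1 (0, l) (x, y) = (x, l + y).
  by rewrite /hop /= rmorph0; congr (_, _); ring.
(* On a fibre the first component is antilinear up to a constant and has the nonzero period [l0], so
   it is constant. *)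
have F1 x y : (F (x, y)).1 = (F (x, 0)).1.
  have [df Dx] := entire1 x.
  have per l : L (0, l) -> forall z : C, (F (x, l + z)).1 = (F (x, z)).1 + 0.
    by move=> Ll z; rewrite -hop0 FM //= fiber_preserved // add0r addr0.
  have [|c Hc] := slice_affine Dx Hr2; first by move=> l Ll; exists 0; exact: per.
  have := per _ Ll0 0; rewrite !addr0 Hc => /eqP.
  rewrite -subr_eq0 addrAC subrr add0r mulf_eq0 conjC_eq0 (negbTE l0n) orbF => /eqP c0.
  by rewrite Hc c0 mul0r addr0.
have [|a Ha] := slice_affine D1 Hr1.
  move=> u [b Lu]; exists (F (u, b)).1 => z.
  have := FM (z, 0) Lu; rewrite /hop /= => /(congr1 fst) /=.
  by rewrite F1 => ->; rewrite addrC.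
have {}Ha x y : (F (x, y)).1 = a * x^* by rewrite F1 Ha F001 add0r.
(* The increment of the second component under [l0] is that of (0, l0) for every [x], so the slope
   along the fibre does not depend on [x]. *)
have [k Hk] : exists k, forall x y, (F (x, y)).2 = (F (x, 0)).2 + k * y^*.
  have per x l : L (0, l) -> forall z : C, (F (x, l + z)).2 = (F (x, z)).2 + (F (0, l)).2.
    by move=> Ll z; rewrite -hop0 FM //= fiber_preserved // rmorph0 mulr0 mul0r addr0 addrC.
  have /choice[k Hk] : forall x, exists k, forall y, (F (x, y)).2 = (F (x, 0)).2 + k * y^*.
    move=> x; have [df Dx] := entire2 x.
    have [|c Hc] := slice_affine Dx Hr2; first by move=> l Ll; exists (F (0, l)).2; exact: per.
    by exists c.
  exists (k 0) => x y; rewrite Hk; congr (_ + _ * _).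
  have := per x _ Ll0 0; have := per 0 _ Ll0 0.
  rewrite !addr0 [(F (x, l0)).2]Hk F002 add0r => _ /addrI H; rewrite Hk F002 add0r in H.
  by apply: (mulIf _ H); rewrite conjC_eq0.
have q u b z : L (u, b) -> (F (u + z, 0)).2 = (F (z, 0)).2 + (F (u, 0)).2 + (a * a^* - k) * (u * z^*).
  move=> Lu; have := FM (z, 0) Lu; rewrite /hop /= => /(congr1 snd) /=.
  rewrite Hk [(F (u, b)).2]Hk !Ha !rmorphD !rmorphM /= !conjCK rmorph1 rmorph0 => H.
  have -> : (F (u + z, 0)).2 = ((F (u + z, 0)).2 + k * (b^* + 0 + 1 * u * z^*)) - k * (b^* + u * z^*) by ring.
  by rewrite H; ring.
(* The left side of [q] is symmetric in [u] and [z], the last term is not: exchanging two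
   independent base elements forces its coefficient to vanish. *)
have ka : a * a^* - k = 0.
  have [a1 [b1 [a2 [b2 [L1 L2 h]]]]] := base_independent.
  have := q _ _ a2 L1; rewrite addrC (q _ _ a1 L2) => /eqP; rewrite -subr_eq0 => /eqP H.
  apply/eqP; rewrite -[_ == _]negbK; apply/negP => k0.
  have : a2 * a1^* - a1 * a2^* = 0.
    by apply: (mulfI k0); rewrite mulr0 -H; ring.
  move=> /(congr1 (@im R)); rewrite imB [a2 * _]mulrC.
  have -> : im (a1 * a2^*) = - im (a1^* * a2) by rewrite -imJ rmorphM /= conjCK.
  by move=> /eqP; rewrite opprK -mulr2n mulrn_eq0 /= (negbTE h).
have [|d Hd] := slice_affine D2 Hr1.
  by move=> u [b Lu]; exists (F (u, 0)).2 => z; rewrite (q _ _ z Lu) ka mul0r addr0.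
exists a, d => -[x y] /=; have -> : a * a^* = k by apply/eqP; rewrite -subr_eq0 ka.
have E1 := Ha x y; have E2 : (F (x, y)).2 = k * y^* + d * x^* by rewrite Hk Hd F002 add0r addrC.
by rewrite -E1 -E2; case: (F (x, y)).
Qed.

End KodairaLattice.

Lemma pair_mulz (K : comNzRingType) (m : K * K) (k : int) : m *~ k = (k%:~R * m.1, k%:~R * m.2).
Proof.
have nat_case n : m *+ n = (m.1 *+ n, m.2 *+ n).
  by elim: n => [|n IH]; rewrite ?mulr0n // !mulrS IH.
rewrite !mulrzl; case: k => n; first exact: nat_case.
by rewrite !NegzE !mulrNz -!pmulrn nat_case.
Qed.

(** * Lattices in the plane *)

Section RealLattices.
Variable R : realType.
Implicit Types (m v : R * R).

Lemma finite_set_min (A : set R) : finite_set A -> A !=set0 ->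
  exists2 d, A d & forall x, A x -> d <= x.
Proof.
move=> /finite_seqP[s ->]; elim: s => [|x s IH] [y]; first by [].
case: s IH => [|z s] IH.
  rewrite /= inE => /eqP _; exists x; rewrite /= ?mem_head // => w.
  by rewrite inE => /eqP ->.
have [|d ds Hd] := IH; first by exists z; rewrite /= mem_head.
move=> _; have [xd|dx] := leP x d.
  exists x; rewrite /= ?mem_head // => w; rewrite inE => /orP[/eqP -> //|/Hd].
  exact: le_trans.
exists d; first by rewrite /= inE ds orbT.
by move=> w; rewrite /= inE => /orP[/eqP ->|/Hd //]; exact: ltW.
Qed.

Lemma subgroup_mulz (V : zmodType) (K : set V) (z : V) (k : int) : K 0 ->
  (forall x y, K x -> K y -> K (x - y)) -> K z -> K (z *~ k).
Proof.
move=> K0 KB Kz; have KN x : K x -> K (- x) by move=> Kx; rewrite -sub0r; exact: KB.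
have Kn n : K (z *+ n).
  elim: n => [|n IH]; first by rewrite mulr0n.
  by rewrite mulrS -[z *+ n]opprK; apply: KB => //; exact: KN.
by case: k => n; [exact: Kn | rewrite NegzE mulrNz; apply: KN; exact: Kn].
Qed.

Lemma discrete_subgroup_cyclic (K : set R) : K 0 ->
  (forall x y, K x -> K y -> K (x - y)) ->
  (forall r, finite_set [set x | K x /\ `|x| <= r]) ->
  exists2 d, K d & forall x, K x -> exists k : int, x = d *~ k.
Proof.
move=> K0 KB Kfin.
have [[x Kx x0]|h] := pselect (exists2 x, K x & x != 0); last first.
  exists 0 => // x Kx; exists 0; rewrite mulr0z; apply: contrapT => x0.
  by apply: h; exists x => //; exact/eqP.
have [y Ky y0] : exists2 y, K y & 0 < y.
  have [xp|xn|x0'] := ltgtP x 0; last by rewrite x0' eqxx in x0.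
    by exists (- x); [rewrite -sub0r; exact: KB | rewrite oppr_gt0].
  by exists x.
have fA : finite_set [set z | K z /\ 0 < z <= y].
  apply: sub_finite_set (Kfin y) => z [Kz /andP[z0 zy]]; split => //.
  by rewrite ger0_norm // ltW.
have [|d [Kd /andP[d0 dy]] Hd] := finite_set_min fA.
  by exists y; split=> //; rewrite y0 lexx.
exists d => // z Kz; exists (Num.floor (z / d)).
have := floor_itv (z / d); rewrite intrD mulr1z => /andP[h1 h2].
rewrite ler_pdivlMr // in h1; rewrite ltr_pdivrMr // mulrDl mul1r in h2.
pose w := z - d *~ Num.floor (z / d).
have Kw : K w by exact: KB Kz (subgroup_mulz _ K0 KB Kd).
have dE : d *~ Num.floor (z / d) = (Num.floor (z / d))%:~R * d by rewrite mulrzl.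
have w0 : 0 <= w by rewrite /w dE subr_ge0.
have wd : w < d by rewrite /w dE ltrBlDl.
apply/eqP; rewrite -subr_eq0 -/w; apply/eqP; apply: contrapT => /eqP wn0.
have wp : 0 < w by rewrite lt_neqAle eq_sym wn0.
have : K w /\ 0 < w <= y by split; rewrite // wp (le_trans (ltW wd) dy).
move=> /Hd.
by rewrite leNgt wd.
Qed.

Definition det2 m v := m.1 * v.2 - m.2 * v.1.
Definition comb m v s t : R * R := (s * m.1 + t * v.1, s * m.2 + t * v.2).

Lemma comb_det m v w : det2 m v != 0 ->
  w = comb m v (det2 w v / det2 m v) (det2 m w / det2 m v).
Proof.
case: m v w => m1 m2 [v1 v2] [w1 w2] /= h; rewrite /comb /=.
by congr (_, _); rewrite /det2 /= in h *; field.
Qed.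

Lemma comb_inj m v s t s' t' : det2 m v != 0 -> comb m v s t = comb m v s' t' ->
  s = s' /\ t = t'.
Proof.
case: m v => m1 m2 [v1 v2] /= h [E1 E2]; rewrite /det2 /= in h.
split; apply: (mulIf h).
  have -> : s * (m1 * v2 - m2 * v1) = (s * m1 + t * v1) * v2 - (s * m2 + t * v2) * v1 by ring.
  by rewrite E1 E2; ring.
have -> : t * (m1 * v2 - m2 * v1) = (s * m2 + t * v2) * m1 - (s * m1 + t * v1) * m2 by ring.
by rewrite E1 E2; ring.
Qed.

Variable M : set (R * R).
Hypotheses (M0 : M 0) (MB : forall x y, M x -> M y -> M (x - y)).
Hypothesis Mfin : forall r : R, finite_set [set m | [/\ M m, `|m.1| <= r & `|m.2| <= r]].

Lemma multiples_cyclic v : v != 0 ->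
  exists2 d, M (d * v.1, d * v.2) &
    forall x, M (x * v.1, x * v.2) -> exists k : int, x = d *~ k.
Proof.
move=> v0; apply: (@discrete_subgroup_cyclic [set x | M (x * v.1, x * v.2)]).
- by rewrite /= !mul0r.
- by move=> x y Mx My /=; rewrite !mulrBl; exact: (MB Mx My).
move=> r; have := Mfin (r * (`|v.1| + `|v.2|)).
have [i vi] : exists i : bool, (if i then v.1 else v.2) != 0.
  have [v1|v1] := eqVneq v.1 0; last by exists true.
  exists false; apply: contra v0 => /eqP v2.
  by case: v v1 v2 => a b /= -> ->.
pose g m := (if i then m.1 else m.2) / (if i then v.1 else v.2).
move=> /(finite_image g); apply: sub_finite_set => x [/= Mx xr].
exists (x * v.1, x * v.2); last by rewrite /g /=; case: (i) vi => vi; rewrite mulfK.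
by split=> //=; rewrite normrM ler_pM // ?lerDl ?lerDr.
Qed.

(** The generator of the lattice vectors on the line of [v1], together with a vector whose
    [v2]-coordinate generates all [v2]-coordinates. *)
Lemma lattice_basis v1 v2 : M v1 -> M v2 -> det2 v1 v2 != 0 ->
  exists m1 m2, [/\ M m1, M m2, det2 m1 m2 != 0 &
    forall m, M m -> exists k l : int, m = comb m1 m2 k%:~R l%:~R].
Proof.
move=> Mv1 Mv2 D.
have v10 : v1 != 0.
  by apply: contra D => /eqP ->; rewrite /det2 !mul0r subr0.
have [s1 Ms1 Hs1] := multiples_cyclic v10.
have MD x y : M x -> M y -> M (x + y).
  by move=> Mx My; rewrite -[y]opprK; apply: MB => //; rewrite -sub0r; exact: MB.
pose T := [set t | exists s, M (comb v1 v2 s t)].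
have Mmul k : M (k%:~R * v1.1, k%:~R * v1.2).
  by have := subgroup_mulz k M0 MB Mv1; rewrite pair_mulz.
have [t0 [s0 Mt0] Ht0] : exists2 d, T d & forall x, T x -> exists k : int, x = d *~ k.
  apply: discrete_subgroup_cyclic.
  - by exists 0; rewrite /comb !mul0r addr0.
  - move=> t t' [s Ms] [s' Ms']; exists (s - s').
    have := MB Ms Ms'; congr (M _); rewrite /comb; congr (_, _) => /=; ring.
  (* The [v2]-coordinates form a discrete group because subtracting an integer multiple of [v1]
     brings the other coordinate into [0, 1) without changing them. *)
  - move=> r; pose B := `|v1.1| + `|v1.2| + r * (`|v2.1| + `|v2.2|).
    have := finite_image (fun m => det2 v1 m / det2 v1 v2) (Mfin B).
    apply: sub_finite_set => t [[s Ms] tr].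
    pose k := Num.floor s; have /andP[h1 h2] := floor_itv s.
    rewrite intrD in h2.
    exists (comb v1 v2 (s - k%:~R) t); last first.
      by rewrite /det2 /comb /= in D *; field.
    have s1' : `|s - k%:~R| <= 1 by rewrite ler_norml; apply/andP; split; rewrite /k; lra.
    have bnd (a b : R) : `|(s - k%:~R) * a + t * b| <= `|a| + r * `|b|.
      apply: (le_trans (ler_normD _ _)); rewrite !normrM; apply: lerD.
        by rewrite -[leRHS]mul1r ler_wpM2r.
      by rewrite ler_wpM2r.
    have r0 : 0 <= r := le_trans (normr_ge0 _) tr.
    have q1 : 0 <= r * `|v2.1| by rewrite mulr_ge0.
    have q2 : 0 <= r * `|v2.2| by rewrite mulr_ge0.
    have p1 := normr_ge0 v1.1; have p2 := normr_ge0 v1.2.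
    split.
    + have := MB Ms (Mmul k); congr (M _); rewrite /comb; congr (_, _) => /=; ring.
    + by apply: (le_trans (bnd _ _)); rewrite /B; lra.
    + by apply: (le_trans (bnd _ _)); rewrite /B; lra.
have [k1 E1] : exists k : int, 1 = t0 *~ k.
  by apply: Ht0; exists 0; rewrite /comb !mul0r !mul1r !add0r -surjective_pairing.
have [k2 E2] : exists k : int, 1 = s1 *~ k.
  by apply: Hs1; rewrite !mul1r -surjective_pairing.
have t00 : t0 != 0.
  by apply/eqP => t00; move: E1; rewrite t00 mul0rz => /eqP; rewrite oner_eq0.
have s10 : s1 != 0.
  by apply/eqP => s10; move: E2; rewrite s10 mul0rz => /eqP; rewrite oner_eq0.
exists (s1 * v1.1, s1 * v1.2), (comb v1 v2 s0 t0); split=> //.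
  have -> : det2 (s1 * v1.1, s1 * v1.2) (comb v1 v2 s0 t0) = s1 * t0 * det2 v1 v2.
    by rewrite /det2 /comb /=; ring.
  by rewrite !mulf_neq0.
move=> m Mm; have mE := comb_det m D.
set s := _ / _ in mE; set t := _ / _ in mE; clearbody s t.
have [l tl] := Ht0 t (ex_intro _ s (ltac:(by rewrite -mE) : M (comb v1 v2 s t))).
have Ml : M (comb v1 v2 s0 t0 *~ l) by exact: subgroup_mulz.
have combz : comb v1 v2 s0 t0 *~ l = (l%:~R * (comb v1 v2 s0 t0).1, l%:~R * (comb v1 v2 s0 t0).2).
  exact: pair_mulz.
have [k sk] : exists k : int, s - l%:~R * s0 = s1 *~ k.
  apply: Hs1; have := MB Mm Ml; congr (M _); rewrite combz mE tl -mulrzl /comb.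
  by congr (_, _) => /=; ring.
exists k, l; rewrite mE; have -> : s = k%:~R * s1 + l%:~R * s0 by rewrite [_ * s1]mulrzl -sk subrK.
by rewrite tl -mulrzl /comb; congr (_, _) => /=; ring.
Qed.

(** The rank may be 0, 1 or 2, missing generators being 0, so that the rank of the lattice of
    cocycles of a torus need not be computed. *)
Lemma two_generators : exists m1 m2, [/\ M m1, M m2 &
    forall m, M m -> exists k l : int, m = comb m1 m2 k%:~R l%:~R].
Proof.
have [[v1 [v2 [Mv1 Mv2 D]]]|h] := pselect (exists v1 v2, [/\ M v1, M v2 & det2 v1 v2 != 0]).
  by have [m1 [m2 [? ? _ ?]]] := lattice_basis Mv1 Mv2 D; exists m1, m2.
have [[v Mv v0]|h0] := pselect (exists2 v, M v & v != 0); last first.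
  exists 0, 0; split=> // m Mm; exists 0, 0; rewrite /comb !mulr0 addr0.
  by apply: contrapT => m0; apply: h0; exists m => //; exact/eqP.
have [d Md Hd] := multiples_cyclic v0.
exists (d * v.1, d * v.2), 0; split=> // m Mm.
have : det2 v m = 0.
  by apply: contrapT => D; apply: h; exists v, m; split=> //; exact/eqP.
rewrite /det2 => /eqP; rewrite subr_eq0 => /eqP D.
have [x mx] : exists x, m = (x * v.1, x * v.2).
  have [v1|v1] := eqVneq v.1 0.
    have v2 : v.2 != 0.
      by apply: contra v0 => /eqP v2; case: v v1 v2 {Mv h Md Hd D} => a b /= -> ->.
    exists (m.2 / v.2); rewrite v1 mulr0 divfK //.
    have m10 : m.1 = 0 by apply: (mulfI v2); rewrite -D v1 mul0r mulr0.
    by case: m m10 {Mm D} => a b /= ->.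
  exists (m.1 / v.1); rewrite divfK //.
  have -> : m.1 / v.1 * v.2 = m.2.
    by apply: (mulfI v1); rewrite D; field.
  by case: (m).
have [k xk] := Hd x (ltac:(by rewrite -mx)).
by exists k, 0; rewrite mx xk -mulrzl /comb /=; congr (_, _); ring.
Qed.

Lemma cocompact_independent r : (forall y : R * R, exists2 m, M m & `|m.1 + y.1| <= r /\ `|m.2 + y.2| <= r) ->
  exists v1 v2, [/\ M v1, M v2 & det2 v1 v2 != 0].
Proof.
move=> Mr; have r0 : 0 <= r by have [m _ [h _]] := Mr 0; exact: le_trans h.
(* The shift [3 * r + 1] leaves diagonal entries at least [2 * r + 1] against off-diagonal entries
   at most [r], so the determinant is positive. *)
have [v1 Mv1 /= [h1 h2]] := Mr (- (3 * r + 1), 0).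
have [v2 Mv2 /= [h3 h4]] := Mr (0, - (3 * r + 1)).
exists v1, v2; split=> //; apply: lt0r_neq0; rewrite /det2.
rewrite addr0 in h2; rewrite addr0 in h3.
have a1 : 2 * r + 1 <= v1.1 by move: h1; rewrite ler_norml; lra.
have a2 : 2 * r + 1 <= v2.2 by move: h4; rewrite ler_norml; lra.
have A1 : (2 * r + 1) * (2 * r + 1) <= v1.1 * v2.2 by apply: ler_pM => //; lra.
have A2 : v1.2 * v2.1 <= r * r.
  by apply: (le_trans (ler_norm _)); rewrite normrM; exact: ler_pM (normr_ge0 _) (normr_ge0 _) h2 h3.
have A3 := mulr_ge0 r0 r0.
rewrite subr_gt0; apply: (le_lt_trans A2); apply: lt_le_trans A1; nra.
Qed.

End RealLattices.

Section Representatives.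

(** The labels [c] need not be constant on classes; they only bound the number of classes. The exact
    number is the least size of a family meeting every class, and minimality makes its members
    inequivalent. *)
Lemma minimal_representatives (T : Type) (X : set T) (E : T -> T -> Prop)
    (I : finType) (c : T -> I) : X !=set0 ->
  (forall z w, E z w -> E w z) -> (forall y z w, E y z -> E z w -> E y w) ->
  (forall z w, X z -> X w -> c z = c w -> E z w) ->
  exists t (x : 'I_t -> T), [/\ (1 <= t <= #|I|)%N, forall i, X (x i),
    forall z, X z -> exists i, E z (x i) & forall i j, E (x i) (x j) -> i = j].
Proof.
move=> [z0 Xz0] Esym Etr cE.
pose P n := `[< exists x : 'I_n -> T, (forall i, X (x i)) /\ forall z, X z -> exists i, E z (x i) >].
have PI : P #|I|.
  apply/asboolP.
  have /choice[y yP] : forall k : I, exists y, X y /\ forall z, X z -> c z = k -> c y = k.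
    move=> k; have [[y Xy yk]|h] := pselect (exists2 y, X y & c y = k).
      by exists y.
    by exists z0; split=> // z Xz zk; case: h; exists z.
  exists (fun i => y (enum_val i)); split=> [i|z Xz]; first by have [] := yP (enum_val i).
  exists (enum_rank (c z)); rewrite enum_rankK; have [Xy yc] := yP (c z).
  by apply: cE => //; rewrite (yc z).
have exP : exists n, P n by exists #|I|.
case: (ex_minnP exP) => t /asboolP[x [Xx xE]] tmin.
exists t, x; split=> //.
  rewrite (tmin _ PI) andbT; have [i _] := xE _ Xz0.
  by apply: leq_trans (ltn_ord i).
move=> i j Eij; apply: contrapT => /eqP ij.
case: t x Xx xE tmin i j Eij ij => [|n] x Xx xE tmin i j Eij ij; first by case: i Eij ij.
have : P n.
  apply/asboolP; exists (fun k => x (lift i k)); split=> // z Xz.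
  have [k Ek] := xE z Xz.
  have [ki|ki] := eqVneq i k; last by have [k' kE _] := unlift_some ki; exists k'; rewrite -kE.
  have [k' kE _] := unlift_some ij; exists k'; rewrite -kE; apply: Etr Eij.
  by rewrite ki.
by move=> /tmin; rewrite ltnn.
Qed.

End Representatives.

(** * The circle as the quotient of R by Z *)

Section Circle.
Variable R : realType.
Implicit Types (s t x y : R).

Lemma cir_subproof t : (cos (pi *+ 2 * t), sin (pi *+ 2 * t)) \in @circle R.
Proof. by apply/mem_set; exact: cos2Dsin2. Qed.

Definition cir t : @circle R := @exist (R * R) (fun p => p \in @circle R) _ (cir_subproof t).

Lemma twopi_gt0 : 0 < (pi : R) *+ 2.
Proof. by rewrite mulrn_wgt0 // pi_gt0. Qed.

Lemma periodic_int (f : R -> R) (T : R) (k : int) : periodic f T ->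
  forall x, f (x + T * k%:~R) = f x.
Proof.
move=> fT x; case: k => n; first by rewrite -pmulrn mulr_natr periodicn.
by rewrite NegzE mulrNz -pmulrn mulrN mulr_natr -[in RHS](subrK (T *+ n.+1) x) periodicn.
Qed.

Lemma cos_eq1_int x : cos x = 1 -> exists k : int, x = pi *+ 2 * k%:~R.
Proof.
move=> cx; have p0 := twopi_gt0; pose k := Num.floor (x / (pi *+ 2)).
have := floor_itv (x / (pi *+ 2)); rewrite -/k intrD mulr1z => /andP[h1 h2].
rewrite ler_pdivlMr // in h1; rewrite ltr_pdivrMr // in h2.
exists k; pose y := x - pi *+ 2 * k%:~R.
have cy : cos y = 1.
  by rewrite -cx -[in RHS](subrK (pi *+ 2 * k%:~R) x) (periodic_int _ (@cosD2pi R)).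
have y0 : 0 <= y by rewrite subr_ge0 mulrC.
have y2 : y < pi *+ 2 by rewrite /y ltrBlDl; apply: lt_le_trans h2 _; rewrite mulrDl mul1r mulrC.
have pi0 := pi_gt0 R.
suff y00 : y = 0 by apply/eqP; rewrite -subr_eq0 -/y y00.
have cos1_0 (z : R) : 0 <= z -> z <= pi -> cos z = 1 -> z = 0.
  move=> z0 zp cz; have := @cosK R z; rewrite in_itv /= z0 zp => /(_ isT) <-.
  by rewrite cz acos1.
have [yp|py] := leP y pi; first exact: cos1_0.
have : pi *+ 2 - y = 0.
  apply: cos1_0; [by rewrite subr_ge0 ltW|by rewrite mulr2n; lra|].
  by rewrite cosB cos2pi sin2pi mul1r mul0r addr0.
by move: y2; lra.
Qed.

Lemma cir_eq s t : cir s = cir t -> exists k : int, s - t = k%:~R.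
Proof.
move=> /(congr1 (@set_val _ _)); rewrite !set_valE /= => -[E1 E2].
have [|k Hk] := @cos_eq1_int (pi *+ 2 * s - pi *+ 2 * t).
  by rewrite cosB E1 E2 -!expr2 cos2Dsin2.
exists k; apply: (mulfI (lt0r_neq0 twopi_gt0)); by rewrite mulrBr.
Qed.

Lemma cir_int s t (k : int) : s = t + k%:~R -> cir s = cir t.
Proof.
move=> ->; apply: val_inj; rewrite /= mulrDr.
by rewrite (periodic_int _ (@cosD2pi R)) (periodic_int _ (@sinD2pi R)).
Qed.

Lemma cir_surj (c : @circle R) : exists t, cir t = c.
Proof.
case: c => -[x y] h; have xy : x ^+ 2 + y ^+ 2 = 1 by have /set_mem := h.
have x1 : -1 <= x <= 1.
  rewrite -ler_norml -(@expr_le1 _ 2) // real_normK ?num_real //.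
  by rewrite -xy lerDl sqr_ge0.
have sx : sin (acos x) = `|y|.
  rewrite sin_acos // -sqrtr_sqr; congr Num.sqrt; lra.
have cx : cos (acos x) = x by rewrite acosK // in_itv.
have p0 := lt0r_neq0 twopi_gt0.
exists ((if 0 <= y then acos x else - acos x) / (pi *+ 2)).
apply: val_inj => /=; rewrite mulrCA mulfV // mulr1.
case: (leP 0 y) => y0; first by rewrite cx sx ger0_norm.
by rewrite cosN sinN cx sx ltr0_norm // opprK.
Qed.

Lemma cir_continuous : continuous cir.
Proof.
apply: continuous_comp_initial => t.
have c1 : continuous (fun t : R => pi *+ 2 * t).
  by move=> u; apply: cvgM; [exact: cvg_cst | exact: cvg_id].
have H1 : cos (pi *+ 2 * u) @[u --> t] --> cos (pi *+ 2 * t).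
  by apply: (@continuous_comp _ _ _ (fun t => pi *+ 2 * t) (@cos R)); [exact: c1 | exact: continuous_cos].
have H2 : sin (pi *+ 2 * u) @[u --> t] --> sin (pi *+ 2 * t).
  by apply: (@continuous_comp _ _ _ (fun t => pi *+ 2 * t) (@sin R)); [exact: c1 | exact: continuous_sin].
exact: (cvg_pair H1 H2).
Qed.

Lemma circle_fst_continuous : continuous (fun c : @circle R => (set_val c).1).
Proof.
move=> c; apply: (@continuous_comp _ _ _ (set_val : @circle R -> R * R) fst).
  exact: initial_continuous.
exact: cvg_fst.
Qed.
Lemma circle_snd_continuous : continuous (fun c : @circle R => (set_val c).2).
Proof.
move=> c; apply: (@continuous_comp _ _ _ (set_val : @circle R -> R * R) snd).
  exact: initial_continuous.
exact: cvg_snd.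
Qed.

(* Near [cir t0], the angle relative to [t0] is the arcsine of the ordinate in
   the frame rotated by [t0]. *)
Lemma cir_local_section t0 : exists g : @circle R -> R,
  [/\ g (cir t0) = t0, {for cir t0, continuous g} & \forall c \near cir t0, cir (g c) = c].
Proof.
pose th := pi *+ 2 * t0.
pose X (c : @circle R) := (set_val c).1 * cos th + (set_val c).2 * sin th.
pose Y (c : @circle R) := (set_val c).2 * cos th - (set_val c).1 * sin th.
have cX : continuous X.
  move=> c; have H1 := @circle_fst_continuous c; have H2 := @circle_snd_continuous c.
  exact: (cvgD (cvgM H1 (cvg_cst (cos th))) (cvgM H2 (cvg_cst (sin th)))).
have cY : continuous Y.
  move=> c; have H1 := @circle_fst_continuous c; have H2 := @circle_snd_continuous c.
  exact: (cvgB (cvgM H2 (cvg_cst (cos th))) (cvgM H1 (cvg_cst (sin th)))).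
have Y0 : Y (cir t0) = 0 by rewrite /Y set_valE /= -/th mulrC subrr.
have X0 : X (cir t0) = 1 by rewrite /X set_valE /= -/th -!expr2 cos2Dsin2.
have asin0 : asin 0 = 0 :> R.
  by rewrite -[X in asin X]sin0 sinK // in_itv /= oppr_le0 divr_ge0 // pi_ge0.
have p0 := lt0r_neq0 twopi_gt0.
exists (fun c => t0 + asin (Y c) / (pi *+ 2)); split.
- by rewrite Y0 asin0 mul0r addr0.
- have HA : {for cir t0, continuous (fun c => asin (Y c))}.
    apply: (@continuous_comp _ _ _ Y (@asin R)); first exact: cY.
    by apply: continuous_asin; rewrite Y0 ltrN10 ltr01.
  exact: (cvgD (cvg_cst t0) (cvgM HA (cvg_cst (pi *+ 2)^-1))).
- have : \forall c \near cir t0, 0 < X c.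
    have nb : nbhs (X (cir t0)) [set x | 0 < x].
      by rewrite X0; apply: open_nbhs_nbhs; split; [exact: open_gt | exact: ltr01].
    exact: (cX _ _ nb).
  apply: filterS => c Xc.
  have cc : (set_val c).1 ^+ 2 + (set_val c).2 ^+ 2 = 1 by have /set_mem := valP c.
  have XY : X c ^+ 2 + Y c ^+ 2 = 1.
    rewrite -[RHS]cc -[RHS]mulr1 -(cos2Dsin2 th) /X /Y; ring.
  have Y1 : -1 <= Y c <= 1.
    rewrite -ler_norml -(@expr_le1 _ 2) // real_normK ?num_real //.
    by rewrite -XY lerDr sqr_ge0.
  have sY : sin (asin (Y c)) = Y c by rewrite asinK // in_itv.
  have cYX : cos (asin (Y c)) = X c.
    rewrite cos_asin // -[RHS]ger0_norm ?ltW // -sqrtr_sqr; congr Num.sqrt; lra.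
  apply: val_inj => /=.
  have -> : pi *+ 2 * (t0 + asin (Y c) / (pi *+ 2)) = th + asin (Y c).
    by rewrite /th mulrDr mulrCA mulfV // mulr1.
  rewrite cosD sinD sY cYX.
  have E1 : cos th * X c - sin th * Y c = (set_val c).1.
    by rewrite -[RHS]mulr1 -(cos2Dsin2 th) /X /Y; ring.
  have E2 : sin th * X c + cos th * Y c = (set_val c).2.
    by rewrite -[RHS]mulr1 -(cos2Dsin2 th) /X /Y; ring.
  by rewrite E1 E2; exact: (esym (surjective_pairing (set_val c))).
Qed.

End Circle.

Definition hop_simp R :=
  (@hopK R, @hopVK R, @hopV R, @hVop R, @hopz0 R, @hop0z R).

(** * Components of the fixed locus *)

Section Components.
Variable R : realType.
Notation C := (cplx R).
Notation N := (C * C)%type.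
Variables (e : C) (L : set N) (S : topologicalType) (p : N -> S) (sigma : S -> S).
Variables (F : N -> N) (psi : R * R -> N) (chi : N -> R * R) (I : finType) (P : N -> I -> Prop).
Hypotheses (latL : lattice e L) (covp : covering e L p).
Hypothesis pF : forall z, p (F z) = sigma (p z).
Hypothesis FM : forall u z, F (hop e u z) = hop e (F u) (F z).
Hypotheses (FK : involutive F) (cF : continuous F) (FL : forall u, L u -> L (F u)).
Hypotheses (cpsi : continuous psi) (cchi : continuous chi) (psiK : cancel psi chi).
Hypothesis psiD : forall x y, psi (x + y) = hop e (psi x) (psi y).
Hypotheses (Fpsi : forall x, F (psi x) = psi x) (chiK : forall v, F v = v -> psi (chi v) = v).
(* [P u c] says that the cocycle [u] lies in the twisted conjugacy class with label [c]. *)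
Hypothesis class_exists : forall u, L u -> hop e u (F u) = 0 -> exists c, P u c.
Hypothesis class_eq : forall u v c, L u -> L v -> hop e u (F u) = 0 -> hop e v (F v) = 0 ->
  P u c -> P v c -> exists2 h, L h & u = hop e (hop e h v) (hinv e (F h)).

Lemma F_zero : F 0 = 0.
Proof. by apply: (@hop_inj R e (F 0)); rewrite -FM !hopz0. Qed.

Lemma F_inv u : F (hinv e u) = hinv e (F u).
Proof. by apply: (@hop_inj R e (F u)); rewrite -FM !hopV F_zero. Qed.

Lemma psi_zero : psi 0 = 0.
Proof. by apply: (@hop_inj R e (psi 0)); rewrite -psiD addr0 hopz0. Qed.

Lemma psi_opp y : psi (- y) = hinv e (psi y).
Proof. by apply: (@hop_inj R e (psi y)); rewrite -psiD subrr hopV psi_zero. Qed.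

(* [p z] is fixed by [sigma] iff [defect z] is in [L], and then it is a cocycle; two
   fixed points lie on the same torus iff their cocycles are twisted conjugate. *)
Definition defect z := hop e z (hinv e (F z)).

Lemma fixed_defect z : sigma (p z) = p z <-> L (defect z).
Proof.
rewrite -pF; split=> [/(covering_fiber covp)[u Lu zu]|Ld].
  by rewrite /defect {1}zu -hopA hopV hopz0.
by apply/(covering_fiber covp); exists (defect z) => //; rewrite /defect -hopA hVop hopz0.
Qed.

Lemma defect_cocycle z : hop e (defect z) (F (defect z)) = 0.
Proof. by rewrite /defect FM F_inv FK -!hopA !hop_simp. Qed.

Lemma defect_hop h z : defect (hop e h z) = hop e (hop e h (defect z)) (hinv e (F h)).
Proof. by rewrite /defect FM hinvM -!hopA. Qed.

Lemma defect_psi z y : defect (hop e z (psi y)) = defect z.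
Proof. by rewrite /defect FM Fpsi hinvM -!hopA !hop_simp. Qed.

(** Equality of the defects says exactly that w^-1 z is fixed by F, hence lies in the image of
    [psi]. *)
Lemma defect_eq z w : defect z = defect w -> z = hop e w (psi (chi (hop e (hinv e w) z))).
Proof.
move=> E; rewrite chiK ?hop_simp //.
rewrite FM F_inv; apply: (@hop_inj R e w).
have : hop e (defect w) (F z) = hop e (defect z) (F z) by rewrite E.
by rewrite /defect -!hopA !hop_simp.
Qed.

Lemma defect_continuous : continuous defect.
Proof. by move=> z; apply: cvg_hop; [exact: cvg_id | apply: cvg_hinv; exact: cF]. Qed.

Definition same_component z w :=
  exists2 h, L h & defect z = hop e (hop e h (defect w)) (hinv e (F h)).

Lemma same_component_sym z w : same_component z w -> same_component w z.
Proof.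
move=> [h Lh E]; exists (hinv e h); first exact: latticeV latL _ Lh.
by rewrite E F_inv hinvK -!hopA !hop_simp.
Qed.

Lemma same_component_trans y z w :
  same_component y z -> same_component z w -> same_component y w.
Proof.
move=> [h Lh E1] [k Lk E2]; exists (hop e h k); first exact: latticeM latL _ _ Lh Lk.
by rewrite E1 E2 FM hinvM -!hopA.
Qed.

(** The period lattice in R^2 of the torus y |-> p(x psi(y)). *)
Definition stab (x : N) : set (R * R) := [set m | L (hop e (hop e x (psi m)) (hinv e x))].

Lemma stab0 x : stab x 0.
Proof. by rewrite /stab /= psi_zero hopz0 hopV; exact: lattice0 latL. Qed.

Lemma stabB x m m' : stab x m -> stab x m' -> stab x (m - m').
Proof.
move=> Mm Mm'; have := latticeM latL Mm (latticeV latL Mm').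
by congr (L _); rewrite psiD psi_opp !hinvM hinvK -!hopA !hop_simp.
Qed.

Lemma component_eq x y y' :
  p (hop e x (psi y)) = p (hop e x (psi y')) <-> stab x (y' - y).
Proof.
rewrite /stab /= psiD psi_opp; split=> [/(covering_fiber covp)[u Lu E]|Lu].
  by move: Lu; congr (L _); rewrite hopA E -!hopA !hop_simp.
apply/(covering_fiber covp); eexists; first exact: Lu.
by rewrite -!hopA !hop_simp.
Qed.

Definition rbox (r : R) : set (R * R) := `[- r, r] `*` `[- r, r].

Lemma rbox_compact r : compact (rbox r).
Proof. by apply: compact_setX; exact: segment_compact. Qed.

Lemma conj_continuous2 (x w : N) : continuous (fun y => hop e (hop e x (psi y)) w).
Proof.
move=> y; apply: cvg_hop; last exact: cvg_cst.
by apply: cvg_hop; [exact: cvg_cst | exact: cpsi].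
Qed.

Lemma stab_fin x (r : R) : finite_set [set m | [/\ stab x m, `|m.1| <= r & `|m.2| <= r]].
Proof.
have [B HB] := continuous_bounded_ball (@rbox_compact r) (@conj_continuous2 x (hinv e x)).
have := finite_image (fun u => chi (hop e (hinv e x) (hop e u x))) (lattice_fin latL B).
apply: sub_finite_set => m [Mm m1 m2].
exists (hop e (hop e x (psi m)) (hinv e x)); last by rewrite -!hopA !hop_simp psiK.
by split; [exact: Mm | apply: HB; split; rewrite /= in_itv /= -ler_norml].
Qed.

(** A lattice element h brings x psi(y) into a fixed box, where the defect takes finitely many
    values in [L]. Correcting h by an element chosen once for the value reached makes it commute
    with the twist by F, and so turns it into a period that brings [y] into a bounded set. *)
Lemma stab_cocompact x : L (defect x) -> exists r : R, forall y : R * R,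
  exists2 m, stab x m & `|m.1 + y.1| <= r /\ `|m.2 + y.2| <= r.
Proof.
move=> Lx; have [r Hr] := lattice_cocompact latL.
have [B HB] := continuous_bounded_ball (@box2_compact R r) defect_continuous.
pose A := [set w | L w /\ nrm2 w <= B].
have fA : finite_set A := lattice_fin latL B.
(* One [k w] for each twisted conjugate [w] of the defect of [x]; the default 0 at other [w] is
   never reached. *)
have /choice[k kP] : forall w, exists k, (exists2 h, L h & w = hop e (hop e h (defect x)) (hinv e (F h))) ->
    L k /\ w = hop e (hop e k (defect x)) (hinv e (F k)).
  move=> w; have [[h Lh wh]|nh] := pselect (exists2 h, L h & w = hop e (hop e h (defect x)) (hinv e (F h))).
    by exists h.
  by exists 0.
pose q w z := chi (hop e (hinv e x) (hop e (hinv e (k w)) z)).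
have cq w : continuous (q w).
  move=> z; apply: (@continuous_comp _ _ _ (fun z => hop e (hinv e x) (hop e (hinv e (k w)) z)) chi).
    by apply: cvg_hop; [exact: cvg_cst | apply: cvg_hop; [exact: cvg_cst | exact: cvg_id]].
  exact: cchi.
have /choice[b bP] : forall w, exists b, forall z, box2 r z -> `|(q w z).1| <= b /\ `|(q w z).2| <= b.
  move=> w; have [|b1 H1] := @compact_bounded_fun R _ (box2 r) (fun z => `|(q w z).1|) (@box2_compact R r).
    move=> z; apply: (@continuous_comp _ _ _ (fun z => (q w z).1)); last exact: norm_continuous.
    by apply: (@continuous_comp _ _ _ (q w) fst); [exact: cq | exact: cvg_fst].
  have [|b2 H2] := @compact_bounded_fun R _ (box2 r) (fun z => `|(q w z).2|) (@box2_compact R r).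
    move=> z; apply: (@continuous_comp _ _ _ (fun z => (q w z).2)); last exact: norm_continuous.
    by apply: (@continuous_comp _ _ _ (q w) snd); [exact: cq | exact: cvg_snd].
  by exists (Num.max b1 b2) => z Kz; rewrite !le_max H1 // H2 // orbT.
have [b0 Hb0] := finite_set_bounded b fA.
exists b0 => y; pose z := hop e x (psi y).
have [h Lh hz] := Hr z; have bz := nrm2_box2 hz.
pose w := defect (hop e h z).
have wE : w = hop e (hop e h (defect x)) (hinv e (F h)) by rewrite /w defect_hop defect_psi.
have Lw : L w.
  rewrite wE; apply: latticeM latL _ _ _ (latticeV latL (FL Lh)).
  exact: latticeM latL _ _ Lh Lx.
have Aw : A w by split; [exact: Lw | exact: HB].
have [Lk wk] := kP w (ex_intro2 _ _ h Lh wE).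
(* Both [h] and [k w] carry the defect of [x] to [w], so [h'] preserves it; this is the statement
   that [v] below is fixed by F. *)
pose h' := hop e (hinv e (k w)) h.
pose v := hop e (hinv e x) (hop e h' x).
have Lh' : L h' by apply: latticeM latL _ _ (latticeV latL Lk) Lh.
have Fv : F v = v.
  rewrite /v /h' !FM !F_inv.
  have E : hop e (hop e h (defect x)) (hinv e (F h)) = hop e (hop e (k w) (defect x)) (hinv e (F (k w))).
    by rewrite -wE.
  rewrite /defect in E.
  apply: (@hop_inj R e x); rewrite hopVK; apply: (@hop_inj R e (k w)).
  rewrite -!hopA in E *; rewrite hopVK.
  have := congr1 (fun u => hop e u (hop e (F h) (F x))) E.
  by rewrite -!hopA !hop_simp => ->; rewrite ?hop_simp.
have psim : psi (chi v) = v := chiK Fv.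
exists (chi v).
  by rewrite /stab /= psim /v -!hopA !hop_simp.
have -> : (chi v).1 + y.1 = (chi v + y).1 by [].
have -> : (chi v).2 + y.2 = (chi v + y).2 by [].
have -> : chi v + y = q w (hop e h z).
  rewrite -[LHS]psiK psiD psim /q /v /h' /z; congr chi.
  by rewrite -!hopA.
have [h1 h2] := bP w _ bz.
by split; [apply: le_trans h1 _ | apply: le_trans h2 _]; exact: Hb0.
Qed.

Lemma discrete_near (u0 : N) : \forall u \near u0, L u -> u = u0.
Proof.
have [d d0 Hd] := finite_isolated u0 (lattice_fin latL (nrm2 u0 + 1)).
apply/nbhs_nrm2; exists (Num.min d 1); first by rewrite lt_min d0 ltr01.
move=> u; rewrite lt_min => /andP[ud u1] Lu; apply: Hd => //; split=> //.
by have := nrm2D (u - u0) u0; rewrite subrK; lra.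
Qed.

Lemma fixed_locus_tori : (exists s, sigma s = s) ->
  exists t : nat, (1 <= t <= #|I|)%N /\
    homeomorphic [set s | sigma s = s] {i : 'I_t & torus R}.
Proof.
move=> [s1 Fs1].
pose X := [set z | L (defect z)].
have X0 : X !=set0.
  have [z zs] := covering_surj covp s1; exists z; apply/fixed_defect; by rewrite zs.
have /choice[cls clsP] : forall z, exists c, L (defect z) -> P (defect z) c.
  move=> z; have [Lz|nLz] := pselect (L (defect z)).
    by have [c Pc] := class_exists Lz (defect_cocycle z); exists c.
  have [z0 Lz0] := X0; have [c _] := class_exists Lz0 (defect_cocycle z0); by exists c.
have [|t [x [tI Xx cover uniq]]] := @minimal_representatives N X same_component I cls X0
  same_component_sym same_component_trans.
  move=> z w Xz Xw zw; apply: (class_eq Xz Xw (defect_cocycle z) (defect_cocycle w) (clsP z Xz)).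
  by rewrite zw; exact: clsP.
exists t; split=> //.
have /choice[m1 /choice[m2 mP]] : forall i : 'I_t, exists m1 m2, [/\ stab (x i) m1, stab (x i) m2,
    det2 m1 m2 != 0 & forall m, stab (x i) m -> exists k l : int, m = comb m1 m2 k%:~R l%:~R].
  move=> i; have [r Hr] := stab_cocompact (Xx i).
  have [v1 [v2 [Mv1 Mv2 D]]] := cocompact_independent Hr.
  exact: (lattice_basis (stab0 (x i)) (@stabB (x i)) (@stab_fin (x i)) Mv1 Mv2 D).
(* Coordinates on the i-th torus in a basis of its periods, so that the period lattice becomes
   Z^2. *)
pose E i (a : R * R) : S := p (hop e (x i) (psi (comb (m1 i) (m2 i) a.1 a.2))).
have combB i a b a' b' : comb (m1 i) (m2 i) a b - comb (m1 i) (m2 i) a' b' =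
    comb (m1 i) (m2 i) (a - a') (b - b').
  by rewrite /comb; congr (_, _) => /=; ring.
have stabZ i (k l : int) : stab (x i) (comb (m1 i) (m2 i) k%:~R l%:~R).
  have [M1 M2 _ _] := mP i.
  have K1 := subgroup_mulz k (stab0 (x i)) (@stabB (x i)) M1.
  have K2 := subgroup_mulz (- l) (stab0 (x i)) (@stabB (x i)) M2.
  have := stabB K1 K2; congr (stab _ _).
  by rewrite !pair_mulz /comb mulrNz; congr (_, _) => /=; ring.
have Eper i (a b : R * R) : cir a.1 = cir b.1 -> cir a.2 = cir b.2 -> E i a = E i b.
  move=> /esym/cir_eq[k Hk] /esym/cir_eq[l Hl]; apply/component_eq.
  by rewrite combB Hk Hl.
have Einj i j (a b : R * R) : E i a = E j b -> [/\ i = j, cir a.1 = cir b.1 & cir a.2 = cir b.2].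
  move=> Eab; have [u Lu Hu] := (covering_fiber covp _ _).1 Eab.
  have ji : j = i.
    apply: uniq; exists u => //.
    by rewrite -[LHS](defect_psi _ (comb (m1 j) (m2 j) b.1 b.2)) Hu defect_hop defect_psi.
  subst j; have [_ _ D Hbasis] := mP i.
  have /Hbasis[k [l]] := (component_eq (x i) _ _).1 Eab.
  rewrite combB => /(comb_inj D)[Hk Hl]; split=> //; apply/esym.
    by apply: (@cir_int _ _ _ k); rewrite -Hk addrC subrK.
  by apply: (@cir_int _ _ _ l); rewrite -Hl addrC subrK.
have Efix i a : sigma (E i a) = E i a.
  by apply/fixed_defect; rewrite defect_psi; exact: Xx.
have coordE i w : w = comb (m1 i) (m2 i) (det2 w (m2 i) / det2 (m1 i) (m2 i))
    (det2 (m1 i) w / det2 (m1 i) (m2 i)).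
  by have [_ _ D _] := mP i; exact: comb_det.
have Esurj s : sigma s = s -> exists i a, E i a = s.
  have [z <-] := covering_surj covp s => /fixed_defect Lz.
  have [i [h Lh Hz]] := cover z Lz; exists i.
  rewrite -defect_hop in Hz; have zE := defect_eq Hz.
  set w := chi _ in zE; exists (det2 w (m2 i) / det2 (m1 i) (m2 i), det2 (m1 i) w / det2 (m1 i) (m2 i)).
  rewrite /E /= -coordE.
  by rewrite [in RHS]zE -hopA (covering_hop covp _ Lh).
have cE i : continuous (E i).
  move=> a; apply: (@continuous_comp _ _ _
      (fun a : R * R => hop e (x i) (psi (comb (m1 i) (m2 i) a.1 a.2))) p);
    last exact: covering_continuous covp _.
  apply: cvg_hop; first exact: cvg_cst.
  apply: (@continuous_comp _ _ _ (fun a : R * R => comb (m1 i) (m2 i) a.1 a.2) psi); last exact: cpsi.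
  have A1 := @cvg_fst _ _ (nbhs a.1) (nbhs a.2) _; have A2 := @cvg_snd _ _ (nbhs a.1) (nbhs a.2) _.
  have B1 (c d : R) : (b.1 * c + b.2 * d) @[b --> a] --> a.1 * c + a.2 * d.
    by apply: cvgD; apply: cvgM; [exact: A1|exact: cvg_cst|exact: A2|exact: cvg_cst].
  exact: (cvg_pair (B1 (m1 i).1 (m2 i).1) (B1 (m1 i).2 (m2 i).2)).
(* An arbitrary choice of angles, not continuous. Since [E] depends on angles only through the
   circle, it may be replaced near each point by a continuous local section. *)
have /choice[arg argK] := @cir_surj R.
pose fv (a : {i : 'I_t & torus R}) : S := E (projT1 a) (arg (projT2 a).1, arg (projT2 a).2).
have fvE i c : fv (existT _ i c) = E i (arg c.1, arg c.2) by [].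
have fvP a : fv a \in [set s | sigma s = s] by case: a => i c; apply/mem_set; exact: Efix.
pose f a : [set s | sigma s = s] := @exist S (fun s => s \in [set s | sigma s = s]) (fv a) (fvP a).
have finj : injective f.
  move=> [i [c1 c2]] [j [d1 d2]] /(congr1 (@set_val _ _)); rewrite !set_valE /= => /Einj[/= ij e1 e2].
  by move: e1 e2; rewrite !argK => -> ->; rewrite ij.
have fG i (a : R * R) : fv (existT _ i (cir a.1, cir a.2)) = E i a.
  by rewrite fvE; apply: Eper; rewrite /= argK.
have fsurj (s : [set s | sigma s = s]) : exists a, f a = s.
  have [i [a Ea]] := Esurj (set_val s) (set_mem (valP s)).
  by exists (existT _ i (cir a.1, cir a.2)); apply: val_inj; rewrite /= fG Ea.
have /choice[g fgK] := fsurj.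
exists g, f; split=> //; last first.
- by move=> a; apply: finj; rewrite fgK.
- apply: continuous_comp_initial.
  apply: (@sigT_continuous _ _ S (fun i (c : torus R) => E i (arg c.1, arg c.2))) => i [c1 c2].
  have [g1 [g1E cg1 near1]] := cir_local_section (arg c1).
  have [g2 [g2E cg2 near2]] := cir_local_section (arg c2).
  rewrite argK in cg1 near1 g1E; rewrite argK in cg2 near2 g2E.
  have H : {for (c1, c2), continuous (fun c : torus R => E i (g1 c.1, g2 c.2))}.
    apply: (@continuous_comp _ _ _ (fun c : torus R => (g1 c.1, g2 c.2)) (E i)); last exact: cE.
    have H1 : {for (c1, c2), continuous (fun c : torus R => g1 c.1)}.
      by apply: (@continuous_comp _ _ _ fst g1); [exact: cvg_fst | exact: cg1].
    have H2 : {for (c1, c2), continuous (fun c : torus R => g2 c.2)}.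
      by apply: (@continuous_comp _ _ _ snd g2); [exact: cvg_snd | exact: cg2].
    exact: (cvg_pair H1 H2).
  rewrite /prop_for /continuous_at /= g1E g2E in H.
  apply: cvg_trans H; apply: near_eq_cvg.
  have F1 : (fun c : torus R => c.1) @ ((c1, c2) : torus R) --> c1 by exact: cvg_fst.
  have F2 : (fun c : torus R => c.2) @ ((c1, c2) : torus R) --> c2 by exact: cvg_snd.
  have N1 : \forall c \near ((c1, c2) : torus R), cir (g1 c.1) = c.1 by exact: (F1 _ near1).
  have N2 : \forall c \near ((c1, c2) : torus R), cir (g2 c.2) = c.2 by exact: (F2 _ near2).
  by apply: filterS2 N1 N2 => c h1 h2; apply: Eper; rewrite /= ?h1 ?h2 argK.
(* For the inverse map a fixed point is lifted to N, where coordinates are continuous, and openness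
   of [p] carries neighbourhoods down to [S]. *)
move=> s0 A nA; case gs0 : (g s0) nA => [i [c1 c2]] nA.
pose D := det2 (m1 i) (m2 i).
pose z0 := hop e (x i) (psi (comb (m1 i) (m2 i) (arg c1) (arg c2))).
pose W z := chi (hop e (hinv e (x i)) z).
pose a z : R * R := (det2 (W z) (m2 i) / D, det2 (m1 i) (W z) / D).
pose G z : {i : 'I_t & torus R} := existT _ i (cir (a z).1, cir (a z).2).
have pz0 : p z0 = set_val s0.
  by rewrite -(fgK s0) gs0 set_valE.
have Wz0 : W z0 = comb (m1 i) (m2 i) (arg c1) (arg c2) by rewrite /W /z0 !hop_simp psiK.
have az0 : a z0 = (arg c1, arg c2).
  have [_ _ Dn _] := mP i.
  have := coordE i (W z0); rewrite {1}Wz0 => /(comb_inj Dn)[h1 h2].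
  by rewrite /a -/D -h1 -h2.
have Gz0 : G z0 = existT _ i (c1, c2) by rewrite /G az0 /= !argK.
have cW : continuous W.
  move=> z; apply: (@continuous_comp _ _ _ (hop e (hinv e (x i))) chi); last exact: cchi.
  exact: hop_continuous.
have cG : continuous G.
  move=> z; apply: (@continuous_comp _ _ _ (fun z => (cir (a z).1, cir (a z).2) : torus R) (existT _ i)); last first.
    exact: existT_continuous.
  have A1 : (W y).1 @[y --> z] --> (W z).1.
    by apply: (@continuous_comp _ _ _ W fst); [exact: cW | exact: cvg_fst].
  have A2 : (W y).2 @[y --> z] --> (W z).2.
    by apply: (@continuous_comp _ _ _ W snd); [exact: cW | exact: cvg_snd].
  have B1 : (a y).1 @[y --> z] --> (a z).1.
    by apply: cvgM; [apply: cvgB; apply: cvgM;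
      [exact: A1|exact: cvg_cst|exact: A2|exact: cvg_cst] | exact: cvg_cst].
  have B2 : (a y).2 @[y --> z] --> (a z).2.
    by apply: cvgM; [apply: cvgB; apply: cvgM;
      [exact: cvg_cst|exact: A2|exact: cvg_cst|exact: A1] | exact: cvg_cst].
  have D1 : cir (a y).1 @[y --> z] --> cir (a z).1.
    by apply: (@continuous_comp _ _ _ (fun z => (a z).1) (@cir R)); [exact: B1 | exact: cir_continuous].
  have D2 : cir (a y).2 @[y --> z] --> cir (a z).2.
    by apply: (@continuous_comp _ _ _ (fun z => (a z).2) (@cir R)); [exact: B2 | exact: cir_continuous].
  exact: (cvg_pair D1 D2).
have nGA : nbhs z0 (G @^-1` A) by apply: cG; rewrite Gz0.
(* Since [L] is discrete, fixed points with lifts near [z0] have the same defect and so lie on the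
   same torus; this separates the components. *)
have nU : \forall z \near z0, L (defect z) -> defect z = defect z0.
  exact: (@defect_continuous z0 _ (discrete_near (defect z0))).
have : nbhs z0 (G @^-1` A `&` [set z | L (defect z) -> defect z = defect z0]).
  by apply: filterI; [exact: nGA | exact: nU].
rewrite nbhsE => -[V [oV Vz0] VGU].
have nO : nbhs (set_val s0) (p @` V).
  by apply: open_nbhs_nbhs; split; [exact: covering_open covp _ oV | rewrite -pz0; exists z0].
have : nbhs s0 (set_val @^-1` (p @` V)) by exact: (@initial_continuous _ _ set_val s0 _ nO).
apply: filterS => s [z Vz pzs]; have [GA dz] := VGU z Vz.
have Lz : L (defect z) by apply/fixed_defect; rewrite pzs; exact: (set_mem (valP s)).
have zE : z = hop e (x i) (psi (W z)) by apply: defect_eq; rewrite (dz Lz) defect_psi.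
suff gsG : g s = G z by rewrite /= gsG; exact: GA.
apply: finj; rewrite fgK; apply: val_inj; rewrite /= fG /E /a -/D -coordE -zE.
by rewrite pzs.
Qed.

End Components.

(** * Involutions of tori and of nilmanifolds *)

Section TorusInvolution.
Variable R : realType.
Notation C := (cplx R).
Notation N := (C * C)%type.
Notation ci := (mkc 0 1 : C).

Lemma ci_sqr : ci * ci = -1.
Proof. by apply: ceq; rewrite ?reM ?imM /re /im /=; ring. Qed.
Lemma ci_conj : ci^* = - ci.
Proof. by apply: ceq; rewrite ?reJ ?imJ ?reN ?imN /re /im /=; ring. Qed.

Lemma int_parity (k : int) : exists (b : bool) (n : int), k = b%:Z + n * 2.
Proof.
have := divz_eq k 2; have := modz_ge0 k (isT : (2 : int) != 0); have := ltz_pmod k (isT : 0 < (2 : int)).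
set r := (k %% 2)%Z; set n := (k %/ 2)%Z => r2 r0 ->.
have [r0'|r1] : r = 0 \/ r = 1 by move: r0 r2; case: r => [[|[|m]]|m] //; auto.
  by exists false, n; rewrite r0' addrC.
by exists true, n; rewrite r1 addrC.
Qed.

Lemma conj_real (s : C) : s^* = s -> s = rc (re s).
Proof.
move=> h; apply: ceq => //; rewrite im_rc.
by have := congr1 (@im R) h; rewrite imJ; lra.
Qed.

Lemma conj_imag (s : C) : s^* = - s -> s = ci * rc (im s).
Proof.
move=> h; apply: ceq; rewrite ?reM ?imM ?re_rc ?im_rc /re /im /= -/(re _) -/(im _).
  by have := congr1 (@re R) h; rewrite reJ reN; lra.
by ring.
Qed.

Lemma conj_ratio (k x y : C) : x = k * x^* -> y = k * y^* -> y != 0 -> (x / y)^* = x / y.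
Proof.
move=> Ex Ey y0; have k0 : k != 0 by apply: contra y0 => /eqP k0; rewrite Ey k0 mul0r.
by rewrite rmorphM fmorphV [in RHS]Ex [in RHS]Ey /= -mulf_div divff // mul1r.
Qed.

Section TorusCase.
Variables (a b c d : C).
Definition antilin (z : N) : N := (a * z.1^* + b * z.2^*, c * z.1^* + d * z.2^*).
Definition sc2 (k : C) (z : N) : N := (k * z.1, k * z.2).
Definition cdet (u v : N) : C := u.1 * v.2 - u.2 * v.1.

Lemma antilinD z w : antilin (z + w) = antilin z + antilin w.
Proof. by rewrite /antilin /= !rmorphD; congr (_, _) => /=; ring. Qed.
Lemma antilinZ k z : antilin (sc2 k z) = sc2 k^* (antilin z).
Proof. by rewrite /antilin /sc2 /= !rmorphM; congr (_, _) => /=; ring. Qed.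

Lemma antilin_continuous : continuous antilin.
Proof.
move=> z.
have c1 : (z.1^* @[z --> z]) --> z.1^* by apply: cvg_conj; exact: (@cvg_comp1 _ _ (nbhs z) _ id z cvg_id).
have c2 : (z.2^* @[z --> z]) --> z.2^* by apply: cvg_conj; exact: (@cvg_comp2 _ _ (nbhs z) _ id z cvg_id).
have H (k l : C) : (k * w.1^* + l * w.2^*) @[w --> z] --> k * z.1^* + l * z.2^*.
  exact: (cvgD (cvgM (cvg_cst k) c1) (cvgM (cvg_cst l) c2)).
by apply: cvg_pairN; [exact: (H a b) | exact: (H c d)].
Qed.

Hypothesis antilinK : involutive antilin.

(** Every vector is a complex combination of fixed ones: 2 z = (z + F z) - i (i (z - F z)). If any
    two fixed vectors were dependent, so would be the standard basis. *)
Lemma real_basis : exists v1 v2, [/\ antilin v1 = v1, antilin v2 = v2 & cdet v1 v2 != 0].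
Proof.
apply: contrapT => h.
have dep u v : antilin u = u -> antilin v = v -> cdet u v = 0.
  by move=> Fu Fv; apply: contrapT => D; apply: h; exists u, v; split=> //; exact/eqP.
pose A z : N := z + antilin z; pose B z : N := sc2 ci (z - antilin z).
have antilinN z : antilin (- z) = - antilin z.
  have -> : - z = sc2 (-1) z by case: z => ? ?; rewrite /sc2 /= !mulN1r.
  by rewrite antilinZ rmorphN rmorph1; case: (antilin z) => ? ?; rewrite /sc2 /= !mulN1r.
have FA z : antilin (A z) = A z by rewrite /A antilinD antilinK addrC.
have FB z : antilin (B z) = B z.
  rewrite /B antilinZ antilinD antilinN antilinK ci_conj /sc2 /=; congr (_, _); ring.
have split z : sc2 2 z = A z - sc2 ci (B z).
  have E (x x' : C) : 2 * x = x + x' - ci * (ci * (x - x')).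
    by rewrite [ci * (ci * _)]mulrA ci_sqr; ring.
  rewrite [LHS]surjective_pairing [RHS]surjective_pairing; congr (_, _).
    exact: (E z.1 (antilin z).1).
  exact: (E z.2 (antilin z).2).
have : cdet (sc2 2 (1, 0)) (sc2 2 (0, 1)) = 0.
  rewrite !split; set p1 := A _; set p2 := B _; set q1 := A _; set q2 := B _.
  have D1 : cdet p1 q1 = 0 by apply: dep; exact: FA.
  have D2 : cdet p1 q2 = 0 by apply: dep; [exact: FA | exact: FB].
  have D3 : cdet p2 q1 = 0 by apply: dep; [exact: FB | exact: FA].
  have D4 : cdet p2 q2 = 0 by apply: dep; exact: FB.
  have -> : cdet (p1 - sc2 ci p2) (q1 - sc2 ci q2) =
    cdet p1 q1 - ci * cdet p1 q2 - ci * cdet p2 q1 + ci * ci * cdet p2 q2.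
    by rewrite /cdet /sc2 /=; ring.
  by rewrite D1 D2 D3 D4; ring.
rewrite /cdet /sc2 /= => /eqP; rewrite !mulr1 !mulr0 ?mul0r subr0 mulf_eq0 orbb.
by rewrite pnatr_eq0.
Qed.

Variables (L : set N) (S : topologicalType) (p : N -> S) (sigma : S -> S).
Hypotheses (latL : lattice 0 L) (covp : covering 0 L p).
Hypotheses (pF : forall z, p (antilin z) = sigma (p z)) (FL : forall u, L u -> L (antilin u)).

(** Cocycles are the elements of L in i V. An h among them satisfies F h = - h, so twisting by h
    adds 2 h; the classes are thus at most those of a group on two generators modulo 2. *)
Lemma torus_case : (exists s, sigma s = s) ->
  exists t : nat, (1 <= t <= 4)%N /\
    homeomorphic [set s | sigma s = s] {i : 'I_t & torus R}.
Proof.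
move=> fixs; have [v1 [v2 [Fv1 Fv2 D]]] := real_basis.
have hop0E u z : hop (0 : C) u z = u + z :> N by rewrite /hop !mul0r addr0.
have hinv0E u : hinv (0 : C) u = - u :> N by rewrite /hinv !mul0r addr0.
pose psi (y : R * R) : N := sc2 (rc y.1) v1 + sc2 (rc y.2) v2.
pose chi (z : N) : R * R := (re (cdet z v2 / cdet v1 v2), re (cdet v1 z / cdet v1 v2)).
have cpsi : continuous psi.
  move=> y.
  have c1 : (rc y.1 @[y --> y]) --> rc y.1.
    by apply: (@continuous_comp _ _ _ fst (@rc R)); [exact: cvg_fst | exact: rc_continuous].
  have c2 : (rc y.2 @[y --> y]) --> rc y.2.
    by apply: (@continuous_comp _ _ _ snd (@rc R)); [exact: cvg_snd | exact: rc_continuous].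
  have H (k l : C) : (rc x.1 * k + rc x.2 * l) @[x --> y] --> rc y.1 * k + rc y.2 * l.
    exact: (cvgD (cvgM c1 (cvg_cst k)) (cvgM c2 (cvg_cst l))).
  by apply: cvg_pairN; [exact: (H v1.1 v2.1) | exact: (H v1.2 v2.2)].
have cchi : continuous chi.
  move=> z.
  have c1 : (z.1 @[z --> z]) --> z.1 by exact: (@cvg_comp1 _ _ (nbhs z) _ id z cvg_id).
  have c2 : (z.2 @[z --> z]) --> z.2 by exact: (@cvg_comp2 _ _ (nbhs z) _ id z cvg_id).
  have d1 : (cdet z v2 / cdet v1 v2) @[z --> z] --> cdet z v2 / cdet v1 v2.
    by apply: cvgM; [apply: cvgB; apply: cvgM;
      [exact: c1|exact: cvg_cst|exact: c2|exact: cvg_cst] | exact: cvg_cst].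
  have d2 : (cdet v1 z / cdet v1 v2) @[z --> z] --> cdet v1 z / cdet v1 v2.
    by apply: cvgM; [apply: cvgB; apply: cvgM;
      [exact: cvg_cst|exact: c2|exact: cvg_cst|exact: c1] | exact: cvg_cst].
  have e1 := cvg_comp _ _ d1 (@re_continuous R _).
  have e2 := cvg_comp _ _ d2 (@re_continuous R _).
  exact: (cvg_pair e1 e2).
have psiK : cancel psi chi.
  move=> [s t]; rewrite /chi /psi.
  have -> : cdet (sc2 (rc s) v1 + sc2 (rc t) v2) v2 = rc s * cdet v1 v2 by rewrite /cdet /sc2 /=; ring.
  have -> : cdet v1 (sc2 (rc s) v1 + sc2 (rc t) v2) = rc t * cdet v1 v2 by rewrite /cdet /sc2 /=; ring.
  by rewrite !mulfK.
have psiD x y : psi (x + y) = hop 0 (psi x) (psi y).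
  by rewrite hop0E /psi /sc2 /= !rcD; congr (_, _) => /=; ring.
have Fpsi y : antilin (psi y) = psi y by rewrite /psi antilinD !antilinZ !rcJ Fv1 Fv2.
have cramer z : z = sc2 (cdet z v2 / cdet v1 v2) v1 + sc2 (cdet v1 z / cdet v1 v2) v2.
  by case: z => x y; rewrite /sc2; congr (_, _); rewrite /cdet /= in D *; field.
(* Determinants of fixed vectors all satisfy x = (a d - b c) conj(x), so their ratios, the
   coordinates of a fixed vector in [v1], [v2], are real. *)
have Fdet u v : antilin u = u -> antilin v = v -> cdet u v = (a * d - b * c) * (cdet u v)^*.
  move=> Fu Fv; rewrite -{1}Fu -{1}Fv /cdet /antilin /= rmorphB !rmorphM; ring.
have FdetV u v : antilin u = u -> antilin v = v -> (cdet u v / cdet v1 v2)^* = cdet u v / cdet v1 v2.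
  move=> Fu Fv; exact: conj_ratio (Fdet _ _ Fu Fv) (Fdet _ _ Fv1 Fv2) D.
have chiK v : antilin v = v -> psi (chi v) = v.
  move=> Fv; rewrite [RHS]cramer /psi /chi /=.
  by rewrite -!conj_real //; exact: FdetV.
have ciK z : sc2 ci (sc2 (- ci) z) = z.
  have H (x : C) : ci * (- ci * x) = x by rewrite mulNr mulrN mulrA ci_sqr mulN1r opprK.
  by case: z => x y; rewrite /sc2 /= !H.
pose D0 : set (R * R) := [set m | L (sc2 ci (psi m))].
have psi0 : psi 0 = 0 by apply: (addrI (psi 0)); rewrite -hop0E -psiD !addr0.
have psiN y : psi (- y) = - psi y.
  by apply: (addrI (psi y)); rewrite -hop0E -psiD !subrr psi0.
have D00 : D0 0.
  rewrite /D0 /= psi0; have := lattice0 latL; congr (L _).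
  by rewrite /sc2 /= mulr0.
have D0B x y : D0 x -> D0 y -> D0 (x - y).
  move=> Dx Dy; have := latticeM latL Dx (latticeV latL Dy); congr (L _).
  rewrite hop0E hinv0E psiD hop0E psiN /sc2 /=; congr (_, _) => /=; ring.
have csc (k : C) : continuous (sc2 k).
  move=> z.
  have c1 : (z.1 @[z --> z]) --> z.1 by exact: (@cvg_comp1 _ _ (nbhs z) _ id z cvg_id).
  have c2 : (z.2 @[z --> z]) --> z.2 by exact: (@cvg_comp2 _ _ (nbhs z) _ id z cvg_id).
  by apply: cvg_pairN; [exact: (cvgM (cvg_cst k) c1) | exact: (cvgM (cvg_cst k) c2)].
have D0fin (r : R) : finite_set [set m | [/\ D0 m, `|m.1| <= r & `|m.2| <= r]].
  have cf : continuous (fun m => sc2 ci (psi m)).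
    by move=> m; apply: (@continuous_comp _ _ _ psi (sc2 ci)); [exact: cpsi | exact: csc].
  have [B HB] := continuous_bounded_ball (@rbox_compact R r) cf.
  have := finite_image (fun u => chi (sc2 (- ci) u)) (lattice_fin latL B).
  apply: sub_finite_set => m [Dm h1 h2]; exists (sc2 ci (psi m)).
    by split; [exact: Dm | apply: HB; split; rewrite /= in_itv /= -ler_norml].
  have -> : sc2 (- ci) (sc2 ci (psi m)) = psi m; last exact: psiK.
  by rewrite -[RHS]ciK /sc2 /=; congr (_, _); ring.
have [m1 [m2 [Dm1 Dm2 Hm]]] := two_generators D00 D0B D0fin.
have cocyE u : hop 0 u (antilin u) = 0 -> antilin u = - u.
  by rewrite hop0E => h; apply: (addrI u); rewrite h subrr.
have imagE u : antilin u = - u -> u = sc2 ci (psi (chi (sc2 (- ci) u))).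
  move=> Fu; rewrite chiK ?ciK // antilinZ rmorphN /= ci_conj Fu /sc2 /=.
  by congr (_, _); ring.
pose P (u : N) (i : bool * bool) := exists k l : int,
  chi (sc2 (- ci) u) = comb m1 m2 ((i.1%:Z + k * 2)%:~R) ((i.2%:Z + l * 2)%:~R).
have P1 u : L u -> hop 0 u (antilin u) = 0 -> exists i, P u i.
  move=> Lu /cocyE /imagE uE.
  have [k [l E]] : exists k l : int, chi (sc2 (- ci) u) = comb m1 m2 k%:~R l%:~R.
    by apply: Hm; rewrite /D0 /= -uE.
  have [b1 [k' kE]] := int_parity k; have [b2 [l' lE]] := int_parity l.
  by exists (b1, b2), k', l'; rewrite E kE lE.
have P2 u v i : L u -> L v -> hop 0 u (antilin u) = 0 -> hop 0 v (antilin v) = 0 ->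
    P u i -> P v i -> exists2 h, L h & u = hop 0 (hop 0 h v) (hinv 0 (antilin h)).
  move=> Lu Lv /cocyE /imagE uE /cocyE /imagE vE [k [l Eu]] [k' [l' Ev]].
  (* Half of the difference of the two cocycles, which is a lattice vector because the parities
     agree. *)
  pose m := comb m1 m2 (k - k')%:~R (l - l')%:~R.
  have Dm : D0 m.
    have K1 := subgroup_mulz (k - k') D00 D0B Dm1.
    have K2 := subgroup_mulz (- (l - l')) D00 D0B Dm2.
    have := D0B _ _ K1 K2; congr (D0 _).
    by rewrite !pair_mulz /m /comb mulrNz; congr (_, _) => /=; ring.
  exists (sc2 ci (psi m)); first exact: Dm.
  rewrite !hop0E hinv0E antilinZ Fpsi ci_conj uE vE Eu Ev.
  have -> : comb m1 m2 (i.1%:Z + k * 2)%:~R (i.2%:Z + l * 2)%:~R =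
     comb m1 m2 (i.1%:Z + k' * 2)%:~R (i.2%:Z + l' * 2)%:~R + (m + m).
    by rewrite /m /comb !intrD !intrM !mulrNz; congr (_, _) => /=; ring.
  by rewrite !psiD !hop0E /sc2 /=; congr (_, _) => /=; ring.
have := fixed_locus_tori latL covp pF _ antilinK antilin_continuous FL cpsi cchi psiK psiD Fpsi chiK P1 P2 fixs.
rewrite card_prod card_bool; apply.
by move=> u z; rewrite !hop0E antilinD.
Qed.

End TorusCase.
End TorusInvolution.

Section ConjugationRules.
Variable R : realType.
Implicit Types x y : cplx R.
Lemma cjM x y : (x * y)^* = x^* * y^*. Proof. exact: rmorphM. Qed.
Lemma cjD x y : (x + y)^* = x^* + y^*. Proof. exact: rmorphD. Qed.
Lemma cjN x : (- x)^* = - x^*. Proof. exact: rmorphN. Qed.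
Lemma cjV x : (x^-1)^* = (x^*)^-1. Proof. exact: fmorphV. Qed.
Lemma cj0 : 0^* = 0 :> cplx R. Proof. exact: rmorph0. Qed.
Lemma cj1 : 1^* = 1 :> cplx R. Proof. exact: rmorph1. Qed.
Lemma cj_nat n : (n%:R)^* = n%:R :> cplx R. Proof. exact: rmorph_nat. Qed.
End ConjugationRules.

Section TwistedConjugacy.
Variable R : realType.
Notation C := (cplx R).
Notation N := (C * C)%type.
Variables (e : C) (L : set N) (F : N -> N).
Hypotheses (latL : lattice e L) (FM : forall u z, F (hop e u z) = hop e (F u) (F z)).

Definition twisted_conj (u v : N) :=
  exists2 h, L h & u = hop e (hop e h v) (hinv e (F h)).

Lemma twisted_conj_sym u v : twisted_conj u v -> twisted_conj v u.
Proof.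
move=> [h Lh ->]; exists (hinv e h); first exact: latticeV latL _ Lh.
by rewrite (F_inv FM) hinvK -!hopA !hop_simp.
Qed.

Lemma twisted_conj_trans u v w : twisted_conj u v -> twisted_conj v w -> twisted_conj u w.
Proof.
move=> [h Lh ->] [k Lk ->]; exists (hop e h k); first exact: latticeM latL _ _ Lh Lk.
by rewrite FM hinvM -!hopA.
Qed.

Lemma twisted_conj_cocycle u v : involutive F -> hop e v (F v) = 0 -> twisted_conj u v ->
  hop e u (F u) = 0.
Proof.
move=> FK cv [h Lh ->]; rewrite !FM (F_inv FM) FK -!hopA !hop_simp.
by rewrite (hopA _ v) cv hop0z hopV.
Qed.

End TwistedConjugacy.

Section KodairaCase.
Variable R : realType.
Notation C := (cplx R).
Notation N := (C * C)%type.
Notation ci := (mkc 0 1 : C).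
Variables (a d : C).
Definition kod (z : N) : N := (a * z.1^*, a * a^* * z.2^* + d * z.1^*).
Hypothesis kodK : involutive kod.

Lemma kod_unit : a * a^* = 1.
Proof.
have := congr1 fst (kodK (1, 0)); rewrite /kod /= cj1 mulr1.
by [].
Qed.

Lemma kod_shear : d^* = - (d * a^*).
Proof.
have := congr1 snd (kodK (1, 0)); rewrite /kod /= kod_unit cj1 cj0 !mulr1 mulr0 add0r mul1r.
by move=> /eqP; rewrite addr_eq0 => /eqP.
Qed.

Lemma kod_hop u z : kod (hop 1 u z) = hop 1 (kod u) (kod z).
Proof.
rewrite /kod /hop /= kod_unit !cjD !cjM /= !conjCK cj1.
have E : a^* * u.1 * (a * z.1^*) = u.1 * z.1^*.
  by rewrite -[RHS]mul1r -kod_unit; ring.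
by congr (_, _); rewrite ?mul1r ?E; ring.
Qed.

(** Hilbert 90 for complex conjugation: 1 + a is a solution as |a| = 1, unless it vanishes, and then
    i is one. The base coordinates of V are the real multiples of [b]. *)
Lemma conj_frame : exists2 b : C, b != 0 & b = a * b^*.
Proof.
have [a1|a1] := eqVneq (1 + a) 0.
  exists ci.
    by apply/eqP => /(congr1 (@im R)); rewrite /im /= => /eqP; rewrite oner_eq0.
  have -> : a = -1 by rewrite -(addKr 1 a) a1 addr0.
  by rewrite ci_conj; ring.
by exists (1 + a) => //; rewrite cjD cj1 mulrDr kod_unit mulr1 addrC.
Qed.

Lemma kod_continuous : continuous kod.
Proof.
move=> z.
have c1 : (z.1^* @[z --> z]) --> z.1^* by apply: cvg_conj; exact: (@cvg_comp1 _ _ (nbhs z) _ id z cvg_id).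
have c2 : (z.2^* @[z --> z]) --> z.2^* by apply: cvg_conj; exact: (@cvg_comp2 _ _ (nbhs z) _ id z cvg_id).
apply: cvg_pairN; first exact: (cvgM (cvg_cst a) c1).
exact: (cvgD (cvgM (cvg_cst (a * a^*)) c2) (cvgM (cvg_cst d) c1)).
Qed.

Variables (L : set N) (S : topologicalType) (p : N -> S) (sigma : S -> S).
Hypotheses (latL : lattice 1 L) (covp : covering 1 L p).
Hypotheses (pF : forall z, p (kod z) = sigma (p z)) (FL : forall u, L u -> L (kod u)).

(** The base coordinate of a cocycle lies on the real line of i b, and twisting shifts it by twice a
    lattice value: this is the first parity. Two cocycles with equal base coordinate differ by a
    purely imaginary fibre element, again defined up to twice such elements: this is the second. *)
Lemma kodaira_classes : exists P : N -> bool * bool -> Prop,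
  (forall u, L u -> hop 1 u (kod u) = 0 -> exists c, P u c) /\
  (forall u v c, L u -> L v -> hop 1 u (kod u) = 0 -> hop 1 v (kod v) = 0 ->
     P u c -> P v c -> exists2 h, L h & u = hop 1 (hop 1 h v) (hinv 1 (kod h))).
Proof.
have [b b0 bE] := conj_frame; pose g := ci * b.
have ci0 : ci != 0.
  by apply/eqP => /(congr1 (@im R)); rewrite /im /= => /eqP; rewrite oner_eq0.
have g0 : g != 0 by rewrite mulf_neq0.
have ag : a * g^* = - g.
  by rewrite /g cjM ci_conj /g [in RHS]bE; ring.
have agr (x : R) : a * (rc x * g)^* = - (rc x * g).
  by rewrite cjM rcJ mulrCA ag mulrN.
(* [D1] asks only for some lattice element over [rc x * g], cocycle or not, since a twist may use
   any such element. *)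
pose D1 : set R := [set x | exists y, L (rc x * g, y)].
pose D2 : set R := [set x | L (0, ci * rc x)].
have D1_0 : D1 0 by exists 0; rewrite rc0 mul0r; exact: lattice0 latL.
have D1B x y : D1 x -> D1 y -> D1 (x - y).
  move=> [x' Lx] [y' Ly]; exists (hop 1 (rc x * g, x') (hinv 1 (rc y * g, y'))).2.
  have := latticeB latL Lx Ly; congr (L _); rewrite [LHS]surjective_pairing; congr (_, _).
  by rewrite /= rcB; ring.
have D1fin (r : R) : finite_set [set x | D1 x /\ `|x| <= r].
  have := finite_image (fun z => re (z / g)) (base_locally_finite latL (r * nrm g)).
  apply: sub_finite_set => x [[y Lx] xr]; exists (rc x * g); last by rewrite mulfK.
  split; first by exists y.
  by rewrite nrmM nrm_rc ler_wpM2r ?nrm_ge0.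
have [x0 Dx0 Hx0] := discrete_subgroup_cyclic D1_0 D1B D1fin.
have D2_0 : D2 0 by rewrite /D2 /= rc0 mulr0; exact: lattice0 latL.
have D2B x y : D2 x -> D2 y -> D2 (x - y).
  move=> Lx Ly; have := latticeB latL Lx Ly; congr (L _).
  by rewrite /hop /hinv /= rcB cj0; congr (_, _); ring.
have nci : nrm ci = 1 by rewrite /nrm /= expr0n expr1n add0r sqrtr1.
have D2fin (r : R) : finite_set [set x | D2 x /\ `|x| <= r].
  have := finite_image (fun z : N => im z.2) (lattice_fin latL r).
  apply: sub_finite_set => x [Lx xr]; exists (0, ci * rc x).
    have E : nrm2 (0, ci * rc x) = nrm (ci * rc x) by rewrite /nrm2 nrm0 add0r.
    by split; [exact: Lx | rewrite E nrmM nci mul1r nrm_rc].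
  by change (im (ci * rc x) = x); rewrite imM im_rc re_rc /re /im /=; ring.
have [y0 Dy0 Hy0] := discrete_subgroup_cyclic D2_0 D2B D2fin.
have /choice[yy Hyy] : forall k : int, exists y, L (rc (x0 *~ k) * g, y).
  by move=> k; exact: (subgroup_mulz k D1_0 D1B Dx0).
have rcz (r : R) (k : int) : rc (r *~ k) = k%:~R * rc r by rewrite -mulrzl rcM rc_int.
pose cocycle u := L u /\ hop 1 u (kod u) = 0.
have cocycle1 u : hop 1 u (kod u) = 0 -> u.1 = rc (re (u.1 / g)) * g.
  move=> /(congr1 fst) /= /eqP; rewrite addr_eq0 => /eqP E.
  rewrite -conj_real ?divfK //; apply: (@conj_ratio R (- a)) => //.
    by rewrite mulNr -E.
  by rewrite mulNr ag opprK.
have cocycle2 u : hop 1 u (kod u) = 0 -> u.2 + u.2^* + d * u.1^* + a * u.1^* * u.1^* = 0.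
  by move=> /(congr1 snd); rewrite /= kod_unit !mul1r => <-; ring.
have normal u : cocycle u -> exists (i : bool) v,
    [/\ cocycle v, twisted_conj 1 L kod u v & v.1 = rc (x0 *~ i%:Z) * g].
  move=> [Lu cu]; have u1 := cocycle1 u cu; set x := re _ in u1.
  have [k xk] : exists k : int, x = x0 *~ k.
    by apply: Hx0; exists u.2; rewrite -u1 -surjective_pairing.
  have [i [n kE]] := int_parity k.
  pose h := hinv 1 (rc (x0 *~ n) * g, yy n).
  have Lh : L h by exact: latticeV latL _ (Hyy n).
  pose v := hop 1 (hop 1 h u) (hinv 1 (kod h)).
  have tvu : twisted_conj 1 L kod v u by exists h.
  exists i, v; split.
  - split; last exact: twisted_conj_cocycle kod_hop _ _ kodK cu tvu.
    by apply: (latticeM latL); [exact: latticeM latL _ _ Lh Lu | apply: (latticeV latL); exact: FL].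
  - exact: twisted_conj_sym latL kod_hop _ _ tvu.
  - rewrite /v /h /= u1 cjN mulrN opprK agr xk kE.
    by rewrite !rcz intrD intrM; ring.
(* There is no canonical zero for the second parity: the fibre coordinate is measured from a
   reference cocycle [w i] fixed for each first parity; the default 0 occurs only when no cocycle
   has that parity. *)
have /choice[w Hw] : forall i : bool, exists w,
    (exists v, cocycle v /\ v.1 = rc (x0 *~ i%:Z) * g) -> cocycle w /\ w.1 = rc (x0 *~ i%:Z) * g.
  move=> i; have [[v Hv]|h] := pselect (exists v, cocycle v /\ v.1 = rc (x0 *~ i%:Z) * g).
    by exists v.
  by exists 0.
exists (fun u (c : bool * bool) => exists v, [/\ cocycle v, twisted_conj 1 L kod u v,
  v.1 = rc (x0 *~ c.1%:Z) * g &
  exists n : int, v.2 = (w c.1).2 + ci * rc (y0 *~ (c.2%:Z + n * 2))]); split.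
- move=> u Lu cu; have [i [v [[Lv cv] uv v1]]] := normal u (conj Lu cu).
  have [[Lw cw] w1] := Hw i (ex_intro _ v (conj (conj Lv cv) v1)).
  have Ll : L (0, v.2 - (w i).2).
    apply: (fiber_diff_mem latL (a := v.1)); first by rewrite -surjective_pairing.
    by rewrite v1 -w1 -surjective_pairing.
  have lJ : (v.2 - (w i).2)^* = - (v.2 - (w i).2).
    have := cocycle2 _ cv; have := cocycle2 _ cw; rewrite v1 -w1 => E1 E2.
    apply/eqP; rewrite -addr_eq0; apply/eqP; rewrite cjD cjN -[RHS](subrr 0) -{1}E2 -E1; ring.
  have lE := conj_imag lJ.
  have [k lk] : exists k : int, im (v.2 - (w i).2) = y0 *~ k by apply: Hy0; rewrite /D2 /= -lE.
  have [j [n kE]] := int_parity k.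
  exists (i, j), v; split=> //; exists n; rewrite /= -kE -lk -lE addrC subrK //.
- move=> u u' c Lu Lu' cu cu' [v [[Lv cv] uv v1 [n vn]]] [v' [[Lv' cv'] uv' v1' [n' vn']]].
  suff vv' : twisted_conj 1 L kod v v'.
    apply: twisted_conj_trans latL kod_hop _ _ _ uv _.
    apply: twisted_conj_trans latL kod_hop _ _ _ vv' _.
    exact: twisted_conj_sym latL kod_hop _ _ uv'.
  exists (0, ci * rc (y0 *~ (n - n'))); first exact: (subgroup_mulz (n - n') D2_0 D2B Dy0).
  rewrite [LHS]surjective_pairing v1 vn [v']surjective_pairing v1' vn'.
  rewrite /kod /hop /hinv /= kod_unit !cjD !cjM /= rcJ ci_conj !cj0 ?cj1.
  by congr (_, _); rewrite ?(rcz, intrD, intrM, mulrNz); ring.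
Qed.

Lemma kodaira_case : (exists s, sigma s = s) ->
  exists t : nat, (1 <= t <= 4)%N /\
    homeomorphic [set s | sigma s = s] {i : 'I_t & torus R}.
Proof.
move=> fixs; have [b b0 bE] := conj_frame.
pose n := re (b^* * b); pose K := d * b^*.
have nE : b^* * b = rc n.
  by apply: conj_real; rewrite cjM /= conjCK mulrC.
have bJ : a^* * b = b^* by rewrite {1}bE mulrA [a^* * a]mulrC kod_unit mul1r.
have KJ : K^* = - K by rewrite /K cjM conjCK kod_shear mulNr -mulrA bJ.
have KE : K = d * b^* by [].
clearbody K; have rc_half (x : R) : rc (x / 2) = rc x / 2 by rewrite rcM rcV rc_nat.
(* A fixed point has base coordinate y1 b, and its fibre coordinate has imaginary part fixed by y1
   through [K / 2]. The real part is shifted by n y1^2 / 2, with n = |b|^2, to absorb the cocycle n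
   x1 y1 of the group law, making [psi] a homomorphism. *)
pose psi (y : R * R) : N := (rc y.1 * b, rc (y.2 + n * (y.1 * y.1) / 2) + rc y.1 * (K / 2)).
pose chi (z : N) : R * R := (re (z.1 / b), re z.2 - n * (re (z.1 / b) * re (z.1 / b)) / 2).
have cpsi : continuous psi.
  move=> y.
  have p1 : (x.1 @[x --> y]) --> y.1 by exact: cvg_fst.
  have p2 : (x.2 @[x --> y]) --> y.2 by exact: cvg_snd.
  have c1 : (rc x.1 @[x --> y]) --> rc y.1 by exact: (cvg_comp _ _ p1 (@rc_continuous R _)).
  have q : (x.2 + n * (x.1 * x.1) / 2) @[x --> y] --> y.2 + n * (y.1 * y.1) / 2.
    apply: cvgD; first exact: p2.
    apply: cvgM; last exact: cvg_cst.
    by apply: cvgM; [exact: cvg_cst | exact: (cvgM p1 p1)].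
  have c2 := cvg_comp _ _ q (@rc_continuous R _).
  apply: cvg_pairN; first exact: (cvgM c1 (cvg_cst b)).
  exact: (cvgD c2 (cvgM c1 (cvg_cst (K / 2)))).
have cchi : continuous chi.
  move=> z.
  have c1 : (x.1 @[x --> z]) --> z.1 by exact: (@cvg_comp1 _ _ (nbhs z) _ id z cvg_id).
  have c2 : (x.2 @[x --> z]) --> z.2 by exact: (@cvg_comp2 _ _ (nbhs z) _ id z cvg_id).
  have d1 : re (x.1 / b) @[x --> z] --> re (z.1 / b).
    exact: (cvg_comp _ _ (cvgM c1 (cvg_cst b^-1)) (@re_continuous R _)).
  have d2 : re x.2 @[x --> z] --> re z.2 by exact: (cvg_comp _ _ c2 (@re_continuous R _)).
  have d3 : (re x.2 - n * (re (x.1 / b) * re (x.1 / b)) / 2) @[x --> z] -->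
      re z.2 - n * (re (z.1 / b) * re (z.1 / b)) / 2.
    apply: cvgB; first exact: d2.
    apply: cvgM; last exact: cvg_cst.
    by apply: cvgM; [exact: cvg_cst | exact: (cvgM d1 d1)].
  exact: (cvg_pair d1 d3).
have reK : re K = 0.
  by have := congr1 (@re R) KJ; rewrite reJ reN; lra.
have rePsi y : re (psi y).2 = y.2 + n * (y.1 * y.1) / 2.
  rewrite /psi /= reD re_rc.
  have -> : rc y.1 * (K / 2) = rc (y.1 / 2) * K by rewrite rc_half; ring.
  by rewrite reM re_rc im_rc reK mulr0 mul0r subrr addr0.
have psiK : cancel psi chi.
  by move=> y; rewrite /chi rePsi /psi /= mulfK // re_rc addrK -surjective_pairing.
have psiD x y : psi (x + y) = hop 1 (psi x) (psi y).
  rewrite /psi /hop /= cjM rcJ mul1r; congr (_, _); first by rewrite rcD mulrDl.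
  have -> : rc x.1 * b^* * (rc y.1 * b) = rc (x.1 * y.1 * n) by rewrite !rcM -nE; ring.
  have -> : x.2 + y.2 + n * ((x.1 + y.1) * (x.1 + y.1)) / 2 =
     (x.2 + n * (x.1 * x.1) / 2) + (y.2 + n * (y.1 * y.1) / 2) + x.1 * y.1 * n by field.
  by rewrite !(rcD (_ + _)) (rcD x.1); ring.
have Fpsi y : kod (psi y) = psi y.
  rewrite /kod /psi /= kod_unit mul1r !cjD !cjM /= !rcJ; congr (_, _).
    by rewrite mulrCA -bE.
  by rewrite KJ cjV cj_nat KE; field.
have chiK v : kod v = v -> psi (chi v) = v.
  case: v => x y [E1 E2]; rewrite /psi /chi /=.
  have xE : x = rc (re (x / b)) * b.
    by rewrite -conj_real ?divfK //; exact: (conj_ratio (esym E1) bE b0).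
  congr (_, _); first by rewrite -xE.
  set s := re (x / b) in xE *; rewrite subrK reE.
  rewrite kod_unit mul1r in E2.
  have -> : rc s * (K / 2) = (y - y^*) / 2.
    by rewrite -{1}E2 xE cjM rcJ KE; field.
  by field.
have [P [P1 P2]] := kodaira_classes.
have := fixed_locus_tori latL covp pF kod_hop kodK kod_continuous FL cpsi cchi psiK psiD Fpsi chiK P1 P2 fixs.
by rewrite card_prod card_bool.
Qed.

End KodairaCase.

Section Projections.
Variable R : realType.
Notation C := (cplx R).

Lemma fst_differentiable (z : C * C) : differentiable (fun w : C * C => w.1) z.
Proof.
have H := @linear_differentiable C (C * C)%type C^o (fst : {linear (C * C)%type -> C^o}) z.
have c : continuous (fst : C * C -> C) by move=> x; exact: cvg_fst.
exact: (H c).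
Qed.

Lemma snd_differentiable (z : C * C) : differentiable (fun w : C * C => w.2) z.
Proof.
have H := @linear_differentiable C (C * C)%type C^o (snd : {linear (C * C)%type -> C^o}) z.
have c : continuous (snd : C * C -> C) by move=> x; exact: cvg_snd.
exact: (H c).
Qed.

Lemma quadratic_differentiable (m n : C) (z : C * C) :
  differentiable (fun u : C * C => m * u.2 + n * (u.1 * u.1)) z.
Proof.
have d1 := fst_differentiable z; have d2 := snd_differentiable z.
exact: (differentiableD (differentiableM (differentiable_cst m z) d2)
  (differentiableM (differentiable_cst n z) (differentiableM d1 d1))).
Qed.

End Projections.

(** * Moving a fixed point to the origin *)

Section RealLocus.
Variable R : realType.
Notation C := (cplx R).
Notation N := (C * C)%type.
Variables (e : C) (L : set N) (S : topologicalType) (p : N -> S) (sigma : S -> S).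
Hypotheses (latL : lattice e L) (covp : covering e L p).
Hypotheses (sigmaK : involutive sigma).
Hypothesis sigma_loc : forall z : N, exists (U : set N) (f : N -> N),
  [/\ open U, U z, forall w, U w -> antiholo f w & forall w, U w -> sigma (p w) = p (f w)].

Section BasePoint.
Variable x0 : N.
(** Precomposing [p] with left translation by [x0] replaces the deck group by its conjugate under
    [x0]; left translations are holomorphic, so the local form of [sigma] is kept. *)
Definition conj_lattice : set N := [set v | L (hop e (hop e x0 v) (hinv e x0))].
Definition shift_cover (z : N) : S := p (hop e x0 z).

Lemma conj_lattice_lattice : lattice e conj_lattice.
Proof.
split.
- by rewrite /conj_lattice /= -!hopA !hop_simp; exact: lattice0 latL.
- move=> u v Lu Lv; have := latticeM latL Lu Lv; congr (L _).
  by rewrite -!hopA !hop_simp.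
- move=> u Lu; have := latticeV latL Lu; congr (L _).
  by rewrite !hinvM hinvK -!hopA.
- move=> r.
  have cf : continuous (fun v => hop e (hop e x0 v) (hinv e x0)).
    move=> v; apply: cvg_hop; last exact: cvg_cst.
    by apply: cvg_hop; [exact: cvg_cst | exact: cvg_id].
  have [B HB] := continuous_bounded_ball (@box2_compact R r) cf.
  have := finite_image (fun u => hop e (hinv e x0) (hop e u x0)) (lattice_fin latL B).
  apply: sub_finite_set => v [Lv vr]; exists (hop e (hop e x0 v) (hinv e x0)).
    by split; [exact: Lv | apply: HB; exact: nrm2_box2].
  by rewrite -!hopA !hop_simp.
have [r Hr] := lattice_cocompact latL.
have [B HB] := continuous_bounded_ball (@box2_compact R r) (@hop_continuous R e (hinv e x0)).
exists B => z; have [u Lu uz] := Hr (hop e x0 z).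
exists (hop e (hinv e x0) (hop e u x0)); first by rewrite /conj_lattice /= -!hopA !hop_simp.
by rewrite -!hopA; apply: HB; exact: nrm2_box2.
Qed.

Lemma shift_cover_covering : covering e conj_lattice shift_cover.
Proof.
split.
- move=> z; apply: (@continuous_comp _ _ _ (hop e x0) p); first exact: hop_continuous.
  exact: covering_continuous covp _.
- move=> U oU.
  have -> : shift_cover @` U = p @` (hop e (hinv e x0) @^-1` U).
    apply/seteqP; split=> [_ [z Uz <-]|_ [z Uz <-]].
      by exists (hop e x0 z); rewrite // /preimage /= hopK.
    by exists (hop e (hinv e x0) z) => //; rewrite /shift_cover hopVK.
  apply: (covering_open covp); apply: open_comp oU => z _; exact: hop_continuous.
- move=> s; have [z <-] := covering_surj covp s; exists (hop e (hinv e x0) z).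
  by rewrite /shift_cover hopVK.
- move=> z w; split=> [/(covering_fiber covp)[u Lu E]|[v Lv ->]].
    exists (hop e (hinv e x0) (hop e u x0)); first by rewrite /conj_lattice /= -!hopA !hop_simp.
    by rewrite -!hopA -E !hop_simp.
  apply/(covering_fiber covp); exists (hop e (hop e x0 v) (hinv e x0)) => //.
  by rewrite -!hopA !hop_simp.
Qed.

Lemma hop_differentiable (u z : N) : differentiable (hop e u) z.
Proof.
have d1 : differentiable (fun w : N => w.1) z by exact: fst_differentiable.
have d2 : differentiable (fun w : N => w.2) z by exact: snd_differentiable.
apply: differentiable_pair.
  exact: (differentiableD (differentiable_cst u.1 z) d1).
apply: differentiableD; first exact: (differentiableD (differentiable_cst u.2 z) d2).
exact: (differentiableM (differentiable_cst (e * u.1^*) z) d1).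
Qed.

Lemma antiholo_hop (u w : N) (f : N -> N) : antiholo f (hop e u w) ->
  antiholo (fun z => hop e (hinv e u) (f (hop e u z))) w.
Proof.
move: (hinv e u) => v [d1 d2].
have c1 : differentiable (fun z => (f (hop e u z)).1^*) w.
  exact: (differentiable_comp (hop_differentiable u w) d1).
have c2 : differentiable (fun z => (f (hop e u z)).2^*) w.
  exact: (differentiable_comp (hop_differentiable u w) d2).
split.
  have -> : (fun z => (hop e v (f (hop e u z))).1^*) = (fun z => v.1^* + (f (hop e u z)).1^*).
    by apply/funext => z; rewrite /hop /= cjD.
  exact: (differentiableD (differentiable_cst (v.1^*) w) c1).
have -> : (fun z => (hop e v (f (hop e u z))).2^*) =
   (fun z => v.2^* + (f (hop e u z)).2^* + (e^* * v.1) * (f (hop e u z)).1^*).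
  by apply/funext => z; rewrite /hop /= !cjD !cjM conjCK.
apply: differentiableD; first exact: (differentiableD (differentiable_cst (v.2^*) w) c2).
exact: (differentiableM (differentiable_cst (e^* * v.1) w) c1).
Qed.

Lemma shift_cover_loc (z : N) : exists (U : set N) (f : N -> N),
  [/\ open U, U z, forall w, U w -> antiholo f w &
      forall w, U w -> sigma (shift_cover w) = shift_cover (f w)].
Proof.
have [U [f [oU Uz af pf]]] := sigma_loc (hop e x0 z).
exists (hop e x0 @^-1` U), (fun w => hop e (hinv e x0) (f (hop e x0 w))); split.
- by apply: open_comp oU => w _; exact: hop_continuous.
- exact: Uz.
- by move=> w Uw; apply: antiholo_hop; exact: af.
- by move=> w Uw; rewrite /shift_cover hopVK pf.
Qed.

End BasePoint.
End RealLocus.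

Theorem real_locus_tori (R : realType) (e : cplx R) (L : set (cplx R * cplx R))
    (S : topologicalType) (p : cplx R * cplx R -> S) (sigma : S -> S) :
  e = 0 \/ e = 1 -> lattice e L -> covering e L p -> involutive sigma ->
  (forall z : cplx R * cplx R, exists (U : set (cplx R * cplx R)) f,
    [/\ open U, U z, forall w, U w -> antiholo f w & forall w, U w -> sigma (p w) = p (f w)]) ->
  (exists s, sigma s = s) ->
  exists t : nat, (1 <= t <= 4)%N /\
    homeomorphic [set s | sigma s = s] {i : 'I_t & torus R}.
Proof.
move=> e01 latL covp sigmaK sigma_loc fixs.
have [s Fs] := fixs; have [x0 x0s] := covering_surj covp s.
have := conj_lattice_lattice latL x0; have := shift_cover_covering covp x0.
have := shift_cover_loc e sigma_loc x0.
have : sigma (shift_cover e p x0 0) = shift_cover e p x0 0 by rewrite /shift_cover hopz0 x0s.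
move: (conj_lattice e L x0) (shift_cover e p x0) => L' p' fix0 loc' covp' latL'.
have [F [F0 pF FK FLM [cF FE]]] := lift_involution latL' covp' sigmaK loc' fix0.
have FL u : L' u -> L' (F u) by move=> /(FLM u 0)[].
have FM u z : L' u -> F (hop e u z) = hop e (F u) (F z) by move=> /(FLM u z)[].
clear FLM latL covp; case: e01 => e_val; subst e.
  have [a [b [c [d Fz]]]] := rigid_torus latL' F0 cF FM FE.
  have EF : F = antilin a b c d by apply/funext => z; rewrite Fz.
  by subst F; have H := torus_case FK latL' covp' pF; exact: H FL fixs.
have [a [d Fz]] := rigid_kodaira latL' F0 FK FL FM FE.
have EF : F = kod a d by apply/funext => z; rewrite Fz.
by subst F; have H := kodaira_case FK latL' covp' pF; exact: H FL fixs.
Qed.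

(** * Normal form of the group *)

Section TriangularGroups.
Variable R : realType.
Notation C := (cplx R).
Notation N := (C * C)%type.

Lemma real_decomposition (a1 a2 a : C) : im (a1^* * a2) != 0 ->
  exists s t : R, a = rc s * a1 + rc t * a2.
Proof.
move=> h; exists (im (a^* * a2) / im (a1^* * a2)), (im (a1^* * a) / im (a1^* * a2)).
have imE (u v : C) : im (u^* * v) = re u * im v - im u * re v.
  by rewrite imM reJ imJ; ring.
rewrite !imE in h *.
by apply: ceq; rewrite ?(reD, imD, reM, imM, re_rc, im_rc); field.
Qed.

Variable T : C -> C -> C -> Prop.
Hypothesis T0 : T 0 0 0.
Hypothesis TM : forall a b c a' b' c', T a b c -> T a' b' c' ->
  T (a + a') (b + b' + c * a') (c + c').
Hypothesis TV : forall a b c, T a b c -> T (- a) (- b + c * a) (- c).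
Hypothesis Tfree : forall b c, T 0 b c -> c = 0.
Hypothesis Tfin : forall r : R,
  finite_set [set t : C * C * C | T t.1.1 t.1.2 t.2 /\ nrm t.1.1 <= r /\ nrm t.1.2 <= r].
Hypothesis Tcoc : exists r : R, forall x y : C, exists a b c,
  [/\ T a b c, nrm (a + x) <= r & nrm (y + c * x + b) <= r].

(** [T a b c] stands for membership of the map (x, y) |-> (x + a, y + c x + b). Forgetting b is a
    homomorphism to C^2, and [slopes] is its image. *)
Definition slopes : set N := [set w | exists b, T w.1 b w.2].
(** The commutator pairing: the commutator of two elements is the translation by (0, omega). *)
Definition omega (w w' : N) : C := w.2 * w'.1 - w'.2 * w.1.

Lemma slopes0 : slopes 0. Proof. by exists 0. Qed.

Lemma slopesB (w w' : N) : slopes w -> slopes w' -> slopes (w - w').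
Proof. by move=> [b Tb] [b' Tb']; eexists; exact: TM Tb (TV Tb'). Qed.

Lemma omega_mem w w' : slopes w -> slopes w' -> T 0 (omega w w') 0.
Proof.
move=> [b Tb] [b' Tb']; have := TM (TM Tb Tb') (TV (TM Tb' Tb)).
by congr T; rewrite /omega; ring.
Qed.

Lemma fiber_sub l l' : T 0 l 0 -> T 0 l' 0 -> T 0 (l - l') 0.
Proof. by move=> h h'; have := TM h (TV h'); congr T; ring. Qed.

(** If the base coordinates of the pair are dependent over R, take a third element transverse to the
    first. Either it already pairs nontrivially with the first, or adding it to the second keeps the
    pairing and restores independence. Freeness ensures that the first base coordinate is
    nonzero. *)
Lemma nontrivial_pair : (exists w w', [/\ slopes w, slopes w' & omega w w' != 0]) ->
  exists w w', [/\ slopes w, slopes w', omega w w' != 0 & im (w.1^* * w'.1) != 0].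
Proof.
move=> [w1 [w2 [H1 H2 o12]]].
have [i12|i12] := eqVneq (im (w1.1^* * w2.1)) 0; last by exists w1, w2.
have a10 : w1.1 != 0.
  apply: contra o12 => /eqP a10.
  have c10 : w1.2 = 0.
    by have [b] := H1; rewrite a10 => /Tfree.
  by rewrite /omega a10 c10 mul0r mulr0 subrr.
have [r Hr] := Tcoc.
have [|a3 [c3 H3] i13] := @transverse_element R [set a | exists c, slopes (a, c)] r w1.1 a10.
  by move=> z; have [a [b [c [Tabc h _]]]] := Hr z 0; exists a => //; exists c, b.
have [h13|h13] := eqVneq (omega w1 (a3, c3)) 0; last by exists w1, (a3, c3).
have H23 : slopes (w2 + (a3, c3)).
  by rewrite -[(a3, c3)]opprK; apply: slopesB => //; rewrite -sub0r; apply: slopesB => //; exact: slopes0.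
exists w1, (w2 + (a3, c3)); split=> //.
  have -> : omega w1 (w2 + (a3, c3)) = omega w1 w2 + omega w1 (a3, c3) by rewrite /omega /=; ring.
  by rewrite h13 addr0.
by rewrite /= mulrDr imD i12 add0r.
Qed.

Section NonTrivial.
Variables w1 w2 : N.
Hypotheses (H1 : slopes w1) (H2 : slopes w2) (o12 : omega w1 w2 != 0).
Hypothesis i12 : im (w1.1^* * w2.1) != 0.

(* When the translations (0, l) of the group span only a real line, the coordinates
   of w.1 in the basis w1.1, w2.1 are ratios of commutators, hence real. *)
Lemma slope_linear_narrow : (forall l, T 0 l 0 -> im ((omega w1 w2)^* * l) = 0) ->
  forall w, slopes w -> exists s t : R,
    w.1 = rc s * w1.1 + rc t * w2.1 /\ w.2 = rc s * w1.2 + rc t * w2.2.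
Proof.
move=> narrow w Hw; have o0 := o12; set om := omega w1 w2 in o0 narrow.
have real l : T 0 l 0 -> l / om = rc (re (l / om)).
  move=> /narrow /eqP h; apply: conj_real; rewrite cjM cjV.
  have om'0 : om^* != 0 by rewrite conjC_eq0.
  have E : l^* * om = l * om^*.
    have : (om^* * l)^* = om^* * l.
      by apply: ceq; rewrite ?reJ // imJ; move/eqP: h => ->; rewrite oppr0.
    by rewrite cjM conjCK [om * _]mulrC [om^* * l]mulrC.
  by apply: (mulIf o0); apply: (mulIf om'0); rewrite divfK // mulrAC divfK.
exists (re (omega w w2 / om)), (re (omega w1 w / om)).
rewrite -!real; [|exact: omega_mem|exact: omega_mem].
by split; rewrite /om /omega in o0 *; field.
Qed.

(* Otherwise these translations span C and w.2 stays bounded when w.1 does, so that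
   an additive defect of linearity, which scales with n, must vanish. *)
Lemma slope_bounded l0 (rho : R) : T 0 l0 0 -> im ((omega w1 w2)^* * l0) != 0 ->
  exists M : R, forall w, slopes w -> nrm w.1 <= rho -> nrm w.2 <= M.
Proof.
move=> Tl0 i0; set o := omega w1 w2 in i0; have To : T 0 o 0 := omega_mem H1 H2.
pose r := Num.max rho (nrm o + nrm l0).
have [M HM] := finite_set_bounded (fun t : C * C * C => nrm t.2) (Tfin r).
exists M => -[a c] [b Tb] /= ar.
have [s [t bE]] := real_decomposition b i0.
pose m := Num.floor s; pose n := Num.floor t.
have lat (l : C) (k : int) : T 0 l 0 -> T 0 (l *~ k) 0.
  by move=> Tl; apply: (@subgroup_mulz C [set l | T 0 l 0] l k T0 _ Tl) => x y; exact: fiber_sub.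
(* Fibre translations reduce [b] to a bounded value without touching [a] and [c], so local
   finiteness bounds [c]. *)
pose l := o *~ (- m) - l0 *~ n.
have Tl : T 0 l 0 by apply: fiber_sub; exact: lat.
have Tb' : T a (l + b) c by have := TM Tl Tb; rewrite !add0r mul0r addr0.
apply: (HM (a, l + b, c)); split=> //=; split.
  by apply: (le_trans ar); rewrite le_max lexx.
have /andP[s1 s2] := floor_itv s; have /andP[t1 t2] := floor_itv t.
rewrite intrD mulr1z -/m in s2; rewrite intrD mulr1z -/n in t2.
have -> : l + b = rc (s - m%:~R) * o + rc (t - n%:~R) * l0.
  by rewrite bE /l -(mulrzl o) -(mulrzl l0) mulrNz !rcB !rc_int; ring.
apply: (@le_trans _ _ (nrm o + nrm l0)); last by rewrite le_max lexx orbT.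
apply: (le_trans (nrmD _ _)); rewrite !nrmM !nrm_rc; apply: lerD.
  by rewrite -[leRHS]mul1r ler_wpM2r ?nrm_ge0 // ler_norml; rewrite /m in s2 *; lra.
by rewrite -[leRHS]mul1r ler_wpM2r ?nrm_ge0 // ler_norml; rewrite /n in t2 *; lra.
Qed.

Lemma slope_linear w : slopes w -> exists s t : R,
  w.1 = rc s * w1.1 + rc t * w2.1 /\ w.2 = rc s * w1.2 + rc t * w2.2.
Proof.
move=> Hw.
have [[l0 [Tl0 i0]]|narrow] := pselect (exists l, T 0 l 0 /\ im ((omega w1 w2)^* * l) != 0); last first.
  apply: slope_linear_narrow => // l Tl; apply: contrapT => /eqP h.
  by apply: narrow; exists l.
have [M HM] := slope_bounded (nrm w1.1 + nrm w2.1) Tl0 i0.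
have [s [t aE]] := real_decomposition w.1 i12.
exists s, t; split=> //; set c0 := rc s * w1.2 + rc t * w2.2.
apply/eqP; rewrite -subr_eq0; apply: contrapT => /negP D0.
have nD := nrm_gt0 D0; set D := w.2 - c0 in D0 nD.
pose M' := M + nrm w1.2 + nrm w2.2.
(* Rounding the real coefficients of n w to integers leaves an element with bounded base coordinate,
   hence bounded slope, whereas the defect of linearity is multiplied by n. *)
have bnd (n : nat) : n%:R * nrm D <= M'.
  pose k := Num.floor (n%:R * s); pose l := Num.floor (n%:R * t).
  have /andP[s1 s2] := floor_itv (n%:R * s); have /andP[t1 t2] := floor_itv (n%:R * t).
  rewrite intrD mulr1z -/k in s2; rewrite intrD mulr1z -/l in t2.
  rewrite -/k in s1; rewrite -/l in t1.
  have n1 : `|n%:R * s - k%:~R| <= 1 by rewrite ler_norml; lra.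
  have n2 : `|n%:R * t - l%:~R| <= 1 by rewrite ler_norml; lra.
  have bb (x y : C) : nrm (rc (n%:R * s - k%:~R) * x + rc (n%:R * t - l%:~R) * y) <= nrm x + nrm y.
    apply: (le_trans (nrmD _ _)); rewrite !nrmM !nrm_rc; apply: lerD;
      by rewrite -[leRHS]mul1r ler_wpM2r ?nrm_ge0.
  pose v := w *~ n%:Z - w1 *~ k - w2 *~ l.
  have mul (u : N) (j : int) : slopes u -> slopes (u *~ j).
    by move=> Hu; exact: (subgroup_mulz j slopes0 slopesB Hu).
  have Hv : slopes v by apply: slopesB; [apply: slopesB|]; exact: mul.
  have v1 : v.1 = rc (n%:R * s - k%:~R) * w1.1 + rc (n%:R * t - l%:~R) * w2.1.
    by rewrite /v !pair_mulz /= aE !rcB !rcM !rc_int rc_nat -pmulrn; ring.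
  have v2 : n%:R * D = v.2 - (rc (n%:R * s - k%:~R) * w1.2 + rc (n%:R * t - l%:~R) * w2.2).
    by rewrite /v !pair_mulz /= /D /c0 !rcB !rcM !rc_int rc_nat -pmulrn; ring.
  have -> : n%:R * nrm D = nrm (n%:R * D).
    by rewrite nrmM -rc_nat nrm_rc normr_nat.
  rewrite v2; apply: (le_trans (nrmB _ _)); rewrite /M' -addrA; apply: lerD; last exact: bb.
  by apply: HM => //; rewrite v1; exact: bb.
have M0 : 0 <= M' by apply: le_trans (bnd 0%N); rewrite mul0r.
have /andP[_] := truncn_itv (divr_ge0 M0 (ltW nD)).
by rewrite ltr_pdivrMr // ltNge bnd.
Qed.

End NonTrivial.

(** With a nonzero commutator, c is real-linear in a, that is c = k a + l conj(a), and l is a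
    nonzero multiple of the commutator; then [e = 1]. If all commutators vanish, c is a complex
    multiple of a, and [e = 0], [l = 1]. *)
Lemma slope_form : exists k l e : C, [/\ l != 0, e = 0 \/ e = 1 &
  forall a b c, T a b c -> c = k * a + l * e * a^*].
Proof.
have [/nontrivial_pair[w1 [w2 [H1 H2 o12 i12]]]|triv] :=
    pselect (exists w w', [/\ slopes w, slopes w' & omega w w' != 0]).
  set a1 := w1.1 in i12; set a2 := w2.1 in i12.
  have d0 : a1 * a2^* - a2 * a1^* != 0.
    apply: contra i12 => /eqP /(congr1 (@im R)); rewrite imB [a2 * _]mulrC.
    have -> : im (a1 * a2^*) = - im (a1^* * a2) by rewrite -imJ cjM conjCK.
    rewrite /im /= => E; apply/eqP; move: E; rewrite -/(im _); lra.
  exists ((w1.2 * a2^* - w2.2 * a1^*) / (a1 * a2^* - a2 * a1^*)),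
    ((a1 * w2.2 - a2 * w1.2) / (a1 * a2^* - a2 * a1^*)), 1; split.
  - rewrite mulf_neq0 ?invr_eq0 //; apply: contra o12 => /eqP E.
    by rewrite /omega -oppr_eq0 -E /a1 /a2; apply/eqP; ring.
  - by right.
  - move=> a b c Tabc; have [s [t [/= -> ->]]] := slope_linear H1 H2 o12 i12 (ex_intro _ b Tabc : slopes (a, c)).
    by rewrite cjD !cjM !rcJ -/a1 -/a2; field.
have om0 w w' : slopes w -> slopes w' -> omega w w' = 0.
  by move=> H H'; apply: contrapT => /eqP h; apply: triv; exists w, w'.
have [[w [Hw w0]]|all0] := pselect (exists w, slopes w /\ w.1 != 0).
  exists (w.2 / w.1), 1, 0; split; [exact: oner_neq0 | by left|] => a b c Tabc.
  have := om0 (a, c) w (ex_intro _ b Tabc) Hw; rewrite /omega /= => /eqP; rewrite subr_eq0 => /eqP E.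
  by apply: (mulIf w0); rewrite E mulr0 mul0r addr0 mulrAC divfK.
exists 0, 1, 0; split; [exact: oner_neq0 | by left|] => a b c Tabc.
have a0 : a = 0.
  by apply: contrapT => /eqP a0; apply: all0; exists (a, c); split=> //; exists b.
by move: Tabc; rewrite a0 => /Tfree ->; ring.
Qed.

(** The image of the origin under each group element, read in the sheared coordinates; a left
    translation is determined by that image. *)
Definition normal_lattice (k l : C) : set N :=
  [set u | exists a b c, T a b c /\ u = (a, (b - k * a ^+ 2 / 2) / l)].

Lemma normal_lattice_lattice k l e : l != 0 ->
  (forall a b c, T a b c -> c = k * a + l * e * a^*) -> lattice e (normal_lattice k l).
Proof.
move=> l0 Tc; split.
- by exists 0, 0, 0; split=> //; congr (_, _); rewrite expr0n /=; field.
- move=> _ _ [a [b [c [Tu ->]]]] [a' [b' [c' [Tv ->]]]]; do 3 eexists; split; first exact: TM Tu Tv.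
  by rewrite /hop /= (Tc _ _ _ Tu); congr (_, _); field.
- move=> _ [a [b [c [Tu ->]]]]; do 3 eexists; split; first exact: TV Tu.
  by rewrite /hinv /= (Tc _ _ _ Tu); congr (_, _); field.
- move=> r; pose r' := Num.max r (nrm l * r + nrm k * (r * r) / 2).
  have := finite_image (fun t : C * C * C => (t.1.1, (t.1.2 - k * t.1.1 ^+ 2 / 2) / l)) (Tfin r').
  apply: sub_finite_set => _ [[a [b [c [Tu ->]]]] ur]; exists (a, b, c) => //.
  have ar : nrm a <= r := le_trans (nrm2_fst (a, _)) ur.
  have br : nrm ((b - k * a ^+ 2 / 2) / l) <= r := le_trans (nrm2_snd (a, _)) ur.
  split=> //=; split; first by rewrite le_max ar.
  rewrite le_max; apply/orP; right.
  have -> : b = l * ((b - k * a ^+ 2 / 2) / l) + rc 2^-1 * (k * (a * a)).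
    by rewrite rcV rc_nat; field.
  have n0 := nrm_ge0 a.
  apply: (le_trans (nrmD _ _)); rewrite !nrmM nrm_rc ger0_norm ?invr_ge0 //; apply: lerD.
    by rewrite -nrmM ler_wpM2l ?nrm_ge0.
  by rewrite mulrC ler_wpM2r ?invr_ge0 // ler_wpM2l ?nrm_ge0 // ler_pM.
have [r Hr] := Tcoc; exists (r + (r + nrm k * (r * r) / 2) / nrm l) => -[x y].
have [a [b [c [Tu ax bx]]]] := Hr x (l * y + k * x ^+ 2 / 2).
exists (a, (b - k * a ^+ 2 / 2) / l); first by exists a, b, c.
have -> : hop e (a, (b - k * a ^+ 2 / 2) / l) (x, y) =
  (a + x, (l * y + k * x ^+ 2 / 2 + c * x + b - rc 2^-1 * (k * ((a + x) * (a + x)))) / l).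
  by rewrite /hop /= (Tc _ _ _ Tu) rcV rc_nat; congr (_, _); field.
rewrite /nrm2; apply: lerD; first exact: ax.
rewrite [nrm _]nrmM nrmV; rewrite ler_wpM2r ?invr_ge0 ?nrm_ge0 //.
apply: (le_trans (nrmB _ _)); apply: lerD => //.
rewrite !nrmM nrm_rc ger0_norm ?invr_ge0 // mulrC ler_wpM2r ?invr_ge0 //.
by rewrite ler_wpM2l ?nrm_ge0 // ler_pM // nrm_ge0.
Qed.

End TriangularGroups.

(** * Linear coordinates on C^2 adapted to a frame *)

Section Frames.
Variable R : realType.
Notation C := (cplx R).
Notation N := (C * C)%type.
Notation C2 := 'rV[C]_2.

Definition framed (v w : C2) (x : N) : C2 := x.1 *: v + x.2 *: w.
Definition coords (v w z : C2) : N :=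
  (dz1dz2 z w / dz1dz2 v w, dz1dz2 v z / dz1dz2 v w).

Lemma row2P (z z' : C2) : z 0 0 = z' 0 0 -> z 0 1 = z' 0 1 -> z = z'.
Proof.
move=> h0 h1; apply/rowP => i; rewrite -!/(_ 0 i).
by have [->|->] : i = 0 \/ i = 1 by case: i => -[|[|//]] ?; [left|right]; exact: val_inj.
Qed.

Lemma framedE v w x i : framed v w x 0 i = x.1 * v 0 i + x.2 * w 0 i.
Proof. by rewrite /framed !mxE. Qed.

Lemma dz1dz2_framed v w x y :
  dz1dz2 (framed v w x) (framed v w y) = (x.1 * y.2 - x.2 * y.1) * dz1dz2 v w.
Proof. by rewrite /dz1dz2 !framedE; ring. Qed.

Lemma framedK v w : dz1dz2 v w != 0 -> cancel (framed v w) (coords v w).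
Proof.
move=> D0 [x y]; rewrite /coords; rewrite /dz1dz2 in D0 *; rewrite !framedE /=.
by congr (_, _); field.
Qed.

Lemma coordsK v w : dz1dz2 v w != 0 -> cancel (coords v w) (framed v w).
Proof.
by move=> D0 z; apply: row2P; rewrite framedE /coords /=; rewrite /dz1dz2 in D0 *; field.
Qed.

Lemma coord_differentiable i (z : C2) : differentiable (fun u : C2 => u 0 i : C) z.
Proof. exact: differentiable_coord. Qed.

Lemma framed_differentiable v w (x : N) : differentiable (framed v w) x.
Proof.
have h1 := differentiableZl v (fst_differentiable x).
have h2 := differentiableZl w (snd_differentiable x).
exact: (differentiableD h1 h2).
Qed.

Lemma framed_continuous v w : continuous (framed v w).
Proof. by move=> x; apply: differentiable_continuous; exact: framed_differentiable. Qed.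

Lemma coords1_differentiable v w z : differentiable (fun u => (coords v w u).1) z.
Proof.
have -> : (fun u => (coords v w u).1) = (fun u : C2 =>
    w 0 1 / dz1dz2 v w * u 0 0 + - (w 0 0 / dz1dz2 v w) * u 0 1).
  by apply/funext => u; rewrite /coords /= {1}/dz1dz2; ring.
have h c i := differentiableM (differentiable_cst (c : C) z) (@coord_differentiable i z).
exact: (differentiableD (h _ _) (h _ _)).
Qed.

Lemma coords2_differentiable v w z : differentiable (fun u => (coords v w u).2) z.
Proof.
have -> : (fun u => (coords v w u).2) = (fun u : C2 =>
    v 0 0 / dz1dz2 v w * u 0 1 + - (v 0 1 / dz1dz2 v w) * u 0 0).
  by apply/funext => u; rewrite /coords /= {1}/dz1dz2; ring.
have h c i := differentiableM (differentiable_cst (c : C) z) (@coord_differentiable i z).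
exact: (differentiableD (h _ _) (h _ _)).
Qed.

Lemma coords_continuous v w : continuous (coords v w).
Proof.
move=> z; apply: (@cvg_pairN R _ (nbhs z) _ (fun u => (coords v w u).1) (fun u => (coords v w u).2)).
  exact: (differentiable_continuous (coords1_differentiable v w z)).
exact: (differentiable_continuous (coords2_differentiable v w z)).
Qed.

Lemma coords_antiholo v w (h : N -> C2) z :
  differentiable (@conj2 R \o h) z -> antiholo (coords v w \o h) z.
Proof.
move=> dh; have d i : differentiable (fun u => (h u 0 i)^*) z.
  have -> : (fun u => (h u 0 i)^*) = (fun u : C2 => u 0 i) \o (@conj2 R \o h).
    by apply/funext => u; rewrite /= mxE.
  exact: differentiable_comp dh (@coord_differentiable i _).
have dc c i := differentiableM (differentiable_cst (c : C) z) (d i).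
split.
  have -> : (fun u => ((coords v w \o h) u).1^*) = (fun u =>
      (w 0 1 / dz1dz2 v w)^* * (h u 0 0)^* + (- (w 0 0 / dz1dz2 v w))^* * (h u 0 1)^*).
    apply/funext => u; rewrite -!cjM -cjD /coords /=; congr (_ ^*).
    by rewrite {1}/dz1dz2; ring.
  exact: (differentiableD (dc _ _) (dc _ _)).
have -> : (fun u => ((coords v w \o h) u).2^*) = (fun u =>
    (v 0 0 / dz1dz2 v w)^* * (h u 0 1)^* + (- (v 0 1 / dz1dz2 v w))^* * (h u 0 0)^*).
  apply/funext => u; rewrite -!cjM -cjD /coords /=; congr (_ ^*).
  by rewrite {1}/dz1dz2; ring.
exact: (differentiableD (dc _ _) (dc _ _)).
Qed.

Lemma mulmx_continuous (A : 'M[C]_2) : continuous (fun z : C2 => z *m A).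
Proof.
have -> : (fun z : C2 => z *m A) = (fun z : C2 => z 0 0 *: row 0 A + z 0 1 *: row 1 A).
  apply/funext => z; apply/rowP => i; rewrite !mxE big_ord_recl big_ord1.
  by congr (_ + z 0 _ * A _ i); exact: val_inj.
move=> z; apply: differentiable_continuous.
exact: (differentiableD (differentiableZl _ (@coord_differentiable 0 z))
  (differentiableZl _ (@coord_differentiable 1 z))).
Qed.

Lemma affine_diff (A : 'M[C]_2) (b : C2) z u : 'd (fun z => z *m A + b) z u = u *m A.
Proof.
have cA : continuous (mulmxr A : C2 -> C2) by exact: mulmx_continuous.
have -> : (fun z => z *m A + b) = (mulmxr A : C2 -> C2) + cst b by [].
rewrite diffD; [|exact: linear_differentiable|exact: differentiable_cst].
have E1 : 'd (mulmxr A : C2 -> C2) z = mulmxr A :> (C2 -> C2) := diff_lin z cA.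
have E2 : 'd (cst b : C2 -> C2) z = 0 :> (C2 -> C2) := diff_cst b z.
exact: (etrans (congr2 +%R (congr1 (@^~ u) E1) (congr1 (@^~ u) E2)) (addr0 _)).
Qed.

Lemma affine_continuous (g : C2 -> C2) : affine g -> continuous g.
Proof.
move=> [A [b [_ gE]]]; have -> : g = fun z => z *m A + b by exact/funext.
move=> z; apply: (@cvgD _ _ _ (nbhs z) (nbhs_filter z) (fun z => z *m A) (cst b)).
  exact: mulmx_continuous.
exact: cvg_cst.
Qed.

End Frames.

Section UnipotentFrame.
Variables (R : realType) (G : affine_group R).
Notation C := (cplx R).
Notation C2 := 'rV[C]_2.
Hypothesis G_free : acts_freely G.
Hypothesis G_form : preserves_dz1dz2 G.

(* By freeness: a trace different from 2 would give a fixed point. *)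
Lemma affine_coords v w g : dz1dz2 v w != 0 -> G g -> exists p q r s b1 b2 : C,
  [/\ forall x y, g (framed v w (x, y)) = framed v w (p * x + r * y + b1, q * x + s * y + b2),
      p * s - q * r = 1 & p + s = 2].
Proof.
move=> D0 Gg; have [A [b [_ gE]]] := elements_affine Gg.
pose P := coords v w (v *m A); pose Q := coords v w (w *m A); pose B := coords v w b.
have vA : v *m A = framed v w P by rewrite coordsK.
have wA : w *m A = framed v w Q by rewrite coordsK.
have bE : b = framed v w B by rewrite coordsK.
clearbody P Q B.
have form x y : g (framed v w (x, y)) =
    framed v w (P.1 * x + Q.1 * y + B.1, P.2 * x + Q.2 * y + B.2).
  rewrite gE {1}/framed /= mulmxDl -!scalemxAl vA wA {1}bE.
  by apply: row2P; rewrite /framed !mxE /=; ring.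
have det1 : P.1 * Q.2 - P.2 * Q.1 = 1.
  have := G_form Gg 0 v w; have -> : g = fun z => z *m A + b by exact/funext.
  rewrite !affine_diff vA wA dz1dz2_framed => /eqP.
  by rewrite -subr_eq0 -{2}[dz1dz2 v w]mul1r -mulrBl mulf_eq0 (negPf D0) orbF subr_eq0 => /eqP.
exists P.1, P.2, Q.1, Q.2, B.1, B.2; split=> //.
move: P.1 P.2 Q.1 Q.2 B.1 B.2 form det1 => p q r s b1 b2 form det1.
apply: contrapT => /eqP tr2.
(* Up to the relation of determinant 1, [2 - p - s] is the determinant of the linear part minus the
   identity. When it is nonzero, Cramer's rule gives the fixed point used next. *)
have Del0 : 2 - p - s != 0 by apply: contra tr2 => /eqP h; rewrite -subr_eq0 -oppr_eq0 -h; apply/eqP; ring.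
have frac (d n m a c k l : C) : d != 0 -> a * n + c * m + k * d = l ->
    a * (n / d) + c * (m / d) + k = l / d.
  by move=> d0 <-; field.
have gid : g = id.
  apply: (G_free (z := framed v w (((1 - s) * b1 + r * b2) / (2 - p - s),
    ((1 - p) * b2 + q * b1) / (2 - p - s)))) => //.
  have E1 : p * s = 1 + q * r by rewrite -det1; ring.
  rewrite form; congr (framed v w (_, _)); apply: frac => //.
    transitivity ((1 - s) * b1 + r * b2 + b1 * (1 + q * r - p * s)); first by ring.
    by rewrite E1 subrr mulr0 addr0.
  transitivity ((1 - p) * b2 + q * b1 + b2 * (1 + q * r - p * s)); first by ring.
  by rewrite E1 subrr mulr0 addr0.
have g00 := form 0 0; have g10 := form 1 0; have g01 := form 0 1.
rewrite gid !(mulr0, mulr1, add0r, addr0) /= in g00 g10 g01.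
have inj := can_inj (framedK D0).
have [z1 z2] := inj _ _ g00.
have [y1 y2] := inj _ _ g10.
have [x1 x2] := inj _ _ g01.
move/eqP: tr2; apply.
move: y1 x2; rewrite -z1 -z2 !addr0 => <- <-; ring.
Qed.

(* Kolchin's theorem in dimension 2, for the unipotent linear parts of [G]. *)
Lemma triangular_frame : exists v w : C2, dz1dz2 v w != 0 /\
  forall g, G g -> exists a b c : C, forall x y,
    g (framed v w (x, y)) = framed v w (x + a, y + c * x + b).
Proof.
pose e1 : C2 := delta_mx 0 0; pose e2 : C2 := delta_mx 0 1.
have e12 : dz1dz2 e1 e2 = 1 by rewrite /dz1dz2 !mxE /= mulr1 mulr0 subr0.
have D12 : dz1dz2 e1 e2 != 0 by rewrite e12 oner_neq0.
have [trans|] := pselect (forall g, G g -> exists a b : C, forall x y,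
    g (framed e1 e2 (x, y)) = framed e1 e2 (x + a, y + b)).
  exists e1, e2; split=> // g /trans[a [b h]]; exists a, b, 0 => x y.
  by rewrite h mul0r addr0.
move=> /existsNP[g0 /not_implyP[Gg0 ntriv]].
(* With A the linear part of [g0], the frame is v and v (A - 1), where v is a standard basis vector
   not killed by A - 1; in it A becomes a single unipotent block. *)
have [v [w [D0 [a0 [b0 g0E]]]]] : exists v w : C2, dz1dz2 v w != 0 /\ exists a b : C, forall x y,
    g0 (framed v w (x, y)) = framed v w (x + a, y + x + b).
  have [p [q [r [s [b1 [b2 [g0E det1 tr2]]]]]]] := affine_coords D12 Gg0.
  have sE : s = 2 - p by rewrite -tr2; ring.
  subst s.
  have [q0|q0] := eqVneq q 0.
    subst q; have p1 : p = 1.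
      apply/eqP; rewrite -subr_eq0 -sqrf_eq0; apply/eqP.
      by transitivity (1 - (p * (2 - p) - 0 * r)); [ring | rewrite det1 subrr].
    subst p; have r0 : r != 0.
      apply/eqP => r0; apply: ntriv; exists b1, b2 => x y; rewrite g0E r0.
      by congr (framed _ _ (_, _)); ring.
    exists e2, (r *: e1); have D0 : dz1dz2 e2 (r *: e1) != 0.
      by rewrite /dz1dz2 !mxE /= !mulr0 !mulr1 mul1r sub0r oppr_eq0.
    split=> //; exists b2, (b1 / r) => x y.
    have -> : framed e2 (r *: e1) (x, y) = framed e1 e2 (r * y, x).
      by apply: row2P; rewrite !(framedE, mxE) /=; ring.
    by rewrite g0E; apply: row2P; rewrite !(framedE, mxE) /=; field.
  exists e1, (framed e1 e2 (p - 1, q)); have D0 : dz1dz2 e1 (framed e1 e2 (p - 1, q)) != 0.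
    by rewrite /dz1dz2 !(framedE, mxE) /=; rewrite !(mulr0, mulr1, add0r, addr0, mul1r, mul0r) subr0.
  split=> //; exists (b1 - (p - 1) / q * b2), (b2 / q) => x y.
  have -> : framed e1 (framed e1 e2 (p - 1, q)) (x, y) = framed e1 e2 (x + (p - 1) * y, q * y).
    by apply: row2P; rewrite !(framedE, mxE) /=; ring.
  rewrite g0E; apply: row2P; rewrite !(framedE, mxE) /=; last by field.
  have E : q * r = p * (2 - p) - (p * (2 - p) - q * r) by ring.
  rewrite det1 in E.
  rewrite !(mulr0, mulr1, addr0, add0r).
  rewrite [r * _]mulrA [r * q]mulrC E; field.
  exact: q0.
exists v, w; split=> // g Gg.
have [p [q [r [s [b1 [b2 [gE det1 tr2]]]]]]] := affine_coords D0 Gg.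
have [p' [q' [r' [s' [b1' [b2' [gE' _ tr2']]]]]]] := affine_coords D0 (elements_comp Gg0 Gg).
have inj := can_inj (framedK D0).
have comp x y : (p * x + r * y + b1 + a0, q * x + s * y + b2 + (p * x + r * y + b1) + b0) =
   (p' * x + r' * y + b1', q' * x + s' * y + b2').
  by apply: inj; rewrite -gE' /= gE g0E.
have [z1 z2] := comp 0 0; have [y1 y2] := comp 1 0; have [x1 x2] := comp 0 1.
rewrite !(mulr0, mulr1, add0r, addr0) in z1 z2 y1 y2 x1 x2.
(* The linear part of g0 g has trace p + s + r. Both this and p + s equal 2. *)
have r0 : r = 0.
  have -> : r = (p + b1 + a0) - (b1 + a0) + ((s + b2 + (r + b1) + b0) - (b2 + b1 + b0)) - (p + s) by ring.
  by rewrite y1 x2 z1 z2 tr2 -tr2'; ring.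
subst r.
have sE : s = 2 - p by rewrite -tr2; ring.
subst s.
have p1 : p = 1.
  apply/eqP; rewrite -subr_eq0 -sqrf_eq0; apply/eqP.
  by transitivity (1 - (p * (2 - p) - q * 0)); [ring | rewrite det1 subrr].
subst p; exists b1, b2, q => x y; rewrite gE; congr (framed _ _ (_, _)); ring.
Qed.

End UnipotentFrame.

(** * The surface as a quotient by a lattice *)

Section SurfaceCover.
Variables (R : realType) (G : affine_group R).
Notation C := (cplx R).
Notation N := (C * C)%type.
Notation C2 := 'rV[C]_2.

Lemma surface_piP (z w : C2) : surface_pi G z = surface_pi G w <-> exists2 g, G g & g z = w.
Proof.
split=> [/eqmodP/asboolP //|h].
by apply/eqmodP/asboolP.
Qed.

Lemma surface_pi_surj (s : surface G) : exists z, surface_pi G z = s.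
Proof. by exists (repr s); exact: reprK. Qed.

Lemma surface_pi_continuous : continuous (surface_pi G).
Proof. exact: pi_continuous. Qed.

Lemma surface_pi_open (U : set C2) : open U -> open (surface_pi G @` U).
Proof.
move=> oU; have E : surface_pi G @^-1` (surface_pi G @` U) =
    \bigcup_(g in [set g | G g]) (g @^-1` U).
  apply/seteqP; split=> [z [u Uu /esym/surface_piP[g Gg gz]]|z [g Gg Ugz]].
    by exists g => //; rewrite /preimage /= gz.
  by exists (g z) => //; apply/esym/surface_piP; exists g.
suff : open (surface_pi G @^-1` (surface_pi G @` U)) by [].
rewrite E; apply: bigcup_open => g Gg; apply: open_comp oU => z _.
exact: affine_continuous (elements_affine Gg) z.
Qed.

Hypothesis G_disc : properly_discontinuous G.
Hypothesis G_free : acts_freely G.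
Hypothesis G_cpt : compact [set: surface G].
Variables v w : C2.
Hypothesis D0 : dz1dz2 v w != 0.
Hypothesis G_tri : forall g, G g -> exists a b c : C, forall x y,
  g (framed v w (x, y)) = framed v w (x + a, y + c * x + b).

Definition triangular (a b c : C) : Prop :=
  exists2 g, G g & forall x y, g (framed v w (x, y)) = framed v w (x + a, y + c * x + b).

Let finj : injective (framed v w) := can_inj (framedK D0).

Lemma triangular0 : triangular 0 0 0.
Proof.
exists id; first exact: elements_id.
by move=> x y; rewrite mul0r !addr0.
Qed.

Lemma triangularM a b c a' b' c' : triangular a b c -> triangular a' b' c' ->
  triangular (a + a') (b + b' + c * a') (c + c').
Proof.
move=> [g Gg gE] [h Gh hE]; exists (g \o h); first exact: elements_comp.
by move=> x y; rewrite /= hE gE; congr (framed _ _ (_, _)); ring.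
Qed.

Lemma triangularV a b c : triangular a b c -> triangular (- a) (- b + c * a) (- c).
Proof.
move=> [g Gg gE]; have [h [Gh gK hK]] := elements_inv Gg; exists h => // x y.
by apply: (can_inj gK); rewrite hK gE; congr (framed _ _ (_, _)); ring.
Qed.

Lemma triangular_free b c : triangular 0 b c -> c = 0.
Proof.
move=> [g Gg gE]; apply: contrapT => /eqP c0.
have gid : g = id.
  apply: (G_free (z := framed v w (- b / c, 0))) => //.
  by rewrite gE; congr (framed _ _ (_, _)); [rewrite addr0 | field].
move: gE; rewrite gid => gE.
have E0 : 0 = 0 + c * 0 + b := congr1 snd (finj (gE 0 0)).
have E1 : 0 = 0 + c * 1 + b := congr1 snd (finj (gE 1 0)).
rewrite mulr0 !add0r in E0; rewrite mulr1 add0r -E0 in E1.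
by move/eqP: c0; apply; rewrite E1 addr0.
Qed.

(** An element with bounded a and b keeps the image of the origin in a compact set, so proper
    discontinuity applies; c is then recovered from the image of (1, 0). *)
Lemma triangular_finite (r : R) : finite_set [set t : C * C * C |
  triangular t.1.1 t.1.2 t.2 /\ nrm t.1.1 <= r /\ nrm t.1.2 <= r].
Proof.
pose K := framed v w @` box2 r.
have cK : compact K.
  apply: continuous_compact; last exact: box2_compact.
  by apply: continuous_subspaceT => z; exact: framed_continuous.
have [z0 z0E] : exists z, framed v w (0, 0) = z by eexists.
have [z1 z1E] : exists z, framed v w (1, 0) = z by eexists.
pose val g : C * C * C := (coords v w (g z0), (coords v w (g z1)).2 - (coords v w (g z0)).2).
apply: sub_finite_set (finite_image val (G_disc cK)) => -[[a b] c] /= [[g Gg gE] [ar br]].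
have r0 : 0 <= r := le_trans (nrm_ge0 a) ar.
have g00 : g z0 = framed v w (a, b) by rewrite -z0E gE mulr0 !add0r.
have g10 : g z1 = framed v w (1 + a, c + b) by rewrite -z1E gE mulr1 [0 + c]add0r.
exists g; last first.
  have c00 : coords v w (g z0) = (a, b) by rewrite g00; exact: framedK.
  have c10 : coords v w (g z1) = (1 + a, c + b) by rewrite g10; exact: framedK.
  rewrite /val c00 c10; transitivity (a, b, c + b - b); first by [].
  by rewrite addrK.
split=> //; exists (framed v w (a, b)); split.
  exists z0; last exact: g00.
  by exists (0, 0); [apply: nrm2_box2; rewrite /nrm2 nrm0 addr0 | exact: z0E].
by exists (a, b); [split; apply: nrm_cbox | reflexivity].
Qed.

(** The images of growing balls exhaust the compact surface, so one ball already covers it. *)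
Lemma triangular_cocompact : exists r : R, forall x y, exists a b c,
  [/\ triangular a b c, nrm (a + x) <= r & nrm (y + c * x + b) <= r].
Proof.
pose P (n : nat) (s : surface G) := exists2 z : N, nrm2 z <= n%:R & surface_pi G (framed v w z) = s.
have [n _ Pn] : \forall n \near \oo, [set: surface G] `<=` P n.
  move/compact_near_coveringP: G_cpt; apply => s _.
  have [z0 z0s] := surface_pi_surj s.
  pose m := Num.bound (nrm2 (coords v w z0)).
  have m0 : nrm2 (coords v w z0) < m%:R by exact: (archi_boundP (nrm2_ge0 _)).
  pose U := coords v w @^-1` [set z | nrm2 z < m%:R].
  have oU : open U.
    apply: (@open_comp _ _ (coords v w) [set z : N | nrm2 z < m%:R]) => [z _|].
      exact: coords_continuous.
    have := @open_comp _ _ (@nrm2 R) [set x : R | x < m%:R].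
    apply => [z _|]; [exact: nrm2_continuous | exact: open_lt].
  exists (surface_pi G @` U, [set n | (m <= n)%N]).
    split; last by exists m.
    apply: open_nbhs_nbhs; split; first exact: surface_pi_open.
    by exists z0.
  move=> [_ n] /= [[u Uu <-] mn]; exists (coords v w u); last by rewrite coordsK.
  by apply: le_trans (ltW Uu) _; rewrite ler_nat.
exists n%:R => x y; have [z zn] := Pn n (leqnn n) (surface_pi G (framed v w (x, y))) I.
move=> /esym/surface_piP[g Gg]; have [a [b [c gE]]] := G_tri Gg.
rewrite gE => /finj E; exists a, b, c; split; first by exists g.
  by rewrite addrC; apply: le_trans zn; rewrite -E; exact: (nrm2_fst (x + a, _)).
by apply: le_trans zn; rewrite -E; exact: (nrm2_snd (x + a, _)).
Qed.

Variables e k l : C.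
Hypothesis l0 : l != 0.
Hypothesis G_slope : forall a b c, triangular a b c -> c = k * a + l * e * a^*.

(** Since (x + a)^2 / 2 - x^2 / 2 = a x + a^2 / 2, the quadratic term absorbs the part k a x of c x.
    What remains is l e conj(a) x, the twist of the group law scaled by l. *)
Definition shear (z : N) : N := (z.1, l * z.2 + k * z.1 ^+ 2 / 2).
Definition unshear (z : N) : N := (z.1, (z.2 - k * z.1 ^+ 2 / 2) / l).

Lemma shearK : cancel shear unshear.
Proof. by move=> [x y]; rewrite /shear /unshear /=; congr (_, _); field. Qed.

Lemma unshearK : cancel unshear shear.
Proof. by move=> [x y]; rewrite /shear /unshear /=; congr (_, _); field. Qed.

Lemma shear_hop a b c z : c = k * a + l * e * a^* ->
  shear (hop e (a, (b - k * a ^+ 2 / 2) / l) z) =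
  ((shear z).1 + a, (shear z).2 + c * (shear z).1 + b).
Proof. by move=> ->; rewrite /shear /hop /=; congr (_, _); field. Qed.

Lemma shear2_differentiable z : differentiable (fun u : N => (shear u).2) z.
Proof.
have -> : (fun u : N => (shear u).2) = (fun u : N => l * u.2 + (k / 2) * (u.1 * u.1)).
  by apply/funext => u; rewrite /shear /= expr2; ring.
exact: quadratic_differentiable.
Qed.

Lemma unshear2_differentiable z : differentiable (fun u : N => (unshear u).2) z.
Proof.
have -> : (fun u : N => (unshear u).2) = (fun u : N => l^-1 * u.2 + (- k / 2 / l) * (u.1 * u.1)).
  by apply/funext => u; rewrite /unshear /= expr2; ring.
exact: quadratic_differentiable.
Qed.

Lemma unshear_antiholo (f : N -> N) z : antiholo f z -> antiholo (unshear \o f) z.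
Proof.
move=> [d1 d2]; split; first exact: d1.
have -> : (fun u => ((unshear \o f) u).2^*) =
    (fun u => (l^-1)^* * (f u).2^* + (- k / 2 / l)^* * ((f u).1^* * (f u).1^*)).
  by apply/funext => u; rewrite -!cjM -cjD /unshear /=; congr (_ ^*); ring.
exact: (differentiableD (differentiableM (differentiable_cst _ z) d2)
  (differentiableM (differentiable_cst _ z) (differentiableM d1 d1))).
Qed.

Lemma shear_continuous : continuous shear.
Proof.
move=> z; apply: (@cvg_pairN R _ (nbhs z) _ (fun u => (shear u).1) (fun u => (shear u).2)).
  exact: (differentiable_continuous (fst_differentiable z)).
exact: (differentiable_continuous (shear2_differentiable z)).
Qed.

Lemma unshear_continuous : continuous unshear.
Proof.
move=> z; apply: (@cvg_pairN R _ (nbhs z) _ (fun u => (unshear u).1) (fun u => (unshear u).2)).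
  exact: (differentiable_continuous (fst_differentiable z)).
exact: (differentiable_continuous (unshear2_differentiable z)).
Qed.

Definition surface_cover (z : N) : surface G := surface_pi G (framed v w (shear z)).

Lemma surface_cover_covering : covering e (normal_lattice triangular k l) surface_cover.
Proof.
split.
- move=> z; apply: (@continuous_comp _ _ _ (framed v w \o shear) (surface_pi G)).
    by apply: continuous_comp; [exact: shear_continuous | exact: framed_continuous].
  exact: surface_pi_continuous.
- move=> U oU.
  have -> : surface_cover @` U = surface_pi G @` (coords v w @^-1` (unshear @^-1` U)).
    apply/seteqP; split=> [_ [z Uz <-]|_ [z Uz <-]].
      by exists (framed v w (shear z)) => //; rewrite /preimage /= framedK // shearK.
    by exists (unshear (coords v w z)) => //; rewrite /surface_cover unshearK coordsK.
  apply: surface_pi_open; apply: open_comp => [z _|]; first exact: coords_continuous.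
  by apply: open_comp oU => z _; exact: unshear_continuous.
- move=> s; have [z <-] := surface_pi_surj s; exists (unshear (coords v w z)).
  by rewrite /surface_cover unshearK coordsK.
move=> z z'; split.
  move=> /surface_piP[g Gg]; have [a [b [c gE]]] := G_tri Gg.
  have Tabc : triangular a b c by exists g.
  rewrite [shear z]surjective_pairing gE => /finj E.
  exists (a, (b - k * a ^+ 2 / 2) / l); first by exists a, b, c.
  by apply: (can_inj shearK); rewrite (shear_hop _ _ (G_slope Tabc)) E.
move=> [_ [a [b [c [Tabc ->]]]] ->]; apply/surface_piP; have [g Gg gE] := Tabc.
by exists g => //; rewrite (shear_hop _ _ (G_slope Tabc)) [shear z]surjective_pairing gE.
Qed.

Variable sigma : surface G -> surface G.
Hypothesis sigma_antiholo : antiholomorphic sigma.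

Lemma surface_cover_loc (z : N) : exists (U : set N) (f : N -> N),
  [/\ open U, U z, forall u, U u -> antiholo f u &
      forall u, U u -> sigma (surface_cover u) = surface_cover (f u)].
Proof.
have [U [f [oU Uz af pf]]] := sigma_antiholo (framed v w (shear z)).
exists ((framed v w \o shear) @^-1` U), (unshear \o coords v w \o f \o framed v w \o shear).
have cfs : continuous (framed v w \o shear).
  by move=> u; apply: continuous_comp; [exact: shear_continuous | exact: framed_continuous].
split; first 1 [by apply: open_comp oU => u _; exact: cfs | exact: Uz].
  move=> u Uu; have := af _ Uu; move: (f) => f1 af1.
  have d0 : differentiable (@conj2 R \o f1 \o (framed v w \o shear)) u.
    apply: differentiable_comp af1; apply: differentiable_comp (framed_differentiable _ _ _).
    exact: differentiable_pair (fst_differentiable u) (shear2_differentiable u).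
  apply: unshear_antiholo; exact: (coords_antiholo v w d0).
by move=> u Uu; rewrite /surface_cover pf //= unshearK coordsK.
Qed.

End SurfaceCover.

Theorem corollary0p3 (R : realType) (G : affine_group R)
    (sigma : surface G -> surface G)
    (G_kodaira : primary_kodaira G)
    (sigma_antiholo : antiholomorphic sigma)
    (sigma_invol : involutive sigma) :
  real_part sigma = set0 \/
  exists t : nat, (1 <= t <= 4)%N /\
    homeomorphic (real_part sigma) {i : 'I_t & torus R}.
Proof.
have [G_disc G_free G_form G_cpt _] := G_kodaira.
have [[s Fs]|nofix] := pselect (exists s, sigma s = s); last first.
  by left; apply/seteqP; split=> // s Fs; case: nofix; exists s.
right; have [v [w [D0 G_tri]]] := triangular_frame G_free G_form.
have T0 := triangular0 G v w; have TM := @triangularM R G v w.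
have TV := @triangularV R G v w.
have Tfree := triangular_free G_free D0.
have Tfin := triangular_finite G_disc D0.
have Tcoc := triangular_cocompact G_cpt D0 G_tri.
have [k [l [e [l0 e01 slope]]]] := slope_form T0 TM TV Tfree Tfin Tcoc.
have latL := normal_lattice_lattice T0 TM TV Tfin Tcoc l0 slope.
have covp := surface_cover_covering D0 G_tri l0 slope.
have loc := surface_cover_loc D0 k l0 sigma_antiholo.
by apply: (real_locus_tori e01 latL covp sigma_invol loc); exists s.
Qed.
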